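(* Let $n\ge 3$, $0\le \delta<\frac{1}{n-2}$, let $\Omega\subset\mathbb{R}^n$ be open, and let $W\in C^2(\Omega)$ be $\delta$-convex. Then for every domain $\Omega'\subset\subset\Omega$, $$\|W\|_{C^{\gamma}(\Omega')}\le C_1\int_\Omega |W|,\qquad \gamma=\frac{1+(2-n)\delta}{1+\delta},$$ where $C_1$ depends only on $\Omega',\Omega,\delta$. Moreover, for every $p<p_\delta:=\frac{n(1+\delta)}{(n-1)\delta}$ (any $p<\infty$ if $\delta=0$), $$\Big(\int_{\Omega'}|\nabla W|^p\Big)^{1/p}\le C_2\int_\Omega|W|,$$ where $C_2$ depends only on $\Omega',\Omega,p$ (and $\delta$).
   Context: For $\delta\in\mathbb{R}$, define the cone $\Gamma_\delta=\{\lambda=(\lambda_1,\dots,\lambda_n)\in\mathbb{R}^n:\ \lambda_i>-\delta\sum_{j=1}^n\lambda_j \text{ for all } 1\le i\le n\}$, and let $\overline{\Gamma}_\delta$ be its closure. A symmetric matrix is said to lie in $\Gamma_\delta$ (resp. $\overline\Gamma_\delta$) if its $n$-tuple of eigenvalues does. A function $W\in C^2(\Omega)$ is called $\delta$-convex in $\Omega$ if $D^2W(x)\in\overline{\Gamma}_\delta$ for every $x\in\Omega$ (strictly $\delta$-convex if $D^2W\in\Gamma_\delta$). *)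

(* Defs.v *)
From HB Require Import structures.
From mathcomp Require Import all_boot all_order all_algebra.
From mathcomp Require Import all_classical all_reals all_analysis.
Set Implicit Arguments. Unset Strict Implicit. Unset Printing Implicit Defensive.
Import Order.TTheory GRing.Theory Num.Theory.
Import numFieldNormedType.Exports.
Local Open Scope classical_set_scope.
Local Open Scope ring_scope.

Section Defs.
Variable R : realType.

Definition evec n (i : 'I_n) : 'rV[R]_n := delta_mx 0 i.

Definition pderiv n (i : 'I_n) (f : 'rV[R]_n -> R) : 'rV[R]_n -> R :=
  fun x => 'D_(evec i) f x.

Definition C2_on n (Om : set 'rV[R]_n) (W : 'rV[R]_n -> R) : Prop :=
  forall x, Om x ->
    {for x, continuous W} /\
    (forall i, derivable W x (evec i) /\ {for x, continuous (pderiv i W)}) /\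
    (forall i j, derivable (pderiv i W) x (evec j) /\
                 {for x, continuous (pderiv j (pderiv i W))}).

Definition hessian n (W : 'rV[R]_n -> R) (x : 'rV[R]_n) : 'M[R]_n :=
  \matrix_(i, j) pderiv j (pderiv i W) x.

Definition Gamma n (delta : R) : set 'rV[R]_n :=
  [set l | forall i : 'I_n, l 0 i > - delta * \sum_(j < n) l 0 j].

(** a square matrix "lies in" a set S of n-tuples if its n-tuple of
    eigenvalues (the roots, with multiplicity, of its characteristic
    polynomial) lies in S; the cones are permutation invariant so the
    ordering of the tuple is irrelevant *)
Definition mx_in n (S : set 'rV[R]_n) (A : 'M[R]_n) : Prop :=
  exists l : 'rV[R]_n,
    char_poly A = \prod_(i < n) ('X - (l 0 i)%:P) /\ S l.

Definition delta_convex n (delta : R) (Om : set 'rV[R]_n) (W : 'rV[R]_n -> R) :=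
  C2_on Om W /\ forall x, Om x -> mx_in (closure (@Gamma n delta)) (hessian W x).

Definition enorm n (x : 'rV[R]_n) : R := Num.sqrt (\sum_(i < n) x 0 i ^+ 2).

Definition grad n (W : 'rV[R]_n -> R) (x : 'rV[R]_n) : 'rV[R]_n :=
  \row_i pderiv i W x.

Definition holder_norm n (gamma : R) (U : set 'rV[R]_n) (W : 'rV[R]_n -> R)
  : \bar R :=
  (ereal_sup [set (`|W x|)%:E | x in U] +
   ereal_sup [set (`|W xy.1 - W xy.2| / (enorm (xy.1 - xy.2)) `^ gamma)%:E |
              xy in [set xy : 'rV[R]_n * 'rV[R]_n |
                     U xy.1 /\ U xy.2 /\ xy.1 <> xy.2]])%E.

(** Lebesgue integral of a nonnegative function over R^n, computed as the
    iterated one-dimensional Lebesgue integral (Tonelli); R^0 is a point. *)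
Fixpoint leb_int (n : nat) : ('rV[R]_n -> \bar R) -> \bar R :=
  match n with
  | 0 => fun f => f 0
  | n'.+1 => fun f =>
      (\int[lebesgue_measure]_x
         leb_int (fun y : 'rV[R]_n' => f (row_mx (\row_(_ < 1) x) y)))%E
  end.

Definition int_over n (U : set 'rV[R]_n) (f : 'rV[R]_n -> \bar R) : \bar R :=
  leb_int (fun x => if `[< U x >] then f x else 0%E).

Definition domain n (U : set 'rV[R]_n) : Prop :=
  open U /\ connected U /\ U !=set0.

Definition compactly_contained n (U Om : set 'rV[R]_n) : Prop :=
  compact (closure U) /\ closure U `<=` Om.

Definition p_crit (n : nat) (delta : R) : R :=
  n%:R * (1 + delta) / ((n%:R - 1) * delta).

End Defs.

(* Main.v *)
(** Write [u = M^2 + |grad W|^2] and [gamma = (1 + (2-n) delta) / (1 + delta)].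

    Hölder estimate.  For [a < gamma] the barrier [|x - x0|^a] is strictly on the
    wrong side of delta-convexity: at an interior maximum of [W - C |x - x0|^a]
    away from [x0] the Hessian of [W] lies below that of the barrier, and comparing
    the radial direction with the trace contradicts
    [D^2 W >= - delta (Lap W) Id].  Hence [W] is dominated by such barriers,
    which gives the oscillation estimate after [a -> gamma].  Used at a maximum
    point of [d^n |W|], with [d] a distance to the boundary, the same comparison
    shows that [|W|] stays comparable to its maximum on a fixed fraction of the
    ball of radius [d], so that [sup |W|] is controlled by [int |W|].

    Gradient estimate.  Delta-convexity in the direction [grad W] gives
    [div (u^((s-1)/2) grad W) >= (1 - (s-1) delta) u^((s-1)/2) Lap W], while
    [|D^2 W| <= C Lap W] bounds [|grad u^(s/2)|] by [C u^((s-1)/2) Lap W].  So as long as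
    [(s-1) delta < 1], a bound for [int u^(s/2)] yields one for the total variation of
    [u^(s/2)], and the Sobolev embedding of [W^{1,1}] into [L^(n/(n-1))] improves [s]
    to [s n/(n-1)].  Starting from [s = 2] the iteration reaches every exponent
    below [(n/(n-1)) (1 + 1/delta) = p_delta]. *)
Require Import Defs.
From HB Require Import structures.
From mathcomp Require Import all_boot all_order all_algebra.
From mathcomp Require Import all_classical all_reals all_analysis.
From mathcomp Require Import ring lra.
Set Implicit Arguments.
Unset Strict Implicit.
Unset Printing Implicit Defensive.
Import Order.TTheory GRing.Theory Num.Theory.
Import numFieldNormedType.Exports.
Local Open Scope classical_set_scope.
Local Open Scope ring_scope.

(** * Row vectors and iterated integrals of nonnegative functions *)

(** The integrals of the statement are iterated one-dimensional ones and enter through monotonicity: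
    lower bounds come from constants on cubes, upper bounds from continuous majorants vanishing
    outside a cube, for which linearity, exchange of integrations and integration by parts are
    proved directly. Regularity is given by continuous partial derivatives, so the first-order
    expansion, the derivative along a line and the symmetry of the Hessian all come from the mean
    value theorem. Membership in the cone speaks of roots of the characteristic polynomial, whereas
    both estimates use the quadratic form; the passage goes through the invertibility of shifted
    Hessians instead of a diagonalisation. Constants must not depend on [W]: the gradient bounds
    carry a free bound [M > 0] of [|W|] where the cutoff is nonzero, and inserting the supremum
    bound for [M] makes them linear in the integral of [|W|]. *)

(** The integral of a nonnegative function is a supremum over the simple functions below it, which
    is monotone in the function. *)
Lemma nneg_le_integral (R : realType) (f g : R -> \bar R) :
  (forall x, 0 <= f x)%E -> (forall x, f x <= g x)%E ->
  (\int[lebesgue_measure]_x f x <= \int[lebesgue_measure]_x g x)%E.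
Proof.
move=> f0 fg.
have g0 x : (0 <= g x)%E by exact: le_trans (f0 x) (fg x).
rewrite !ge0_integralTE//; apply: ereal_sup_le => _ [h hf <-].
by exists h => // x; exact: le_trans (hf x) (fg x).
Qed.

Section row_vectors.
Variable R : realType.

Lemma ler_rv_normP n (x : 'rV[R]_n) (c : R) : 0 <= c ->
  reflect (forall i, `|x 0 i| <= c) (`|x| <= c).
Proof.
move=> c0; rewrite [`|x|]/Num.norm /= mx_normrE.
apply: (iffP (bigmax_leP _ _ _ _)) => [[_ h] i|h]; first exact: (h (0, i) isT).
by split => // -[a i] _; rewrite (ord1 a); exact: h.
Qed.

Lemma le_coord_norm n (x : 'rV[R]_n) i : `|x 0 i| <= `|x|.
Proof. exact/(ler_rv_normP x (normr_ge0 x)). Qed.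

(** Spelled exactly as the slice in [leb_int], so that unfolding an iterated integral yields it. *)
Definition vcons n (x : R) (y : 'rV[R]_n) : 'rV[R]_n.+1 :=
  row_mx (\row_(_ < 1) x) y.

Lemma vcons0 n x (y : 'rV[R]_n) : vcons x y 0 ord0 = x.
Proof.
rewrite /vcons (_ : ord0 = lshift n (0 : 'I_1)); last exact/val_inj.
by rewrite (row_mxEl (\row_(_ < 1) x) y) mxE.
Qed.

Lemma vconsS n x (y : 'rV[R]_n) i : vcons x y 0 (lift ord0 i) = y 0 i.
Proof.
rewrite /vcons (_ : lift ord0 i = rshift 1 i); last exact/val_inj.
by rewrite (row_mxEr (\row_(_ < 1) x) y).
Qed.

Lemma rv_eqP n (x y : 'rV[R]_n) : (forall i, x 0 i = y 0 i) -> x = y.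
Proof. by move=> h; apply/rowP. Qed.

Lemma vconsD n (x x' : R) (y y' : 'rV[R]_n) :
  vcons x y + vcons x' y' = vcons (x + x') (y + y').
Proof.
apply: rv_eqP => i; rewrite mxE.
by case: (unliftP ord0 i) => [j|] ->; rewrite ?vconsS ?vcons0 ?mxE.
Qed.

Lemma vconsN n (x : R) (y : 'rV[R]_n) : - vcons x y = vcons (- x) (- y).
Proof.
apply: rv_eqP => i; rewrite mxE.
by case: (unliftP ord0 i) => [j|] ->; rewrite ?vconsS ?vcons0 ?mxE.
Qed.

Lemma vconsZ n a (x : R) (y : 'rV[R]_n) : a *: vcons x y = vcons (a * x) (a *: y).
Proof.
apply: rv_eqP => i; rewrite mxE.
by case: (unliftP ord0 i) => [j|] ->; rewrite ?vconsS ?vcons0 ?mxE.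
Qed.

Lemma norm_vcons n (x : R) (y : 'rV[R]_n) : `|vcons x y| = Num.max `|x| `|y|.
Proof.
apply/eqP; rewrite eq_le; apply/andP; split.
  apply/ler_rv_normP => [|i]; first by rewrite le_max normr_ge0.
  rewrite le_max; case: (unliftP ord0 i) => [j|] ->; rewrite ?vconsS ?vcons0 ?lexx//.
  by rewrite le_coord_norm orbT.
rewrite ge_max; apply/andP; split.
  by have := le_coord_norm (vcons x y) ord0; rewrite vcons0.
apply/ler_rv_normP => // i.
by have := le_coord_norm (vcons x y) (lift ord0 i); rewrite vconsS.
Qed.

Lemma evec0 n : evec R (ord0 : 'I_n.+1) = vcons 1 0.
Proof.
apply: rv_eqP => i; rewrite mxE eqxx /=.
by case: (unliftP ord0 i) => [j|] ->; rewrite ?vconsS ?vcons0 ?mxE.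
Qed.

Lemma evecS n (i : 'I_n) : evec R (lift ord0 i) = vcons 0 (evec R i).
Proof.
apply: rv_eqP => k; rewrite mxE eqxx /=.
by case: (unliftP ord0 k) => [j|] ->; rewrite ?vconsS ?vcons0 ?mxE ?(inj_eq lift_inj).
Qed.

Lemma vcons_surj n (v : 'rV[R]_n.+1) : exists x y, v = vcons x y.
Proof.
exists (v 0 ord0), (\row_i v 0 (lift ord0 i)); apply: rv_eqP => k.
by case: (unliftP ord0 k) => [j|] ->; rewrite ?vconsS ?vcons0 ?mxE.
Qed.

End row_vectors.

Section leb_int_nneg.
Variable R : realType.

Lemma leb_int_ge0 n (f : 'rV[R]_n -> \bar R) :
  (forall x, 0 <= f x)%E -> (0 <= leb_int f)%E.
Proof.
elim: n f => [|n IH] f f0 /=; first exact: f0.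
by apply: integral_ge0 => x _; apply: IH => y.
Qed.

Lemma le_leb_int n (f g : 'rV[R]_n -> \bar R) :
  (forall x, 0 <= f x)%E -> (forall x, f x <= g x)%E -> (leb_int f <= leb_int g)%E.
Proof.
elim: n f g => [|n IH] f g f0 fg /=; first exact: fg.
apply: nneg_le_integral => x; first exact: leb_int_ge0.
by apply: IH => y.
Qed.

(** Slices of a sup-norm cube are cubes of the same radius, so the constant [c] is integrated one
    coordinate at a time. This is how a lower bound for [|W|] near a point enters the integral over
    [Om]. *)
Lemma leb_int_lower n (f : 'rV[R]_n -> \bar R) (y : 'rV[R]_n) (r c : R) :
  0 <= r -> 0 <= c -> (forall x, 0 <= f x)%E ->
  (forall x, `|x - y| <= r -> (c%:E <= f x)%E) ->
  ((c * (2 * r) ^+ n)%:E <= leb_int f)%E.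
Proof.
move=> r0 c0; elim: n f y => [|n IH] f y f0 fc /=.
  by rewrite expr0 mulr1; apply: fc; rewrite (_ : 0 - y = 0 :> 'rV[R]_0) ?normr0//; apply/rv_eqP => -[].
have [y0 [y1 yE]] := vcons_surj y; rewrite {y}yE in fc.
set K := c * (2 * r) ^+ n; have K0 : 0 <= K by rewrite mulr_ge0// exprn_ge0// mulr_ge0.
have -> : ((c * (2 * r) ^+ n.+1)%:E = \int[lebesgue_measure]_(x in `[(y0 - r)%R, (y0 + r)%R]) (cst K%:E) x)%E.
  rewrite integral_cst//= lebesgue_measure_itv /= lte_fin.
  case: ltP => h.
    rewrite -EFinB -EFinM; congr (_%:E); rewrite /K exprSr; ring.
  have -> : r = 0 by lra.
  by rewrite mulr0 exprS mul0r mulr0 mule0.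
rewrite integral_mkcond; apply: nneg_le_integral => x.
  by rewrite patchE; case: ifPn.
rewrite patchE; case: ifPn => [|_]; last exact: leb_int_ge0.
rewrite inE /= in_itv /= => xy.
apply: (IH _ y1) => // z zy; apply: fc.
by rewrite -/(vcons x z) vconsN vconsD norm_vcons ge_max zy andbT ler_distl.
Qed.

End leb_int_nneg.

(** * Calculus on the real line *)

Section one_dim.
Variable R : realType.
Notation mu := (@lebesgue_measure R).

Lemma continuous_itv_integrable (h : R -> R) (a b : R) :
  continuous h -> mu.-integrable `[a, b] (EFin \o h).
Proof.
move=> ch; apply: continuous_compact_integrable; first exact: segment_compact.
exact: continuous_subspaceT.
Qed.

Lemma Rint_bound (h : R -> R) (a b B : R) : a <= b -> continuous h ->
  (forall x, `|h x| <= B) -> `|\int[mu]_(x in `[a, b]) h x| <= B * (b - a).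
Proof.
move=> ab ch hB.
apply: le_trans (le_normr_Rintegral _ (continuous_itv_integrable _ _ ch)) _ => //.
have -> : B * (b - a) = \int[mu]_(x in `[a, b]) (cst B) x.
  rewrite Rintegral_cst//= lebesgue_measure_itv /= lte_fin.
  case: ltP => [_|h'] /=; first by [].
  by rewrite (_ : b = a) ?subrr; lra.
apply: le_Rintegral => //.
- by apply: continuous_itv_integrable => x; apply: continuous_comp (ch x) _; exact: norm_continuous.
- by apply: continuous_itv_integrable => x; exact: cst_continuous.
Qed.

Lemma is_derive_continuous (F : R -> R) (x df : R) :
  is_derive x 1 F df -> {for x, continuous F}.
Proof. by move=> h; apply: differentiable_continuous; exact/derivable1_diffP. Qed.

Lemma Rint_derive (F h : R -> R) (a b : R) : a <= b -> continuous h ->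
  (forall x, a <= x <= b -> is_derive x 1 F (h x)) ->
  \int[mu]_(x in `[a, b]) h x = F b - F a.
Proof.
rewrite le_eqVlt => /orP[/eqP <-|ab] ch dF.
  by rewrite set_itv1 Rintegral_set1 subrr.
rewrite /Rintegral (@continuous_FTC2 _ _ F)//.
- exact: continuous_subspaceT.
- split.
  + by move=> x; rewrite in_itv /= => /andP[ax xb]; case: (dF x) => //; rewrite !ltW.
  + by apply: cvg_at_right_filter; apply: is_derive_continuous (dF a _); rewrite lexx ltW.
  + by apply: cvg_at_left_filter; apply: is_derive_continuous (dF b _); rewrite lexx ltW.
- move=> x; rewrite in_itv /= => /andP[ax xb].
  have dx : is_derive x 1 F (h x) by apply: dF; rewrite !ltW.
  by rewrite derive1E derive_val.
Qed.

Lemma is_derive_Rint (h : R -> R) (a x : R) : a < x -> continuous h ->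
  is_derive x 1 (fun t => \int[mu]_(s in `[a, t]) h s) (h x).
Proof.
move=> ax ch.
have xu : x < x + 1 by rewrite ltrDl.
have [d e] := @continuous_FTC1_closed R h a x (x + 1) xu (continuous_itv_integrable _ _ ch) ax (ch x).
apply: DeriveDef; [exact: d|].
by rewrite -derive1E; exact: e.
Qed.

Lemma is_derive_eps (f : R -> R) (x a : R) :
  (forall e : R, 0 < e -> exists2 d, 0 < d & forall h, `|h| < d ->
     `|f (x + h) - f x - h * a| <= e * `|h|) -> is_derive x 1 f a.
Proof.
move=> H.
have C : (fun h => h^-1 *: (f (h *: (1:R) + x) - f x)) @ 0^' --> a.
  apply/cvgrPdist_le => e e0.
  have [d d0 Hd] := H e e0.
  near=> h.
  have h0 : h != 0 by near: h; exact: nbhs_dnbhs_neq.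
  have hd : `|h| < d.
    by near: h; apply: dnbhs0_lt.
  have := Hd h hd.
  rewrite [h *: 1]mulr1 addrC -ler_pdivrMr ?normr_gt0// => He.
  apply: le_trans He; rewrite -normfV -normrM distrC.
  rewrite le_eqVlt; apply/orP; left; apply/eqP; congr (`|_|).
  rewrite /GRing.scale /= [h + x]addrC; by field.
by apply: DeriveDef; [exact: cvgP C|exact: cvg_lim C].
Unshelve. all: by end_near.
Qed.

Lemma is_deriveP_eps (f : R -> R) (x a : R) : is_derive x 1 f a ->
  (forall e : R, 0 < e -> exists2 d, 0 < d & forall h, `|h| < d ->
     `|f (x + h) - f x - h * a| <= e * `|h|).
Proof.
move=> [df fa] e e0.
have C : (fun h => h^-1 *: (f (h *: (1:R) + x) - f x)) @ 0^' --> a by rewrite -fa; exact: df.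
have /cvgrPdist_le/(_ e e0) := C.
rewrite near_withinE => /nbhs_ballP [d /= d0 H]; exists d => // h hd.
have [->|h0] := eqVneq h 0; first by rewrite mul0r addr0 subrr subr0 normr0 mulr0.
have := H h; rewrite /ball /= sub0r normrN => /(_ hd h0).
rewrite [h *: 1]mulr1 -ler_pdivrMr ?normr_gt0//; apply: le_trans.
rewrite -normfV -normrM distrC.
rewrite le_eqVlt; apply/orP; left; apply/eqP; congr (`|_|).
rewrite /GRing.scale /= [h + x]addrC; by field.
Qed.

Lemma MVT_step (F df : R -> R) (t h : R) :
  (forall s, `|s - t| <= `|h| -> is_derive s 1 F (df s)) ->
  exists2 x, `|x - t| <= `|h| & F (t + h) - F t = h * df x.
Proof.
move=> H; have [h0|h0] := leP 0 h.
  have le1 : t <= t + h by rewrite lerDl.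
  have Hd x : x \in `[t, t + h] -> is_derive x 1 F (df x).
    rewrite in_itv /= => /andP[h1 h2]; apply: H.
    by rewrite !ger0_norm ?subr_ge0//; lra.
  have d1 x : x \in `]t, t + h[ -> is_derive x 1 F (df x) by move/subset_itv_oo_cc; exact: Hd.
  have c1 : {within `[t, t + h], continuous F}.
    by apply: continuous_in_subspaceT => x; rewrite inE => /Hd xd; exact: is_derive_continuous xd.
  have [x xI E] := MVT_segment le1 d1 c1.
  exists x; last by rewrite E addrAC subrr add0r mulrC.
  move: xI; rewrite in_itv /= => /andP[h1 h2].
  by rewrite !ger0_norm ?subr_ge0//; lra.
have le1 : t + h <= t by rewrite gerDl ltW.
have Hd x : x \in `[t + h, t] -> is_derive x 1 F (df x).
  rewrite in_itv /= => /andP[h1 h2]; apply: H.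
  by rewrite distrC ger0_norm ?subr_ge0// ltr0_norm//; lra.
have d1 x : x \in `]t + h, t[ -> is_derive x 1 F (df x) by move/subset_itv_oo_cc; exact: Hd.
have c1 : {within `[t + h, t], continuous F}.
  by apply: continuous_in_subspaceT => x; rewrite inE => /Hd xd; exact: is_derive_continuous xd.
have [x xI E] := MVT_segment le1 d1 c1.
exists x; last by rewrite -opprB E; ring.
move: xI; rewrite in_itv /= => /andP[h1 h2].
by rewrite distrC ger0_norm ?subr_ge0// ltr0_norm//; lra.
Qed.

(** Derivability and derivative depend on the difference quotients only. This carries partial
    derivatives over to slices and to restrictions to lines. *)
Lemma derive_transfer (V V' : normedModType R) (f : V -> R) (g : V' -> R)
    (a v : V) (a' v' : V') :
  (forall h : R, g (h *: v' + a') = f (h *: v + a)) ->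
  (derivable f a v -> derivable g a' v') /\ 'D_v' g a' = 'D_v f a.
Proof.
move=> H; have E : (fun h : R => h^-1 *: ((g \o shift a') (h *: v') - g a')) =
                  (fun h => h^-1 *: ((f \o shift a) (h *: v) - f a)).
  apply/funext => h /=; rewrite H; congr (_ *: (_ - _)).
  by have := H 0; rewrite !scale0r !add0r.
by rewrite /derivable /derive E.
Qed.

End one_dim.

Arguments derive_transfer {R V V'} f g a v a' v'.

(** * Iterated integrals of compactly supported continuous functions *)

Section box_integral.
Variables (R : realType) (L : R).
Hypothesis L0 : 0 < L.
Notation mu := (@lebesgue_measure R).

Definition cbox n (f : 'rV[R]_n -> R) :=
  continuous f /\ forall x, L <= `|x| -> f x = 0.

(* [J] is the real-valued counterpart of [leb_int] for continuous functions vanishing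
   outside the sup-norm cube [|x| < L]; their slices are again of this kind, so no
   measurability or integrability condition ever appears. *)
Fixpoint J n : ('rV[R]_n -> R) -> R :=
  match n with
  | 0 => fun f => f 0
  | n'.+1 => fun f => \int[mu]_(x in `[- L, L]) J (fun y : 'rV[R]_n' => f (vcons x y))
  end.

Lemma continuous_norm_le (V W : normedModType R) (f : V -> W) (x : V) :
  (forall e : R, 0 < e -> exists2 d, 0 < d & forall y, `|y - x| < d -> `|f y - f x| <= e) ->
  {for x, continuous f}.
Proof.
move=> H; apply/cvgrPdist_le => e /H [d d0 Hd].
apply/nbhs_ballP; exists d => // y; rewrite -ball_normE /= distrC => /Hd.
by rewrite distrC.
Qed.

Lemma norm_leL_compact n : compact [set x : 'rV[R]_n | `|x| <= L].
Proof.
apply: bounded_closed_compact.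
  exists L; split; first exact: num_real.
  by move=> M LM x /= xL; apply: le_trans xL (ltW LM).
apply: (@preimage_closed _ _ (fun x : 'rV[R]_n => `|x|) [set t | t <= L]); last exact: closed_le.
by move=> x _; exact: norm_continuous.
Qed.

(** Heine-Cantor on the closed cube. If only one point lies in the cube, it serves as the base
    point; if neither does, both values vanish. *)
Lemma cbox_unif n (f : 'rV[R]_n -> R) : cbox f -> forall e : R, 0 < e ->
  exists2 d, 0 < d & forall x y, `|y - x| < d -> `|f y - f x| <= e.
Proof.
move=> [cf zf] e e0.
have /compact_near_coveringP/(_ R 0^'+ (fun d x => forall y, `|y - x| < d -> `|f y - f x| <= e)) := @norm_leL_compact n.
case.
- move=> x xL.
  have /cvgrPdist_lt/(_ _ (divr_gt0 e0 (ltr0n _ 2))) /nbhs_ballP [d /= d0 Hd] := cf x.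
  have d20 : 0 < d / 2 by lra.
  exists (ball x (d / 2), [set t | 0 < t < d / 2]) => /=.
    split; first exact: nbhsx_ballx.
    near=> t; apply/andP; split; first by near: t; exact: nbhs_right_gt.
    near: t; exact: nbhs_right_lt.
  move=> [x' t] [/=]; rewrite -ball_normE /= => xx' /andP[t0 td] y yx'.
  have h1 : `|f x - f x'| < e / 2 by apply: Hd; rewrite -ball_normE /=; lra.
  have h2 : `|f x - f y| < e / 2.
    apply: Hd; rewrite -ball_normE /=.
    have -> : x - y = (x - x') - (y - x') by rewrite opprB addrA subrK.
    apply: le_lt_trans (ler_normB _ _) _; lra.
  have -> : f y - f x' = (f x - f x') - (f x - f y) by ring.
  apply: le_trans (ler_normB _ _) _; lra.
- move=> d /= d0 Hd.
  have d20 : 0 < d / 2 by lra.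
  have HK x : `|x| <= L -> forall y, `|y - x| < d / 2 -> `|f y - f x| <= e.
    by apply: Hd => //=; rewrite sub0r normrN gtr0_norm//; lra.
  exists (d / 2) => // x y xy.
  have [xL|xL] := lerP `|x| L; first exact: HK.
  have [yL|yL] := lerP `|y| L; first by rewrite distrC; apply: HK => //; rewrite distrC.
  by rewrite (zf x (ltW xL)) (zf y (ltW yL)) subrr normr0 ltW.
Unshelve. all: by end_near. Qed.

Lemma cbox_bounded n (f : 'rV[R]_n -> R) : cbox f ->
  exists2 B : R, 0 <= B & forall x, `|f x| <= B.
Proof.
move=> [cf zf].
have c1 : {within [set x : 'rV[R]_n | `|x| <= L], continuous (fun x => `|f x|)}.
  apply: continuous_subspaceT => x; apply: continuous_comp (cf x) _; exact: norm_continuous.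
have n0 : [set x : 'rV[R]_n | `|x| <= L] !=set0 by exists 0; rewrite /= normr0 ltW.
have [x xL Hx] := @EVT_max_rV R n (fun x => `|f x|) _ n0 (@norm_leL_compact n) c1.
exists `|f x| => // y; have [yL|yL] := lerP `|y| L; first by apply: Hx; rewrite inE.
by rewrite (zf y (ltW yL)) normr0.
Qed.

Lemma cbox_slice n (f : 'rV[R]_n.+1 -> R) (x : R) : cbox f ->
  cbox (fun y => f (vcons x y)).
Proof.
move=> [cf zf]; split; last first.
  by move=> y Ly; apply: zf; rewrite norm_vcons le_max Ly orbT.
move=> y; apply: continuous_norm_le => e e0.
have /cvgrPdist_le/(_ _ e0) /nbhs_ballP [d /= d0 Hd] := cf (vcons x y).
exists d => // z zy; rewrite distrC; apply: Hd; rewrite -ball_normE /=.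
by rewrite vconsN vconsD subrr norm_vcons normr0 distrC gt_max d0.
Qed.

Lemma cboxD n (f g : 'rV[R]_n -> R) : cbox f -> cbox g -> cbox (fun x => f x + g x).
Proof.
move=> [cf zf] [cg zg]; split => [x|x xL]; first exact: continuousD (cf x) (cg x).
by rewrite zf// zg// addr0.
Qed.

Lemma cboxM n (f g : 'rV[R]_n -> R) : cbox f -> continuous g -> cbox (fun x => f x * g x).
Proof.
move=> [cf zf] cg; split => [x|x xL]; first exact: continuousM (cf x) (cg x).
by rewrite zf// mul0r.
Qed.

Lemma cboxZ n (f : 'rV[R]_n -> R) (k : R) : cbox f -> cbox (fun x => k * f x).
Proof.
move=> [cf zf]; split => [x|x xL]; last by rewrite zf// mulr0.
by apply: continuousM (cf x); exact: cst_continuous.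
Qed.

Lemma cboxB n (f g : 'rV[R]_n -> R) : cbox f -> cbox g -> cbox (fun x => f x - g x).
Proof.
move=> [cf zf] [cg zg]; split => [x|x xL]; first exact: continuousB (cf x) (cg x).
by rewrite zf// zg// subr0.
Qed.

Lemma cbox_norm n (f : 'rV[R]_n -> R) : cbox f -> cbox (fun x => `|f x|).
Proof.
move=> [cf zf]; split => [x|x xL]; last by rewrite zf// normr0.
apply: continuous_comp (cf x) _; exact: norm_continuous.
Qed.

Lemma cbox0 n : cbox (fun _ : 'rV[R]_n => 0).
Proof. by split => // x; exact: cst_continuous. Qed.

Lemma cbox_sum n (I : finType) (f : I -> 'rV[R]_n -> R) :
  (forall i, cbox (f i)) -> cbox (fun x => \sum_i f i x).
Proof.
move=> H; elim: (index_enum I) => [|i s IH].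
  by under eq_fun do rewrite big_nil; exact: cbox0.
by under eq_fun do rewrite big_cons; exact: cboxD.
Qed.

Lemma leNL : - L <= L. Proof. by move: L0; lra. Qed.

(** One induction for all five properties: in dimension [n.+1] linearity and monotonicity need
    integrable slice integrals, hence their continuity, which follows from linearity and the bound
    in dimension [n]. *)
Lemma J_linear_monotone n :
  (forall f g : 'rV[R]_n -> R, cbox f -> cbox g -> J (fun x => f x + g x) = J f + J g)
  /\ (forall (f : 'rV[R]_n -> R) (k : R), cbox f -> J (fun x => k * f x) = k * J f)
  /\ (forall f g : 'rV[R]_n -> R, cbox f -> cbox g -> (forall x, f x <= g x) -> J f <= J g)
  /\ (forall (f : 'rV[R]_n -> R) (B : R), cbox f -> (forall x, `|f x| <= B) -> `|J f| <= B * (2 * L) ^+ n)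
  /\ (forall f : 'rV[R]_n -> R, (forall x, f x = 0) -> J f = 0).
Proof.
elim: n => [|n [JD [JZ [Jle [Jb J0]]]]] /=.
  do !split => //; by move=> f B cf fB; rewrite expr0 mulr1.
have Jc (f : 'rV[R]_n.+1 -> R) : cbox f -> continuous (fun x => J (fun y : 'rV[R]_n => f (vcons x y))).
  move=> cf x; apply: continuous_norm_le => e e0.
  have p0 : 0 < (2 * L) ^+ n by rewrite exprn_gt0// mulr_gt0.
  have [d d0 Hd] := cbox_unif cf (divr_gt0 e0 p0).
  exists d => // x' xx'.
  have -> : J (fun y : 'rV[R]_n => f (vcons x' y)) - J (fun y : 'rV[R]_n => f (vcons x y))
     = J (fun y : 'rV[R]_n => f (vcons x' y) + (-1) * f (vcons x y)).
    rewrite JD ?JZ ?mulN1r//; first exact: cbox_slice.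
    + exact: cbox_slice.
    + by apply: cboxZ; exact: cbox_slice.
  have := Jb (fun y => f (vcons x' y) + (-1) * f (vcons x y)) (e / (2 * L) ^+ n).
  rewrite divfK ?gt_eqF//; apply.
    by apply: cboxD; [|apply: cboxZ]; exact: cbox_slice.
  move=> y; rewrite mulN1r; apply: Hd.
  by rewrite vconsN vconsD subrr norm_vcons normr0 gt_max d0 xx'.
split; [|split; [|split; [|split]]].
- move=> f g cf cg; rewrite -RintegralD//; try exact/continuous_itv_integrable/Jc.
  by apply: eq_Rintegral => x _; rewrite JD//; exact: cbox_slice.
- move=> f k cf; rewrite -RintegralZl//; last exact/continuous_itv_integrable/Jc.
  by apply: eq_Rintegral => x _; rewrite JZ//; exact: cbox_slice.
- move=> f g cf cg fg; apply: le_Rintegral => //; try exact/continuous_itv_integrable/Jc.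
  by move=> x _; apply: Jle => //; exact: cbox_slice.
- move=> f B cf fB; have -> : B * (2 * L) ^+ n.+1 = (B * (2 * L) ^+ n) * (L - - L) by rewrite exprSr; ring.
  apply: Rint_bound leNL _ _ => [|x]; first exact: Jc.
  by apply: Jb => //; exact: cbox_slice.
- move=> f f0; rewrite (_ : 0 = \int[mu]_(x in `[- L, L]) (cst 0) x); last by rewrite Rintegral_cst// mul0r.
  by apply: eq_Rintegral => x _; apply: J0.
Qed.

Lemma JD n (f g : 'rV[R]_n -> R) : cbox f -> cbox g -> J (fun x => f x + g x) = J f + J g.
Proof. exact: (J_linear_monotone n).1. Qed.

Lemma JZ n (f : 'rV[R]_n -> R) (k : R) : cbox f -> J (fun x => k * f x) = k * J f.
Proof. exact: (J_linear_monotone n).2.1. Qed.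

Lemma le_J n (f g : 'rV[R]_n -> R) : cbox f -> cbox g -> (forall x, f x <= g x) -> J f <= J g.
Proof. exact: (J_linear_monotone n).2.2.1. Qed.

Lemma J_bound n (f : 'rV[R]_n -> R) (B : R) :
  cbox f -> (forall x, `|f x| <= B) -> `|J f| <= B * (2 * L) ^+ n.
Proof. exact: (J_linear_monotone n).2.2.2.1. Qed.

Lemma J_eq0 n (f : 'rV[R]_n -> R) : (forall x, f x = 0) -> J f = 0.
Proof. exact: (J_linear_monotone n).2.2.2.2. Qed.

Lemma eq_J n (f g : 'rV[R]_n -> R) : f =1 g -> J f = J g.
Proof. by move=> fg; congr J; exact/funext. Qed.

Lemma JB n (f g : 'rV[R]_n -> R) : cbox f -> cbox g -> J (fun x => f x - g x) = J f - J g.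
Proof.
move=> cf cg; rewrite -mulN1r -JZ// -JD//; last exact: cboxZ.
by apply: eq_J => x; rewrite mulN1r.
Qed.

Lemma J_sum n (I : finType) (f : I -> 'rV[R]_n -> R) :
  (forall i, cbox (f i)) -> J (fun x => \sum_i f i x) = \sum_i J (f i).
Proof.
move=> H; elim: (index_enum I) => [|i s IH].
  by rewrite big_nil; apply: J_eq0 => x; rewrite big_nil.
rewrite big_cons -IH -JD//; first by apply: eq_J => x; rewrite big_cons.
elim: s {IH} => [|j s IH]; first by under eq_fun do rewrite big_nil; exact: cbox0.
by under eq_fun do rewrite big_cons; exact: cboxD.
Qed.

Lemma J_ge0 n (f : 'rV[R]_n -> R) : cbox f -> (forall x, 0 <= f x) -> 0 <= J f.
Proof.
move=> cf f0; rewrite -(@J_eq0 n (fun=> 0))//; apply: le_J => //; exact: cbox0.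
Qed.

Lemma J_slice_continuous n (f : 'rV[R]_n.+1 -> R) : cbox f ->
  continuous (fun x => J (fun y : 'rV[R]_n => f (vcons x y))).
Proof.
move=> cf x; apply: continuous_norm_le => e e0.
have p0 : 0 < (2 * L) ^+ n by rewrite exprn_gt0// mulr_gt0.
have [d d0 Hd] := cbox_unif cf (divr_gt0 e0 p0).
exists d => // x' xx'.
rewrite -JB; try exact: cbox_slice.
have := @J_bound n (fun y => f (vcons x' y) - f (vcons x y)) (e / (2 * L) ^+ n).
rewrite divfK ?gt_eqF//; apply; first by apply: cboxB; exact: cbox_slice.
move=> y; apply: Hd.
by rewrite vconsN vconsD subrr norm_vcons normr0 gt_max d0 xx'.
Qed.

Lemma leb_int_J n (f : 'rV[R]_n -> R) : cbox f -> leb_int (fun x => (f x)%:E) = (J f)%:E.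
Proof.
elim: n f => [|n IH] f cf //=.
pose h x := J (fun y : 'rV[R]_n => f (vcons x y)).
have ch : continuous h by exact: J_slice_continuous.
transitivity (\int[mu]_(x in `[(- L)%R, L]) (h x)%:E)%E; last first.
  by rewrite /Rintegral fineK//; apply: integrable_fin_num => //; exact: continuous_itv_integrable.
rewrite [RHS]integral_mkcond; apply: eq_integral => x _.
rewrite (IH (fun y => f (vcons x y))); last exact: cbox_slice.
rewrite patchE; case: ifPn => //; rewrite notin_setE /= in_itv /= => xL.
rewrite J_eq0// => y; apply: cf.2; rewrite norm_vcons le_max; apply/orP; left.
rewrite leNgt; apply/negP => h1; apply: xL.
by rewrite -ler_norml ltW.
Qed.

(** Differentiation under the integral sign: the remainder is uniform in [y] and the box has finite
    volume. *)
Lemma is_derive_J n (F : R -> 'rV[R]_n -> R) (G : 'rV[R]_n -> R) (t : R) :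
  (forall s, cbox (F s)) -> cbox G ->
  (forall e : R, 0 < e -> exists2 d : R, 0 < d & forall h, `|h| < d ->
     forall y, `|F (t + h) y - F t y - h * G y| <= e * `|h|) ->
  is_derive t 1 (fun s => J (F s)) (J G).
Proof.
move=> cF cG H; apply: is_derive_eps => e e0.
have p0 : 0 < (2 * L) ^+ n by rewrite exprn_gt0// mulr_gt0.
have [d d0 Hd] := H _ (divr_gt0 e0 p0).
exists d => // h hd.
rewrite -JZ// -!JB//; [|exact: cboxB|exact: cboxZ].
rewrite (_ : e * `|h| = e / (2 * L) ^+ n * `|h| * (2 * L) ^+ n); last by rewrite mulrAC divfK ?gt_eqF.
apply: J_bound; last exact: Hd.
by apply: cboxB; [exact: cboxB|exact: cboxZ].
Qed.

(* Both sides are antiderivatives of the slice integrals with respect to the upper limit [t]. *)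
Lemma J_swap n (f : 'rV[R]_n.+1 -> R) : cbox f ->
  cbox (fun y : 'rV[R]_n => \int[mu]_(x in `[- L, L]) f (vcons x y)) /\
  J (fun y : 'rV[R]_n => \int[mu]_(x in `[- L, L]) f (vcons x y)) = J f.
Proof.
move=> cf.
have cy (y : 'rV[R]_n) : continuous (fun x => f (vcons x y)).
  move=> x; apply: continuous_norm_le => e e0.
  have [d d0 Hd] := cbox_unif cf e0.
  exists d => // x' xx'; apply: Hd.
  by rewrite vconsN vconsD subrr norm_vcons normr0 gt_max d0 xx'.
(* Starting strictly to the left of [- L] gives [F] a two-sided derivative at [t = - L] as well; the
   integrand vanishes between [a] and [- L]. *)
pose a := - L - 1.
pose F t y := \int[mu]_(x in `[a, t]) f (vcons x y).
have cF t : cbox (F t : 'rV[R]_n -> R).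
  split; last first.
    move=> y Ly; rewrite /F (_ : 0 = \int[mu]_(x in `[a, t]) (cst 0) x); last by rewrite Rintegral_cst// mul0r.
    by apply: eq_Rintegral => x _; apply: cf.2; rewrite norm_vcons le_max Ly orbT.
  have [ta|ta] := ltP t a.
    rewrite /F set_itv_ge; last by rewrite bnd_simp -ltNge.
    by under eq_fun do rewrite Rintegral_set0; move=> y; exact: cst_continuous.
  move=> y; apply: continuous_norm_le => e e0.
  have p0 : 0 < t - a + 1 by lra.
  have [d d0 Hd] := cbox_unif cf (divr_gt0 e0 p0).
  exists d => // y' yy'; rewrite /F -RintegralB//; try exact: continuous_itv_integrable.
  apply: (@le_trans _ _ (e / (t - a + 1) * (t - a))).
    apply: Rint_bound => //.
      by move=> x; apply: continuousB; exact: cy.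
    move=> x; apply: Hd.
    by rewrite vconsN vconsD subrr norm_vcons normr0 gt_max d0 yy'.
  by rewrite mulrAC ler_pdivrMr// ler_pM2l//; lra.
have FE y : F L y = \int[mu]_(x in `[- L, L]) f (vcons x y).
  have dF x : - L <= x <= L -> is_derive x 1 (F^~ y) (f (vcons x y)).
    by move=> /andP[Lx _]; apply: is_derive_Rint => //; rewrite /a; move: Lx; lra.
  rewrite (Rint_derive leNL (cy y) dF).
  rewrite [X in _ - X](_ : _ = 0) ?subr0// /F.
  rewrite (_ : 0 = \int[mu]_(x in `[a, - L]) (cst 0) x); last by rewrite Rintegral_cst// mul0r.
  apply: eq_Rintegral => x; rewrite inE /= in_itv /= => /andP[_ xL].
  apply: cf.2; rewrite norm_vcons le_max; apply/orP; left.
  by rewrite lerNr in xL; apply: le_trans xL _; rewrite -normrN ler_norm.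
have FNL y : F (- L) y = 0.
  rewrite /F (_ : 0 = \int[mu]_(x in `[a, - L]) (cst 0) x); last by rewrite Rintegral_cst// mul0r.
  apply: eq_Rintegral => x; rewrite inE /= in_itv /= => /andP[_ xL].
  apply: cf.2; rewrite norm_vcons le_max; apply/orP; left.
  by rewrite lerNr in xL; apply: le_trans xL _; rewrite -normrN ler_norm.
have FE' : (fun y : 'rV[R]_n => \int[mu]_(x in `[- L, L]) f (vcons x y)) = F L.
  by apply/funext => y; rewrite FE.
rewrite FE'; split; first exact: cF.
have -> : J (F L) = J (F L) - J (F (- L)) by rewrite [J (F (- L))]J_eq0 ?subr0.
suff dJ t : - L <= t <= L ->
    is_derive t 1 (fun t => J (F t)) (J (fun y : 'rV[R]_n => f (vcons t y))).
  by rewrite /= (Rint_derive leNL (J_slice_continuous cf) dJ).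
move=> /andP[tL _]; apply: is_derive_J => //; first exact: cbox_slice.
move=> e e0.
have [d d0 Hd] := cbox_unif cf e0.
(* The bound 1 keeps all points between [t] and [t + h] above [a], where [F] is differentiable. *)
exists (Num.min d 1); first by rewrite lt_min d0 ltr01.
move=> h; rewrite lt_min => /andP[hd h1] y.
have dF s : `|s - t| <= `|h| -> is_derive s 1 (F^~ y) (f (vcons s y)).
  move=> st; apply: is_derive_Rint => //; rewrite /a.
  move: st; rewrite ler_distl => /andP[h2 _]; move: tL h1 h2; lra.
have [x xt ->] := MVT_step dF.
rewrite -mulrBr normrM mulrC ler_wpM2r//; apply: Hd.
by rewrite vconsN vconsD subrr norm_vcons normr0 gt_max d0 (le_lt_trans xt).
Qed.

(** * Compactly supported functions of class C^1 *)

Definition cbox1 n (f : 'rV[R]_n -> R) :=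
  cbox f /\ forall i, (forall x, derivable f x (evec R i)) /\ cbox (pderiv i f).

Lemma slice_quotient n (f : 'rV[R]_n.+1 -> R) (i : 'I_n) (x : R) (y : 'rV[R]_n) (h : R) :
  f (vcons x (h *: evec R i + y)) = f (h *: evec R (lift ord0 i) + vcons x y).
Proof. by rewrite evecS vconsZ vconsD mulr0 add0r. Qed.

Lemma derivable_slice n (f : 'rV[R]_n.+1 -> R) (i : 'I_n) (x : R) (y : 'rV[R]_n) :
  derivable f (vcons x y) (evec R (lift ord0 i)) ->
  derivable (fun z => f (vcons x z)) y (evec R i).
Proof.
by have [] := derive_transfer f (fun z => f (vcons x z)) (vcons x y) (evec R (lift ord0 i)) y (evec R i)
  (slice_quotient f i x y).
Qed.

Lemma pderiv_slice n (f : 'rV[R]_n.+1 -> R) (i : 'I_n) (x : R) (y : 'rV[R]_n) :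
  pderiv i (fun z => f (vcons x z)) y = pderiv (lift ord0 i) f (vcons x y).
Proof.
by have [] := derive_transfer f (fun z => f (vcons x z)) (vcons x y) (evec R (lift ord0 i)) y (evec R i)
  (slice_quotient f i x y).
Qed.

Lemma first_quotient n (f : 'rV[R]_n.+1 -> R) (x : R) (y : 'rV[R]_n) (h : R) :
  f (vcons (h *: (1 : R) + x) y) = f (h *: evec R ord0 + vcons x y).
Proof. by rewrite evec0 vconsZ vconsD scaler0 add0r. Qed.

Lemma is_derive_first n (f : 'rV[R]_n.+1 -> R) (x : R) (y : 'rV[R]_n) :
  derivable f (vcons x y) (evec R ord0) ->
  is_derive x 1 (fun t => f (vcons t y)) (pderiv ord0 f (vcons x y)).
Proof.
move=> df; have [d e] := derive_transfer f (fun t => f (vcons t y)) (vcons x y) (evec R ord0) x 1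
  (first_quotient f x y).
by apply: DeriveDef; [exact: d df|exact: e].
Qed.

Lemma cbox1_slice n (f : 'rV[R]_n.+1 -> R) (x : R) : cbox1 f -> cbox1 (fun y => f (vcons x y)).
Proof.
move=> [cf df]; split; first exact: cbox_slice.
move=> i; have [di ci] := df (lift ord0 i); split.
  by move=> y; exact: derivable_slice.
rewrite (_ : pderiv i _ = fun y => pderiv (lift ord0 i) f (vcons x y)); first exact: cbox_slice.
by apply/funext => y; exact: pderiv_slice.
Qed.

Lemma vcons_close n (x x' d : R) (y : 'rV[R]_n) : 0 < d -> `|x' - x| < d ->
  `|vcons x' y - vcons x y| < d.
Proof. by move=> d0 xd; rewrite vconsN vconsD subrr norm_vcons normr0 gt_max d0 xd. Qed.

(** Integration by parts: in the first coordinate the slice integral of [f] is a primitive that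
    vanishes at both ends [- L] and [L]; the other coordinates reduce to slices. *)
Lemma J_pderiv n (f : 'rV[R]_n -> R) (i : 'I_n) : cbox1 f -> J (pderiv i f) = 0.
Proof.
elim: n f i => [|n IH] f i cf; first by case: i.
case: (unliftP ord0 i) => [j|] -> /=.
  rewrite (_ : 0 = \int[mu]_(x in `[- L, L]) (cst 0) x); last by rewrite Rintegral_cst// mul0r.
  apply: eq_Rintegral => x _; rewrite -(IH _ j (cbox1_slice x cf)).
  by apply: eq_J => y; rewrite pderiv_slice.
have [cf0 /(_ ord0) [df cdf]] := cf.
have dJ t : - L <= t <= L ->
    is_derive t 1 (fun t => J (fun y : 'rV[R]_n => f (vcons t y)))
      (J (fun y : 'rV[R]_n => pderiv ord0 f (vcons t y))).
  move=> _; apply: (@is_derive_J _ (fun t y => f (vcons t y))) => [s||e e0].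
  - exact: cbox_slice.
  - exact: cbox_slice.
  have [d d0 Hd] := cbox_unif cdf e0.
  exists d => // h hd y.
  have dF s : `|s - t| <= `|h| -> is_derive s 1 (fun s => f (vcons s y)) (pderiv ord0 f (vcons s y)).
    by move=> _; exact: is_derive_first.
  have [x xt ->] := MVT_step dF.
  rewrite -mulrBr normrM mulrC ler_wpM2r//; apply: Hd.
  by apply: vcons_close => //; exact: le_lt_trans hd.
rewrite (Rint_derive leNL (J_slice_continuous cdf) dJ).
rewrite !J_eq0 ?subrr// => y; apply: cf0.2; rewrite norm_vcons le_max.
  by rewrite normrN ger0_norm ?lexx// ltW.
by rewrite ger0_norm ?lexx// ltW.
Qed.

(** The fundamental theorem of calculus from the face [- L], where [f] vanishes. The bound no longer
    depends on [x], which is the starting point of Gagliardo's argument. *)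
Lemma le_int_pderiv0 n (f : 'rV[R]_n.+1 -> R) (x : R) (y : 'rV[R]_n) : cbox1 f ->
  f (vcons x y) <= \int[mu]_(t in `[- L, L]) `|pderiv ord0 f (vcons t y)|.
Proof.
move=> [cf /(_ ord0) [df cdf]].
have ca (g : 'rV[R]_n.+1 -> R) : cbox g -> continuous (fun t => g (vcons t y)).
  move=> cg t; apply: continuous_norm_le => e e0.
  have [d d0 Hd] := cbox_unif cg e0.
  exists d => // t' tt'; apply: Hd; exact: vcons_close.
have i0 : 0 <= \int[mu]_(t in `[- L, L]) `|pderiv ord0 f (vcons t y)|.
  by apply: Rintegral_ge0.
have [xL|xL] := ltP `|x| L; last first.
  by rewrite cf.2// norm_vcons le_max xL.
have /andP[xL1 xL2] : - L < x < L by rewrite -ltr_norml.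
have dF t : - L <= t <= x -> is_derive t 1 (fun t => f (vcons t y)) (pderiv ord0 f (vcons t y)).
  by move=> _; exact: is_derive_first.
have <- : \int[mu]_(t in `[- L, x]) pderiv ord0 f (vcons t y) = f (vcons x y).
  rewrite (Rint_derive (ltW xL1) (ca _ cdf) dF) [X in _ - X]cf.2 ?subr0//.
  by rewrite norm_vcons le_max normrN ger0_norm ?lexx// ltW.
have cn := ca _ (cbox_norm cdf).
apply: (@le_trans _ _ (\int[mu]_(t in `[- L, x]) `|pderiv ord0 f (vcons t y)|)).
  apply: le_Rintegral => //; [exact/continuous_itv_integrable/ca|exact: continuous_itv_integrable|].
  by move=> t _; exact: ler_norm.
have := @Rintegral_itvB R (fun t => `|pderiv ord0 f (vcons t y)|) (BLeft (- L)) (BRight L) x (continuous_itv_integrable _ _ cn).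
rewrite !bnd_simp => /(_ (ltW xL1) (ltW xL2)) E.
rewrite -subr_ge0 E; exact: Rintegral_ge0.
Qed.

(** * The Sobolev inequality for [W^{1,1}] *)

Lemma continuous_powR_nneg (T : topologicalType) (f : T -> R) (p : R) (x : T) :
  0 < p -> (forall y, 0 <= f y) -> {for x, continuous f} ->
  {for x, continuous (fun y => f y `^ p)}.
Proof.
move=> p0 f0 cf; have := f0 x; rewrite le_eqVlt => /orP[/eqP fx0|fx0].
  apply/cvgrPdist_lt => e e0; rewrite -fx0 powR0 ?gt_eqF//.
  have ep : 0 < e `^ p^-1 by exact: powR_gt0.
  have /cvgrPdist_lt/(_ _ ep) := cf; apply: filterS => y.
  rewrite -fx0 !sub0r !normrN ger0_norm// => h; rewrite ger0_norm ?powR_ge0//.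
  rewrite (_ : e = (e `^ p^-1) `^ p).
    by apply: (gt0_ltr_powR p0) h; rewrite nnegrE; [exact: f0|exact: ltW].
  by rewrite -powRrM mulVf ?gt_eqF// powRr1// ltW.
apply: (continuous_comp cf (f := f) (g := fun t => t `^ p)).
exact: is_derive_continuous (is_derive1_powR p fx0).
Qed.

Lemma cbox_powR n (f : 'rV[R]_n -> R) (p : R) : 0 < p -> cbox f -> (forall x, 0 <= f x) ->
  cbox (fun x => f x `^ p).
Proof.
move=> p0 [cf zf] f0; split => [x|x xL]; first exact: (continuous_powR_nneg p0 f0 (cf x)).
by rewrite zf// powR0// gt_eqF.
Qed.

Lemma invr_powR (t r : R) : 0 <= t -> t^-1 `^ r = (t `^ r)^-1.
Proof. by move=> t0; rewrite -powR_inv1// -powRrM mulN1r powRN. Qed.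

Lemma powR1D (t r : R) : 0 <= t -> 0 < r -> t `^ (1 + r) = t * t `^ r.
Proof. by move=> t0 r0; rewrite powRD ?powRr1// gt_eqF// addr_gt0. Qed.

(** Young's inequality for [f / a] and [g / b], then integrated. Positive upper bounds [a] and [b]
    in place of the norms avoid a division by zero. *)
Lemma J_hoelder n (f g : 'rV[R]_n -> R) (p q a b : R) :
  cbox f -> cbox g -> (forall x, 0 <= f x) -> (forall x, 0 <= g x) ->
  0 < p -> 0 < q -> p^-1 + q^-1 = 1 -> 0 < a -> 0 < b ->
  J (fun x => f x `^ p) <= a `^ p -> J (fun x => g x `^ q) <= b `^ q ->
  J (fun x => f x * g x) <= a * b.
Proof.
move=> cf cg f0 g0 p0 q0 pq a0 b0 Jf Jg.
have ap : 0 < a `^ p by exact: powR_gt0.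
have bq : 0 < b `^ q by exact: powR_gt0.
have cfp := cbox_powR p0 cf f0; have cgq := cbox_powR q0 cg g0.
pose F x := (a * b / (a `^ p) / p) * (f x `^ p) + (a * b / (b `^ q) / q) * (g x `^ q).
have cF : cbox F by apply: cboxD; exact: cboxZ.
apply: (@le_trans _ _ (J F)).
  apply: le_J => //; first exact: cboxM cf cg.1.
  move=> x; rewrite /F.
  have h := conjugate_powR (divr_ge0 (f0 x) (ltW a0)) (divr_ge0 (g0 x) (ltW b0)) p0 q0 pq.
  rewrite !powRM ?invr_ge0 ?(ltW a0) ?(ltW b0)// in h.
  rewrite !invr_powR ?(ltW a0) ?(ltW b0)// in h.
  have -> : f x * g x = (a * b) * ((f x / a) * (g x / b)) by field; rewrite !gt_eqF.
  have -> : a * b / a `^ p / p * f x `^ p + a * b / b `^ q / q * g x `^ q =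
    (a * b) * (f x `^ p / a `^ p / p + g x `^ q / b `^ q / q) by ring.
  by apply: ler_wpM2l h; rewrite mulr_ge0 ?ltW.
rewrite /F JD; [|exact: cboxZ|exact: cboxZ]; rewrite !JZ//.
rewrite [leRHS](_ : a * b = a * b / p + a * b / q); last by rewrite -!mulrDr pq mulr1.
have ab : 0 <= a * b by rewrite mulr_ge0 ?ltW.
apply: lerD.
  rewrite (_ : _ * _ = a * b / p * (J (fun x => f x `^ p) / a `^ p)); last by ring.
  by apply: ler_piMr; rewrite ?divr_ge0 ?(ltW p0)// ler_pdivrMr ?mul1r.
rewrite (_ : _ * _ = a * b / q * (J (fun x => g x `^ q) / b `^ q)); last by ring.
by apply: ler_piMr; rewrite ?divr_ge0 ?(ltW q0)// ler_pdivrMr ?mul1r.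
Qed.

(** The sum norm is chosen because it splits additively into the first partial derivative and the
    gradient of the slice. *)
Definition gradl1 n (g : 'rV[R]_n -> R) (x : 'rV[R]_n) : R := \sum_i `|pderiv i g x|.

Lemma cbox_gradl1 n (g : 'rV[R]_n -> R) : cbox1 g -> cbox (gradl1 g).
Proof. by move=> cg; apply: cbox_sum => i; apply: cbox_norm; exact: (cg.2 i).2. Qed.

Lemma gradl1_slice n (g : 'rV[R]_n.+1 -> R) (x : R) (y : 'rV[R]_n) :
  gradl1 g (vcons x y) = `|pderiv ord0 g (vcons x y)| + gradl1 (fun z => g (vcons x z)) y.
Proof.
rewrite /gradl1 big_ord_recl; congr (_ + _).
by apply: eq_bigr => i _; rewrite pderiv_slice.
Qed.

(** The base of the power is replaced by [G y], the integral of [|pderiv ord0 g|] along the line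
    through [y] in the first direction. As [G] does not depend on [x] and its integral is at most
    [J (gradl1 g)], the hypothesis applies to every slice with [h := G]. *)
Lemma J_powR_gradl1_step n (g : 'rV[R]_n.+1 -> R) (q b : R) : 0 < q -> cbox1 g ->
  (forall x, 0 <= g x) -> 0 <= b ->
  (forall x (h : 'rV[R]_n -> R), cbox h -> (forall y, 0 <= h y) -> J h <= J (gradl1 g) ->
     J (fun y => g (vcons x y) * h y `^ q) <= b * J (gradl1 (fun y => g (vcons x y)))) ->
  J (fun x => g x * g x `^ q) <= b * J (gradl1 g).
Proof.
move=> q0 cg g0 b0 H.
have [cf df] := cg.
have [cG JG] := J_swap (cbox_norm (df ord0).2).
set G := (fun y => _) in cG JG.
have G0 y : 0 <= G y by exact: Rintegral_ge0.
have JGle : J G <= J (gradl1 g).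
  rewrite JG; apply: le_J => [||x]; [exact/cbox_norm/(df ord0).2|exact: cbox_gradl1|].
  by rewrite /gradl1 big_ord_recl lerDl sumr_ge0.
have cgq : cbox (fun x => g x * g x `^ q) by exact: (cboxM cf (cbox_powR q0 cf g0).1).
rewrite /= -RintegralZl//; last exact/continuous_itv_integrable/J_slice_continuous/cbox_gradl1.
apply: le_Rintegral => //.
- exact: (continuous_itv_integrable _ _ (J_slice_continuous cgq)).
- apply: continuous_itv_integrable => x; apply: continuousM; first exact: cst_continuous.
  exact: (J_slice_continuous (cbox_gradl1 cg)).
move=> x _.
apply: (@le_trans _ _ (J (fun y : 'rV[R]_n => g (vcons x y) * G y `^ q))).
  apply: le_J => [||y].
  - exact: (cbox_slice x cgq).
  - apply: cboxM; first exact: cbox_slice.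
    exact: (cbox_powR q0 cG G0).1.
  - apply: ler_wpM2l => //; apply: ge0_ler_powR; rewrite ?nnegrE ?(ltW q0)//.
    exact: le_int_pderiv0.
apply: le_trans (H x G cG G0 JGle) _.
apply: ler_wpM2l => //; apply: le_J => [||y].
- by apply: cbox_gradl1; exact: cbox1_slice.
- by apply: cbox_slice; exact: cbox_gradl1.
- by rewrite gradl1_slice lerDr.
Qed.

(* [J (g h^(1/n)) <= J(h)^(1/n) J |Dg|] is the dual form of the Sobolev inequality; it makes
   sense for [n = 1] and carries the induction on the dimension. *)
Lemma sobolev_dual n (g h : 'rV[R]_n.+1 -> R) (b : R) : cbox1 g -> cbox h ->
  (forall x, 0 <= g x) -> (forall x, 0 <= h x) -> 0 < b ->
  J h <= b `^ n.+1%:R -> J (fun x => g x * h x `^ (n.+1%:R)^-1) <= b * J (gradl1 g).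
Proof.
elim: n g h b => [|n IH] g h b cg ch g0 h0 b0 Jh.
  have [cf df] := cg.
  have gD x : g x <= J (gradl1 g).
    have [t [y ->]] := vcons_surj x.
    apply: le_trans (le_int_pderiv0 t y cg) _; rewrite /=.
    rewrite le_eqVlt; apply/orP; left; apply/eqP; apply: eq_Rintegral => s _.
    have -> : y = 0 by apply/rv_eqP => -[].
    by rewrite /gradl1 big_ord_recl big_ord0 addr0.
  have -> : (fun x => g x * h x `^ 1%:R^-1) = fun x => g x * h x.
    by apply/funext => x; rewrite invr1 powRr1.
  apply: (@le_trans _ _ (J (fun x => J (gradl1 g) * h x))).
    apply: le_J => [||x]; [exact: cboxM ch.1|exact: cboxZ|].
    by apply: ler_wpM2r.
  rewrite powRr1 ?(ltW b0)// in Jh.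
  rewrite JZ// mulrC; apply: ler_wpM2r => //.
  apply: J_ge0; [exact: cbox_gradl1|by move=> x; exact: sumr_ge0].
set N : R := n.+1%:R in IH *.
have N0 : 0 < N by rewrite ltr0n.
have NE : n.+2%:R = N + 1 by rewrite -natr1.
rewrite NE in Jh *.
have q0 : 0 < N^-1 by rewrite invr_gt0.
have N10 : 0 < N + 1 by rewrite addr_gt0.
have JD0 : 0 <= J (gradl1 g).
  apply: J_ge0; [exact: cbox_gradl1|by move=> x; exact: sumr_ge0].
(* [J (gradl1 g)] may be zero, whereas Hölder's inequality asks for positive bounds; the slack
   [e / b] is arbitrarily small. *)
suff HD (D : R) : 0 < D -> J (gradl1 g) <= D -> J (fun x => g x * h x `^ (N + 1)^-1) <= b * D.
  apply/ler_addgt0Pr => e e0.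
  have eb : 0 < e / b by rewrite divr_gt0.
  apply: le_trans (HD (J (gradl1 g) + e / b) _ _) _; [by rewrite ltr_wpDl|by rewrite lerDl ltW|].
  by rewrite mulrDr [X in _ + X](_ : _ = e)//; field; rewrite gt_eqF.
move=> D0 JD.
have S : J (fun x => g x * g x `^ N^-1) <= D `^ N^-1 * J (gradl1 g).
  apply: J_powR_gradl1_step => //; first exact: powR_ge0.
  move=> x k ck k0 Jk; apply: IH => //; [exact: cbox1_slice|exact: powR_gt0|].
  rewrite -powRrM mulVf ?(gt_eqF N0)// powRr1 ?(ltW D0)//; exact: le_trans JD.
rewrite mulrC.
have p0 : 0 < 1 + N^-1 by rewrite addr_gt0.
have ch' := cbox_powR (_ : 0 < (N + 1)^-1) ch h0.
(* [1 + N^-1] and [N + 1] are conjugate; [S] controls the power of [g], and the hypothesis on [h]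
   the other factor. *)
apply: (@J_hoelder _ g (fun x => h x `^ (N + 1)^-1) (1 + N^-1) (N + 1) D b cg.1 (ch' _)
  g0 (fun x => powR_ge0 _ _) p0 N10 _ D0 b0).
- by rewrite invr_gt0.
- by field; rewrite !gt_eqF.
- rewrite (_ : (fun x => _) = fun x => g x * g x `^ N^-1); last first.
    by apply/funext => x; exact: powR1D.
  apply: le_trans S _.
  rewrite (powR1D (ltW D0) q0) mulrC.
  by apply: ler_wpM2r => //; exact: powR_ge0.
- rewrite (_ : (fun x => _) = h)//.
  by apply/funext => x; rewrite -powRrM mulVf ?(gt_eqF N10)// powRr1.
Qed.

(** In dimension [d = n.+2] the exponent is [d / (d - 1)]. The slices have dimension [d - 1], where
    [sobolev_dual] pairs them with the power [1 / (d - 1)] of the line integral. *)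
Lemma sobolev n (g : 'rV[R]_n.+2 -> R) (D : R) : cbox1 g -> (forall x, 0 <= g x) ->
  0 < D -> J (gradl1 g) <= D ->
  J (fun x => g x `^ (1 + n.+1%:R^-1)) <= D `^ (1 + n.+1%:R^-1).
Proof.
move=> cg g0 D0 JD; set N : R := n.+1%:R.
have N0 : 0 < N by rewrite ltr0n.
have q0 : 0 < N^-1 by rewrite invr_gt0.
have p0 : 0 < 1 + N^-1 by rewrite addr_gt0.
rewrite (_ : (fun x => _) = fun x => g x * g x `^ N^-1); last first.
  by apply/funext => x; exact: powR1D.
apply: (@le_trans _ _ (D `^ N^-1 * J (gradl1 g))).
  apply: J_powR_gradl1_step => //; first exact: powR_ge0.
  move=> x k ck k0 Jk; apply: sobolev_dual => //; [exact: cbox1_slice|exact: powR_gt0|].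
  rewrite -powRrM mulVf ?(gt_eqF N0)// powRr1 ?(ltW D0)//; exact: le_trans JD.
rewrite (powR1D (ltW D0) q0) mulrC.
by apply: ler_wpM2r => //; exact: powR_ge0.
Qed.

End box_integral.

(** * Delta-convexity as a bound on the Hessian form *)

Lemma continuous_at_sum (R : realType) (T : topologicalType) (I : finType) (f : I -> T -> R) (x : T) :
  (forall i, {for x, continuous (f i)}) -> {for x, continuous (fun y => \sum_i f i y)}.
Proof.
move=> H; elim: (index_enum I) => [|i s IH].
  by under [X in {for _, continuous X}]eq_fun do rewrite big_nil; exact: cst_continuous.
under [X in {for _, continuous X}]eq_fun do rewrite big_cons.
exact: continuousD (H i) IH.
Qed.

Section quadratic_forms.
Variables (R : realType) (n : nat).
Implicit Types (A B : 'M[R]_n) (u v w : 'rV[R]_n).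

Definition bform A u v : R := (u *m A *m v^T) 0 0.
(** Squared Euclidean length, kept apart from the ambient norm, which is the maximum norm. *)
Definition sqn v : R := \sum_i v 0 i ^+ 2.

Lemma sqn_ge0 v : 0 <= sqn v.
Proof. by apply: sumr_ge0 => i _; exact: sqr_ge0. Qed.

Lemma sqn_eq0 v : sqn v = 0 -> v = 0.
Proof.
move/eqP; rewrite psumr_eq0 => [/allP h|i _]; last exact: sqr_ge0.
by apply/rowP => i; rewrite mxE; apply/eqP; have := h i; rewrite mem_index_enum sqrf_eq0 => /(_ isT) /=.
Qed.

Lemma bformE A u v : bform A u v = \sum_i \sum_j u 0 i * v 0 j * A i j.
Proof.
rewrite /bform mxE exchange_big; apply: eq_bigr => j _ /=.
by rewrite !mxE mulr_suml; apply: eq_bigr => i _; rewrite mulrAC.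
Qed.

Lemma sqn_bform v w : bform 1%:M v w = \sum_i v 0 i * w 0 i.
Proof. by rewrite /bform mulmx1 mxE; apply: eq_bigr => i _; rewrite mxE. Qed.

Lemma sqnE v : sqn v = bform 1%:M v v.
Proof. by rewrite sqn_bform; apply: eq_bigr => i _; rewrite expr2. Qed.

Lemma bform_addscalar A c u : bform (A + c%:M) u u = bform A u u + c * sqn u.
Proof.
by rewrite /bform mulmxDr mulmxDl mxE mul_mx_scalar -scalemxAl [X in _ + X]mxE sqnE /bform mulmx1.
Qed.

Lemma le_coord_sqn v i j : `|v 0 i * v 0 j| <= sqn v.
Proof.
have h k : v 0 k ^+ 2 <= sqn v.
  by rewrite /sqn (bigD1 k)//= lerDl sumr_ge0// => l _; exact: sqr_ge0.
have := h i; have := h j => hj hi.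
have : 0 <= (`|v 0 i| - `|v 0 j|) ^+ 2 by exact: sqr_ge0.
rewrite normrM sqrrB !real_normK ?num_real// -mulr_natl; lra.
Qed.

Lemma bform_bound A : exists2 K : R, 0 < K & forall v, `|bform A v v| <= K * sqn v.
Proof.
exists (1 + \sum_i \sum_j `|A i j|) => [|v].
  by rewrite ltr_pwDl// sumr_ge0// => i _; rewrite sumr_ge0.
rewrite bformE mulrDl mul1r -[leLHS]add0r lerD ?sqn_ge0//.
apply: le_trans (ler_norm_sum _ _ _) _; rewrite mulr_suml; apply: ler_sum => i _.
apply: le_trans (ler_norm_sum _ _ _) _; rewrite mulr_suml; apply: ler_sum => j _.
by rewrite normrM mulrC ler_wpM2l// le_coord_sqn.
Qed.

Lemma bform_sym A u v : A^T = A -> bform A u v = bform A v u.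
Proof.
move=> As; rewrite !bformE exchange_big /=; apply: eq_bigr => i _; apply: eq_bigr => j _.
by rewrite -{1}As mxE mulrC [u 0 j * _]mulrC mulrC.
Qed.

Lemma bformDZl A c u v w : bform A (u + c *: v) w = bform A u w + c * bform A v w.
Proof. by rewrite /bform !mulmxDl -!scalemxAl mxE [X in _ + X]mxE. Qed.

Lemma bformDZr A c u v w : bform A w (u + c *: v) = bform A w u + c * bform A w v.
Proof. by rewrite /bform linearD linearZ /= mulmxDr -scalemxAr mxE [X in _ + X]mxE. Qed.

(** With [w = v *m B], invertibility bounds [sqn v] by a multiple of [sqn w], and nonnegativity of
    the form at [v - K^-1 *: w] bounds [sqn w] by [K] times the form at [v]. *)
Lemma psd_unit_coercive B : B^T = B -> B \in unitmx -> (forall v, 0 <= bform B v v) ->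
  exists2 c : R, 0 < c & forall v, c * sqn v <= bform B v v.
Proof.
move=> Bs Bu B0.
have [K K0 HK] := bform_bound B.
have [K' K'0 HK'] := bform_bound (invmx B *m (invmx B)^T).
exists (K * K')^-1 => [|v]; first by rewrite invr_gt0 mulr_gt0.
pose w := v *m B.
have vE : v = w *m invmx B by rewrite /w mulmxK.
have h1 : sqn v <= K' * sqn w.
  apply: le_trans (HK' w); rewrite (_ : bform _ w w = sqn v) ?ler_norm//.
  by rewrite [in RHS]vE sqnE /bform mulmx1 (trmx_mul w (invmx B)) !mulmxA.
have h2 : sqn w <= K * bform B v v.
  have := B0 (v - K^-1 *: w).
  rewrite -scaleNr bformDZl !bformDZr [bform B w v]bform_sym//.
  have -> : bform B v w = sqn w by rewrite sqnE /bform mulmx1.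
  have := HK w; rewrite ger0_norm// => h3 h4.
  have : K^-1 * (K^-1 * bform B w w) <= K^-1 * sqn w.
    by rewrite ler_wpM2l ?invr_ge0 ?(ltW K0)// ler_pdivrMl.
  have : 0 < K^-1 by rewrite invr_gt0.
  move: h4; set k := K^-1 => h4 k0 h5.
  rewrite -ler_pdivrMl// -/k; lra.
rewrite ler_pdivrMl ?mulr_gt0// [K * K']mulrC -mulrA.
by apply: le_trans h1 _; rewrite ler_wpM2l// ltW.
Qed.

(* The least [t >= 0] with [A + t >= 0] vanishes: otherwise [A + t] would be invertible
   and nonnegative, hence coercive, and [t] could be decreased. *)
Lemma sym_psd A : A^T = A -> (forall t, 0 < t -> A + t%:M \in unitmx) ->
  forall v, 0 <= bform A v v.
Proof.
move=> As Au.
pose S : set R := [set t | 0 <= t /\ forall v, 0 <= bform (A + t%:M) v v].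
have S0 : S !=set0.
  have [K K0 HK] := bform_bound A; exists K; split; first exact: ltW.
  move=> v; rewrite bform_addscalar -lerBlDr sub0r.
  by rewrite lerNl; apply: le_trans (HK v); rewrite -normrN ler_norm.
have Slb : has_lbound S by exists 0 => t [].
have Sinf : has_inf S by split.
set m := inf S.
have m0 : 0 <= m by apply: lb_le_inf => // t [].
have mS v : 0 <= bform (A + m%:M) v v.
  rewrite bform_addscalar; have := sqn_ge0 v; rewrite le_eqVlt => /orP[/eqP v0|v0].
    have [t [t0 /(_ v)]] := S0; by rewrite bform_addscalar -v0 !mulr0.
  rewrite -lerBlDl sub0r -ler_pdivrMr//; apply: lb_le_inf => // t [_ /(_ v)].
  by rewrite bform_addscalar ler_pdivrMr// -lerBlDl sub0r.
move: m0; rewrite le_eqVlt => /orP[/eqP m0|m0].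
  by move=> v; have := mS v; rewrite -m0 bform_addscalar mul0r addr0.
have Bs : (A + m%:M)^T = A + m%:M by rewrite linearD /= As tr_scalar_mx.
have [c c0 Hc] := psd_unit_coercive Bs (Au _ m0) mS.
pose d := Num.min c m.
have d0 : 0 < d by rewrite lt_min c0.
have : m <= m - d.
  apply: ge_inf => //; split; first by rewrite subr_ge0 ge_min lexx orbT.
  move=> v; have := Hc v; rewrite !bform_addscalar => h.
  have : d * sqn v <= c * sqn v by rewrite ler_wpM2r ?sqn_ge0// ge_min lexx.
  rewrite mulrBl; lra.
by move=> h; exfalso; move: d0 h; lra.
Qed.

Lemma Gamma_closure_ge (delta : R) (l : 'rV[R]_n) :
  closure (@Gamma R n delta) l -> forall i, - delta * \sum_j l 0 j <= l 0 i.
Proof.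
move=> cl i.
pose f (x : 'rV[R]_n) := x 0 i + delta * \sum_j x 0 j.
have cf : continuous f.
  have cc j : continuous (fun x : 'rV[R]_n => x 0 j) by exact: coord_continuous.
  move=> x; have cs : {for x, continuous (fun x : 'rV[R]_n => \sum_j x 0 j)}.
    by apply: continuous_at_sum => j; exact: cc.
  have c1 : {for x, continuous (fun x : 'rV[R]_n => delta * \sum_j x 0 j)}.
    by apply: continuousM cs; exact: cst_continuous.
  exact: continuousD (cc i x) c1.
have c2 : closed [set x | 0 <= f x].
  by apply: (@preimage_closed _ _ f [set t | 0 <= t]) => [x _|]; [exact: cf|exact: closed_ge].
have : [set x | 0 <= f x] l.
  rewrite ((closure_id _).1 c2); apply: closure_subset cl => x /(_ i) /=.
  by rewrite /f mulNr -subr_gt0 opprK => /ltW.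
by rewrite /= /f mulNr -[in X in _ -> X]subr_ge0 opprK.
Qed.

(** All roots of the characteristic polynomial are at least [- delta * \tr A], so [A] shifted by
    [delta * \tr A + t] is invertible for every [t > 0], and [sym_psd] applies. Summing the root
    bounds gives [(1 + n * delta) * \tr A >= 0], hence the sign of the trace. *)
Lemma closure_Gamma_form (delta : R) (A : 'M[R]_n) : (0 < n)%N -> 0 <= delta -> A^T = A ->
  mx_in (closure (@Gamma R n delta)) A ->
  0 <= \tr A /\ forall v, - delta * \tr A * sqn v <= bform A v v.
Proof.
move=> n0 d0 As [l [chA /Gamma_closure_ge Hl]].
have trA : \tr A = \sum_j l 0 j.
  apply: oppr_inj; rewrite -char_poly_trace// chA.
  have := @coefPn_prod_XsubC R [seq l 0 i | i <- index_enum 'I_n].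
  have -> : size [seq l 0 i | i <- index_enum 'I_n] = n.
    by rewrite size_map /index_enum unlock -enumT size_enum_ord.
  by rewrite !big_map => -> //; rewrite -lt0n.
have tr0 : 0 <= \tr A.
  have : \sum_(i < n) (- delta * \sum_j l 0 j) <= \sum_i l 0 i by apply: ler_sum => i _.
  rewrite sumr_const card_ord -trA -mulr_natl => h.
  have : 0 <= (1 + n%:R * delta) * \tr A by move: h; lra.
  by rewrite pmulr_rge0// ltr_pwDl// mulr_ge0.
split=> // v.
have : 0 <= bform (A + (delta * \tr A)%:M) v v.
  apply: sym_psd => [|t t0]; first by rewrite linearD /= As tr_scalar_mx.
  rewrite -row_free_unit -kermx_eq0.
  have := eigenvalue_root_char A (- (delta * \tr A + t)).
  rewrite /eigenvalue /eigenspace raddfN opprK raddfD addrA => /negbRL /= /esym.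
  move=> <-; apply/negP; rewrite chA => /rootP; rewrite horner_prod => /eqP.
  move=> /prodf_eq0 [i _]; rewrite hornerXsubC subr_eq0 => /eqP e.
  have := Hl i; rewrite -trA -e; move: t0; lra.
by rewrite bform_addscalar; lra.
Qed.

End quadratic_forms.

(** * Differential calculus from continuous partial derivatives *)

Section multivariate_calculus.
Variables (R : realType) (n : nat).
Implicit Types (f W : 'rV[R]_n -> R) (x v : 'rV[R]_n) (Om : set 'rV[R]_n).

Lemma is_derive_line f x v (s d : R) :
  is_derive (x + s *: v) v f d -> is_derive s 1 (fun t => f (x + t *: v)) d.
Proof.
have E (h : R) : f (x + (h *: (1 : R) + s) *: v) = f (h *: v + (x + s *: v)).
  by rewrite [h *: (1 : R)]mulr1 scalerDl addrCA.
have [d1 e1] := derive_transfer f (fun t : R => f (x + t *: v)) (x + s *: v) v s 1 E.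
by move=> [df fd]; apply: DeriveDef; [exact: d1|rewrite e1].
Qed.

Lemma line_is_derive f x v (d : R) :
  is_derive (0 : R) (1 : R) (fun t : R => f (x + t *: v)) d -> is_derive x v f d.
Proof.
have E (h : R) : f (h *: v + x) = f (x + (h *: (1 : R) + 0) *: v).
  by rewrite [h *: (1 : R)]mulr1 addr0 addrC.
have [d1 e1] := derive_transfer (fun t : R => f (x + t *: v)) f (0 : R) 1 x v E.
by move=> [df fd]; apply: DeriveDef; [exact: d1|rewrite e1].
Qed.

Lemma addABA (V : zmodType) (x a b : V) : x + a + b - x = a + b.
Proof. by rewrite -[x + a + b]addrA [x + _]addrC addrK. Qed.

Definition C1_at f x := forall i, derivable f x (evec R i) /\ {for x, continuous (pderiv i f)}.

Lemma is_derive_pderiv f x i : derivable f x (evec R i) ->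
  is_derive x (evec R i) f (pderiv i f x).
Proof. by move=> h; apply: DeriveDef. Qed.

Lemma norm_evec i : `|evec R (i : 'I_n)| <= 1.
Proof.
apply/ler_rv_normP => // j; rewrite mxE eqxx /=.
by case: (j == i); rewrite ?normr1 ?normr0.
Qed.

Lemma near_ball x (P : 'rV[R]_n -> Prop) : (\forall y \near x, P y) ->
  exists2 d : R, 0 < d & forall y, `|y - x| < d -> P y.
Proof.
move=> /nbhs_ballP [d /= d0 Hd]; exists d => // y yx.
by apply: Hd; rewrite -ball_normE /= distrC.
Qed.

(** Successive truncations of [v] are the vertices of an axis-parallel path from 0 to [v]. *)
Definition trunc_row (k : nat) v : 'rV[R]_n := \row_i if (i < k)%N then v 0 i else 0.

Lemma norm_trunc_row k v : `|trunc_row k v| <= `|v|.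
Proof.
apply/ler_rv_normP => // i; rewrite mxE; case: ifP => _; last by rewrite normr0.
exact: le_coord_norm.
Qed.

Lemma trunc_rowS (k : 'I_n) v :
  trunc_row k.+1 v = trunc_row k v + v 0 k *: evec R k.
Proof.
apply/rowP => i; rewrite !mxE eqxx /= ltnS.
have [->|ik] := eqVneq i k; first by rewrite leqnn ltnn add0r mulr1.
by rewrite mulr0 addr0 leq_eqVlt (negbTE ik : (val i == val k) = false).
Qed.

(** The mean value theorem on each edge of the path of truncations costs at most [e] times the norm
    of [w]. The factor 2 in the condition on [w] keeps the edges within distance [d] of [x] by the
    triangle inequality. *)
Lemma C1_expansion f x (e d : R) : 0 <= e ->
  (forall y, `|y - x| < d -> forall i, derivable f y (evec R i) /\
     `|pderiv i f y - pderiv i f x| <= e) ->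
  forall w, 2 * `|w| < d ->
  `|f (x + w) - f x - \sum_i w 0 i * pderiv i f x| <= n%:R * (e * `|w|).
Proof.
move=> e0 H w wd.
suff T k : (k <= n)%N -> `|f (x + trunc_row k w) - f x -
    \sum_(i < n | (i < k)%N) w 0 i * pderiv i f x| <= k%:R * (e * `|w|).
  have := T n (leqnn n); rewrite (_ : trunc_row n w = w); last first.
    by apply/rowP => i; rewrite mxE ltn_ord.
  by under eq_bigl => i do rewrite ltn_ord.
elim: k => [_|k IH kn].
  rewrite (_ : trunc_row 0 w = 0); last by apply/rowP => i; rewrite !mxE.
  by rewrite big_pred0_eq addr0 subrr subr0 normr0 mul0r.
have {}IH := IH (ltnW kn); pose ik := Ordinal kn.
have -> : \sum_(i < n | (i < k.+1)%N) w 0 i * pderiv i f x =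
    w 0 ik * pderiv ik f x + \sum_(i < n | (i < k)%N) w 0 i * pderiv i f x.
  rewrite (bigD1 ik)//=; congr (_ + _); apply: eq_bigl => i.
  rewrite ltnS [in RHS]ltn_neqAle andbC; congr (_ && _).
rewrite (trunc_rowS ik) addrA.
set y := x + trunc_row k w in IH *.
have yx (s : R) : `|s - 0| <= `|w 0 ik| -> `|y + s *: evec R ik - x| < d.
  move=> sw; rewrite /y addABA.
  apply: le_lt_trans (ler_normD _ _) (le_lt_trans _ wd); rewrite mulrDl mul1r.
  apply: lerD; first exact: norm_trunc_row.
  rewrite normrZ -[leRHS]mulr1 ler_pM//; last exact: norm_evec.
  by rewrite subr0 in sw; apply: le_trans sw _; exact: le_coord_norm.
have dF (s : R) : `|s - 0| <= `|w 0 ik| ->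
    is_derive s 1 (fun t : R => f (y + t *: evec R ik)) (pderiv ik f (y + s *: evec R ik)).
  by move=> sw; apply: is_derive_line; apply: is_derive_pderiv; exact: (H _ (yx s sw) ik).1.
have [s sw] := MVT_step dF.
rewrite add0r scale0r addr0 => E.
have -> : f (y + w 0 ik *: evec R ik) - f x - (w 0 ik * pderiv ik f x +
    \sum_(i < n | (i < k)%N) w 0 i * pderiv i f x) =
  (f y - f x - \sum_(i < n | (i < k)%N) w 0 i * pderiv i f x) +
  w 0 ik * (pderiv ik f (y + s *: evec R ik) - pderiv ik f x).
  rewrite mulrBr -E; ring.
apply: le_trans (ler_normD _ _) _; rewrite -natr1 mulrDl mul1r; apply: lerD => //.
rewrite normrM mulrC ler_pM//; last exact: le_coord_norm.
exact: (H _ (yx s sw) ik).2.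
Qed.

Lemma is_derive_C1 f x v : (\forall y \near x, C1_at f y) ->
  is_derive x v f (\sum_i v 0 i * pderiv i f x).
Proof.
move=> Hr; have C1x : C1_at f x by exact: nbhs_singleton Hr.
apply: line_is_derive; apply: is_derive_eps => e e0.
have v0 : 0 < `|v| + 1 by rewrite ltr_wpDl.
have n0 : 0 < n%:R + 1 :> R by rewrite ltr_wpDl.
pose e' := e / (n%:R + 1) / (`|v| + 1).
have e'0 : 0 < e' by rewrite !divr_gt0.
have [d d0 Hd] : exists2 d : R, 0 < d & forall y, `|y - x| < d -> forall i,
    derivable f y (evec R i) /\ `|pderiv i f y - pderiv i f x| <= e'.
  suff : \forall y \near x, forall i, derivable f y (evec R i) /\ `|pderiv i f y - pderiv i f x| <= e'.
    by move/near_ball.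
  apply: (@filter_forall _ _ (fun i y => derivable f y (evec R i) /\
    `|pderiv i f y - pderiv i f x| <= e') (nbhs x) (nbhs_filter x)) => i.
  have /cvgrPdist_le/(_ _ e'0) := (C1x i).2; apply: filterS2 Hr => y Hy h.
  by split; [exact: (Hy i).1|rewrite distrC].
exists (d / 2 / (`|v| + 1)) => [|h hd]; first by rewrite !divr_gt0.
rewrite add0r scale0r addr0.
have nhv : `|h *: v| <= `|h| * (`|v| + 1) by rewrite normrZ ler_wpM2l// lerDl.
have -> : h * (\sum_i v 0 i * pderiv i f x) = \sum_i (h *: v) 0 i * pderiv i f x.
  by rewrite mulr_sumr; apply: eq_bigr => i _; rewrite mxE mulrA.
apply: le_trans (C1_expansion (ltW e'0) Hd _) _.
  rewrite mulrC -ltr_pdivlMr//; apply: le_lt_trans nhv _.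
  by rewrite -ltr_pdivlMr.
apply: (@le_trans _ _ (n%:R * (e' * (`|h| * (`|v| + 1))))).
  by rewrite !ler_wpM2l// ltW.
rewrite (_ : _ * _ = (n%:R / (n%:R + 1)) * (e * `|h|)); last first.
  by rewrite /e'; field; rewrite !gt_eqF.
apply: ler_piMl; first by rewrite mulr_ge0// ltW.
by rewrite ler_pdivrMr// mul1r lerDl.
Qed.

Definition C2_at W x := C1_at W x /\ forall i, C1_at (pderiv i W) x.

Lemma C2_on_at Om W x : open Om -> C2_on Om W -> Om x -> \forall y \near x, C2_at W y.
Proof.
move=> oO H Ox; have : nbhs x Om by apply: open_nbhs_nbhs; split.
by apply: filterS => y /H [_ [h1 h2]]; split.
Qed.

(** The mean value theorem is applied along direction [i] to a difference of [W] in direction [j],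
    then along [j]. The second difference is symmetric in [i] and [j], whence the equality of mixed
    derivatives. *)
Lemma mixed_difference W x i j (e d h : R) :
  (forall y, `|y - x| < d -> C2_at W y /\
     `|pderiv j (pderiv i W) y - pderiv j (pderiv i W) x| <= e) ->
  2 * `|h| < d ->
  `|W (x + h *: evec R j + h *: evec R i) - W (x + h *: evec R i)
    - W (x + h *: evec R j) + W x - h * h * pderiv j (pderiv i W) x| <= e * (h * h).
Proof.
move=> H hd.
have near_x (s t : R) : `|s| <= `|h| -> `|t| <= `|h| ->
    `|x + t *: evec R j + s *: evec R i - x| < d.
  move=> sh th; rewrite addABA.
  apply: le_lt_trans (ler_normD _ _) (le_lt_trans _ hd); rewrite mulrDl mul1r !normrZ.
  by apply: lerD; rewrite -[leRHS]mulr1 ler_pM// norm_evec.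
pose g (s : R) := W (x + h *: evec R j + s *: evec R i) - W (x + s *: evec R i).
pose dg (s : R) := pderiv i W (x + h *: evec R j + s *: evec R i) - pderiv i W (x + s *: evec R i).
have dF (s : R) : `|s - 0| <= `|h| -> is_derive s 1 g (dg s).
  rewrite subr0 => sh; apply: is_deriveB; apply: is_derive_line; apply: is_derive_pderiv.
    by have [[+ _] _] := H _ (near_x s h sh (lexx _)); move=> /(_ i) [].
  have := near_x s 0 sh; rewrite normr0 scale0r addr0 => /(_ (normr_ge0 _)) h1.
  by have [[+ _] _] := H _ h1; move=> /(_ i) [].
have [s] := MVT_step dF; rewrite subr0 add0r => sh E.
have dF2 (t : R) : `|t - 0| <= `|h| -> is_derive t 1 (fun t : R => pderiv i W (x + s *: evec R i + t *: evec R j))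
    (pderiv j (pderiv i W) (x + s *: evec R i + t *: evec R j)).
  rewrite subr0 => th; apply: is_derive_line; apply: is_derive_pderiv.
  have := near_x s t sh th; rewrite (addrAC x) => h1.
  by have [[_ +] _] := H _ h1; move=> /(_ i j) [].
have [t] := MVT_step dF2; rewrite subr0 add0r scale0r addr0 => th E2.
have h1 := near_x s t sh th; rewrite (addrAC x) in h1.
have [_ h2] := H _ h1.
rewrite (_ : _ - _ = h * h * (pderiv j (pderiv i W) (x + s *: evec R i + t *: evec R j) - pderiv j (pderiv i W) x)).
  rewrite normrM mulrC (_ : `|h * h| = h * h); last by rewrite ger0_norm// -expr2 sqr_ge0.
  by apply: ler_wpM2r => //; rewrite -expr2 sqr_ge0.
rewrite mulrBr; congr (_ - _); rewrite -mulrA -E2 [x + s *: _ + _]addrAC -/(dg s) -E /g scale0r !addr0; ring.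
Qed.

Lemma clairaut W x i j : (\forall y \near x, C2_at W y) ->
  pderiv j (pderiv i W) x = pderiv i (pderiv j W) x.
Proof.
move=> HW; have [_ Wx] : C2_at W x by exact: nbhs_singleton HW.
apply/eqP; rewrite -subr_eq0 -normr_le0; apply/ler_addgt0Pr => e e0; rewrite add0r.
have e20 : 0 < e / 2 by lra.
have [d d0 Hd] : exists2 d : R, 0 < d & forall y, `|y - x| < d ->
  C2_at W y /\ `|pderiv j (pderiv i W) y - pderiv j (pderiv i W) x| <= e / 2 /\
  `|pderiv i (pderiv j W) y - pderiv i (pderiv j W) x| <= e / 2.
  apply: near_ball; have /cvgrPdist_le/(_ _ e20) := (Wx i j).2.
  have /cvgrPdist_le/(_ _ e20) := (Wx j i).2.
  apply: filterS3 HW => y Hy h1 h2.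
  by split; [exact: Hy|split; rewrite distrC; [exact: h2|exact: h1]].
pose h := d / 4.
have h0 : 0 < h by rewrite /h; lra.
have hd : 2 * `|h| < d by rewrite gtr0_norm// /h; lra.
have H1 y : `|y - x| < d -> C2_at W y /\ `|pderiv j (pderiv i W) y - pderiv j (pderiv i W) x| <= e / 2.
  by move=> /Hd [hy [hy1 hy2]]; split; [exact: hy|exact: hy1].
have H2 y : `|y - x| < d -> C2_at W y /\ `|pderiv i (pderiv j W) y - pderiv i (pderiv j W) x| <= e / 2.
  by move=> /Hd [hy [hy1 hy2]]; split; [exact: hy|exact: hy2].
have := mixed_difference H1 hd; have := mixed_difference H2 hd.
rewrite [x + h *: evec R i + _]addrAC.
set A := pderiv j _ x; set B := pderiv i _ x.
set a := W _; set b := W _; set c := W _ => h1 h2.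
have hh : 0 < h * h by rewrite mulr_gt0.
rewrite -(ler_pM2r hh) -{1}(ger0_norm (ltW hh)) -normrM.
have -> : (A - B) * (h * h) = (a - b - c + W x - h * h * B) - (a - c - b + W x - h * h * A) by ring.
apply: le_trans (ler_normB _ _) _.
by rewrite (_ : e * (h * h) = e / 2 * (h * h) + e / 2 * (h * h)); [exact: (lerD h1 h2)|field].
Qed.

(** If [g2 > 0], then [g1], zero at the maximum, is positive just to the right of 0, and the mean
    value theorem makes [g] exceed [g 0]. *)
Lemma second_derivative_max (g g1 : R -> R) (g2 d : R) : 0 < d ->
  (forall t : R, `|t| < d -> is_derive t 1 g (g1 t)) -> is_derive (0 : R) (1 : R) g1 g2 ->
  (forall t : R, `|t| < d -> g t <= g 0) -> g2 <= 0.
Proof.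
move=> d0 dg dg1 gmax; rewrite leNgt; apply/negP => g20.
have g10 : g1 0 = 0.
  have h0 : (0 : R) \in `]- d, d[ by rewrite in_itv /= d0 oppr_lt0 d0.
  have in_itvE (t : R) : t \in `]- d, d[ -> `|t| < d by rewrite in_itv /= ltr_norml.
  have dd : - d <= d by lra.
  have := @derive1_at_max R g (- d) d 0 dd (fun t ht => @ex_derive _ _ _ _ _ _ _ (dg t (in_itvE t ht))) h0
    (fun t ht => gmax t (in_itvE t ht)).
  move=> [_ g0]; have n0 : `|0 : R| < d by rewrite normr0.
  by have [_ g10] := dg 0 n0; rewrite -g10 g0.
have e0 : 0 < g2 / 2 by lra.
have [d' d'0 Hd'] := is_deriveP_eps dg1 e0.
pose h := Num.min d d' / 2.
have h0 : 0 < h by rewrite divr_gt0// lt_min d0.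
have hd : h < d by rewrite /h ltr_pdivrMr// gt_min; apply/orP; left; lra.
have hd' : h < d' by rewrite /h ltr_pdivrMr// gt_min; apply/orP; right; lra.
have pos (s : R) : 0 < s -> s <= h -> 0 < g1 s.
  move=> s0 sh; have := Hd' s; rewrite gtr0_norm// => /(_ (le_lt_trans sh hd')).
  rewrite add0r g10 subr0 ler_norml => /andP[+ _].
  have : 0 < g2 * s by rewrite mulr_gt0.
  lra.
have dgs (s : R) : 0 <= s <= h -> is_derive s 1 g (g1 s).
  move=> /andP[s0 sh]; apply: dg; rewrite ger0_norm//; exact: le_lt_trans hd.
have dF (s : R) : s \in `]0, h[ -> is_derive s 1 g (g1 s).
  by rewrite in_itv /= => /andP[s0 sh]; apply: dgs; rewrite !ltW.
have cF : {within `[0, h], continuous g}.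
  apply: continuous_in_subspaceT => s; rewrite inE /= in_itv /= => /dgs ds.
  exact: is_derive_continuous ds.
have [s] := MVT h0 dF cF.
rewrite in_itv /= subr0 => /andP[s0 sh] E.
have := gmax h; rewrite (gtr0_norm h0) => /(_ hd).
have : 0 < g1 s * h by rewrite mulr_gt0// pos// ltW.
by rewrite -E; lra.
Qed.

End multivariate_calculus.

(** * Barrier comparison and the Hölder estimate *)

Lemma scaleRE (R : realType) (a b : R) : a *: b = a * b.
Proof. by []. Qed.

Section delta_convex_functions.
Variables (R : realType) (n : nat) (delta : R) (Om : set 'rV[R]_n).
Hypotheses (n0 : (0 < n)%N) (delta0 : 0 <= delta) (oOm : open Om).
Implicit Types (W : 'rV[R]_n -> R) (x y z v : 'rV[R]_n).

Lemma delta_convex_C2_near W x : delta_convex delta Om W -> Om x -> \forall y \near x, C2_at W y.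
Proof. by move=> [hC2 _]; exact: C2_on_at. Qed.

Lemma delta_convex_form W x : delta_convex delta Om W -> Om x ->
  let H := hessian W x in
  [/\ H^T = H, 0 <= \tr H & forall v, - delta * \tr H * sqn v <= bform H v v].
Proof.
move=> HW Ox H.
have Hs : H^T = H.
  apply/matrixP => i j; rewrite !mxE; apply: clairaut.
  exact: delta_convex_C2_near.
by have [t0 hf] := closure_Gamma_form n0 delta0 Hs (HW.2 x Ox).
Qed.

Lemma sqn_line z v (t : R) :
  sqn (z + t *: v) = sqn z + t * (2 * \sum_i z 0 i * v 0 i) + t ^+ 2 * sqn v.
Proof.
rewrite /sqn mulr_sumr mulr_sumr mulr_sumr -!big_split /=; apply: eq_bigr => i _.
by rewrite !mxE; ring.
Qed.

Lemma sqn_evec i : sqn (evec R i : 'rV[R]_n) = 1.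
Proof.
rewrite /sqn (bigD1 i)//= big1 ?addr0 => [|j ji]; rewrite mxE !eqxx ?expr1n//.
by rewrite (negbTE ji) expr0n.
Qed.

Lemma dot_evec z i : \sum_j z 0 j * (evec R i : 'rV[R]_n) 0 j = z 0 i.
Proof.
rewrite (bigD1 i)//= big1 ?addr0 => [|j ji]; rewrite mxE !eqxx ?mulr1//.
by rewrite (negbTE ji) mulr0.
Qed.

Lemma bform_evec (A : 'M[R]_n) i : bform A (evec R i) (evec R i) = A i i.
Proof.
rewrite bformE (bigD1 i)//= [X in _ + X]big1 ?addr0 => [|k ki].
  rewrite (bigD1 i)//= big1 ?addr0 => [|j ji]; rewrite !mxE !eqxx ?mulr1 ?mul1r//.
  by rewrite (negbTE ji) mul0r.
by rewrite big1// => j _; rewrite !mxE (negbTE ki) andbF !mul0r.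
Qed.

Lemma near_line x v (d : R) : 0 < d ->
  exists2 r : R, 0 < r & forall t : R, `|t| < r -> `|x + t *: v - x| < d.
Proof.
move=> d0; have v0 : 0 < `|v| + 1 by rewrite ltr_wpDl.
exists (d / (`|v| + 1)) => [|t]; first by rewrite divr_gt0.
rewrite ltr_pdivlMr// => h; rewrite addrAC subrr add0r normrZ.
by apply: le_lt_trans h; rewrite ler_wpM2l// lerDl.
Qed.

(* Second order condition at [t = 0] for [W] minus the barrier along the line [y + t v];
   [z] stands for [y - x0] and [a] for half of the exponent of the barrier. *)
Lemma barrier_form_le W y z (C a d : R) v : 0 < d -> 0 < sqn z ->
  (\forall x \near y, C2_at W x) ->
  (forall x, `|x - y| < d ->
     W x - C * sqn (z + (x - y)) `^ a <= W y - C * sqn z `^ a) ->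
  bform (hessian W y) v v <=
    C * (a * sqn z `^ (a - 1) *
      ((a - 1) * (2 * \sum_i z 0 i * v 0 i) ^+ 2 / sqn z + 2 * sqn v)).
Proof.
move=> d0 z0 HW Hmax.
pose b := 2 * \sum_i z 0 i * v 0 i.
pose Q (t : R) := sqn z + t * b + t ^+ 2 * sqn v.
pose Q1 (t : R) := b + 2 * t * sqn v.
have dQ (t : R) : is_derive t 1 Q (Q1 t).
  rewrite /Q /Q1; apply: is_derive_eq.
  by rewrite !scaleRE; ring.
have dQ1 (t : R) : is_derive t 1 Q1 (2 * sqn v).
  rewrite /Q1; apply: is_derive_eq.
  by rewrite !scaleRE; ring.
have Q0 : Q 0 = sqn z by rewrite /Q mul0r expr0n /= mul0r !addr0.
(* The powers of [Q] are differentiated where [Q] is positive, which holds for small [t] because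
   [sqn z > 0]. *)
have [r0 r00 Hr0] : exists2 r : R, 0 < r & forall t, `|t| < r -> 0 < Q t.
  have := is_derive_continuous (dQ 0) => /cvgrPdist_lt /(_ _ z0) /nbhs_ballP [r /= r0 Hr].
  exists r => // t tr; have := Hr t; rewrite -ball_normE /= sub0r normrN => /(_ tr).
  rewrite Q0 ltr_norml => /andP[_]; lra.
have [r1 r10 Hr1] : exists2 r : R, 0 < r & forall x, `|x - y| < r -> \forall x' \near x, C2_at W x'.
  by apply: near_ball; exact: nbhs_interior HW.
have dr : 0 < Num.min d r1 by rewrite lt_min d0.
have [r2 r20 Hr2] := near_line y v dr.
pose r := Num.min r0 r2.
pose g (t : R) := W (y + t *: v) - C * Q t `^ a.
pose g1 (t : R) := \sum_i v 0 i * pderiv i W (y + t *: v) - C * (a * Q t `^ (a - 1) * Q1 t).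
pose g2 := bform (hessian W y) v v - C * (a * ((a - 1) * Q 0 `^ (a - 1 - 1) * Q1 0 * Q1 0 + Q 0 `^ (a - 1) * (2 * sqn v))).
have rP (t : R) : `|t| < r -> [/\ 0 < Q t, `|y + t *: v - y| < d & \forall x \near (y + t *: v), C2_at W x].
  rewrite lt_min => /andP[/Hr0 t0 /Hr2]; rewrite lt_min => /andP[td t1].
  by split=> //; exact: Hr1.
have dpow (e t : R) : 0 < Q t -> is_derive t 1 (fun t => Q t `^ e) (e * Q t `^ (e - 1) * Q1 t).
  move=> Qt; have h1 := is_derive1_powR e Qt.
  exact: (is_derive1_comp h1 (dQ t)).
have dg (t : R) : `|t| < r -> is_derive t 1 g (g1 t).
  move=> /rP [Qt _ C2t]; apply: is_deriveB; last first.
    have h1 := dpow a t Qt; exact: is_deriveZ.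
  apply: is_derive_line; apply: is_derive_C1.
  by apply: filterS C2t => x [].
have dg1 : is_derive (0 : R) (1 : R) g1 g2.
  have r_0 : `|0 : R| < r by rewrite normr0 lt_min r00.
  have [Qt _ C2t] := rP 0 r_0.
  apply: is_deriveB; last first.
    have h1 := dpow (a - 1) 0 Qt.
    have h2 : is_derive (0 : R) 1 (fun t => Q t `^ (a - 1) * Q1 t)
       ((a - 1) * Q 0 `^ (a - 1 - 1) * Q1 0 * Q1 0 + Q 0 `^ (a - 1) * (2 * sqn v)).
      apply: is_derive_eq; rewrite !scaleRE; ring.
    have -> : (fun t => C * (a * Q t `^ (a - 1) * Q1 t)) = (fun t => C * (a * (Q t `^ (a - 1) * Q1 t))).
      by apply/funext => t; rewrite -(mulrA a).
    apply: is_deriveZ; exact: is_deriveZ.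
  rewrite bformE.
  have -> : (fun t : R => \sum_i v 0 i * pderiv i W (y + t *: v)) =
      \sum_i (fun t : R => v 0 i * pderiv i W (y + t *: v)).
    by apply/funext => t; rewrite fct_sumE.
  apply: is_derive_sum => i.
  have -> : \sum_j v 0 i * v 0 j * hessian W y i j = v 0 i * \sum_j v 0 j * pderiv j (pderiv i W) y.
    by rewrite mulr_sumr; apply: eq_bigr => j _; rewrite mxE mulrA.
  apply: is_deriveZ; apply: is_derive_line; rewrite scale0r addr0.
  by apply: is_derive_C1; apply: filterS HW => x [_]; exact.
have gmax (t : R) : `|t| < r -> g t <= g 0.
  move=> /rP [Qt td _]; have := Hmax _ td.
  rewrite /g scale0r addr0 Q0 addrAC subrr add0r sqn_line -/b.
  by rewrite /Q.
have rr : 0 < r by rewrite lt_min r00.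
have := second_derivative_max rr dg dg1 gmax.
rewrite /g2 Q0 subr_le0 => h; apply: le_trans h _.
rewrite le_eqVlt; apply/orP; left; apply/eqP; congr (C * _).
rewrite powRB; last by rewrite (gt_eqF z0) implybT.
rewrite powRr1 ?(ltW z0)// /Q1 mulr0 mul0r addr0 -/b; field.
by rewrite gt_eqF.
Qed.

(** The exponent of the radial power whose Hessian lies on the boundary of the cone: up to a common
    factor, [|x|^a] has radial eigenvalue [a - 1], tangential eigenvalues 1 and trace [a + n - 2],
    and this is the solution of [a - 1 = - delta * (a + n - 2)]. *)
Definition holder_exp : R := (1 + (2 - n%:R) * delta) / (1 + delta).

Lemma barrier_no_max W y z (C a d : R) : delta_convex delta Om W -> Om y ->
  0 < d -> 0 < sqn z -> 0 < C -> 0 < a -> 2 * a < holder_exp ->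
  (forall x, `|x - y| < d ->
     W x - C * sqn (z + (x - y)) `^ a <= W y - C * sqn z `^ a) -> False.
Proof.
move=> HW Oy d0 z0 C0 a0 ag Hmax.
have HC := delta_convex_C2_near HW Oy.
have [_ tr0 Hf] := delta_convex_form HW Oy.
have Hb := barrier_form_le _ d0 z0 HC Hmax.
set H := hessian W y in tr0 Hf Hb.
pose P := C * (a * sqn z `^ (a - 1)).
have P0 : 0 < P by rewrite /P !mulr_gt0// powR_gt0.
have trH : \tr H <= P * (4 * (a - 1) + 2 * n%:R).
  rewrite /mxtrace (eq_bigr (fun i => bform H (evec R i) (evec R i))); last first.
    by move=> i _; rewrite bform_evec.
  apply: le_trans (ler_sum _ (fun i _ => Hb (evec R i))) _.
  rewrite -mulr_sumr -mulr_sumr mulrA -/P ler_pM2l// big_split /=.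
  under eq_bigr => i _ do rewrite dot_evec exprMn.
  rewrite -mulr_suml -mulr_sumr -mulr_sumr -/(sqn z).
  under [X in _ + X]eq_bigr => i _ do rewrite sqn_evec.
  rewrite sumr_const card_ord -mulr_natr mulr1 le_eqVlt; apply/orP; left; apply/eqP.
  by field; rewrite gt_eqF.
have rad : bform H z z <= P * ((4 * a - 2) * sqn z).
  apply: le_trans (Hb z) _; rewrite mulrA -/P ler_pM2l//.
  have -> : \sum_i z 0 i * z 0 i = sqn z by apply: eq_bigr => i _; rewrite expr2.
  by rewrite le_eqVlt; apply/orP; left; apply/eqP; field; rewrite gt_eqF.
(* Delta-convexity is tested in the radial direction [z]. Combined with the trace bound and divided
   by [P], it reads [- delta * (4 * (a - 1) + 2 * n) <= 4 * a - 2], that is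
   [2 * a >= holder_exp]. *)
have := le_trans (Hf z) rad; rewrite mulrA ler_pM2r// => h1.
have h2 : - delta * (P * (4 * (a - 1) + 2 * n%:R)) <= - delta * \tr H by rewrite ler_wnM2l// oppr_le0.
have h3 := le_trans h2 h1.
have : P * (- delta * (4 * (a - 1) + 2 * n%:R)) <= P * (4 * a - 2) by move: h3; rewrite mulrCA.
rewrite ler_pM2l// => h4.
move: ag; rewrite /holder_exp ltr_pdivlMr; last by rewrite ltr_pwDl.
by move: h4; lra.
Qed.

Lemma continuous_sqn x : {for x, continuous (fun y => sqn y)}.
Proof.
apply: continuous_at_sum => i; have cc : {for x, continuous (fun y : 'rV[R]_n => y 0 i)}.
  exact: coord_continuous.
exact: (continuousM cc cc).
Qed.

Lemma norm_sqn y : `|y| ^+ 2 <= sqn y.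
Proof.
have h : `|y| <= Num.sqrt (sqn y).
  apply/ler_rv_normP => [|i]; first exact: sqrtr_ge0.
  rewrite -sqrtr_sqr ler_wsqrtr//.
  by have := le_coord_sqn y i i; rewrite -expr2 ger0_norm// sqr_ge0.
by rewrite -[leRHS]sqr_sqrtr ?sqn_ge0// ler_pXn2r// nnegrE// sqrtr_ge0.
Qed.

Lemma sqn_norm y : sqn y <= n%:R * `|y| ^+ 2.
Proof.
rewrite (_ : n%:R * _ = \sum_(i < n) `|y| ^+ 2); last by rewrite sumr_const card_ord mulr_natl.
apply: ler_sum => i _.
by rewrite -real_normK ?num_real// ler_pXn2r ?nnegrE// le_coord_norm.
Qed.

Lemma continuous_sqnB x y : {for y, continuous (fun y => sqn (y - x))}.
Proof.
have c1 : {for y, continuous (fun y => y - x)}.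
  by apply: continuousB; [exact: id|exact: cst_continuous].
by apply: (@continuous_comp _ _ _ (fun y : 'rV[R]_n => y - x) (fun z => sqn z) y c1); exact: continuous_sqn.
Qed.

Lemma compact_sqn_ball x (s : R) : compact [set y | sqn (y - x) <= s].
Proof.
apply: bounded_closed_compact.
  exists (`|x| + (1 + `|s|)); split; first exact: num_real.
  move=> M /ltW LM y /= ys; apply: le_trans LM.
  have -> : y = x + (y - x) by rewrite addrC subrK.
  apply: le_trans (ler_normD _ _) _; rewrite lerD2l.
  have h : `|y - x| ^+ 2 <= `|s| by apply: le_trans (norm_sqn _) (le_trans ys (ler_norm _)).
  have s0 := normr_ge0 s; have y0 := normr_ge0 (y - x).
  rewrite leNgt; apply/negP => h2.
  have : (1 + `|s|) ^+ 2 < `|y - x| ^+ 2 by rewrite ltr_pXn2r// nnegrE// addr_ge0.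
  rewrite sqrrD expr1n mul1r -mulr_natl.
  have := sqr_ge0 `|s|; move: h s0; lra.
apply: (@preimage_closed _ _ (fun y => sqn (y - x)) [set t | t <= s]); last exact: closed_le.
by move=> y _; exact: continuous_sqnB.
Qed.

(** A maximum point of [F] on the closed ball is the centre, where [F] equals [W x], or lies on the
    sphere, where the size of [C] gives [F <= W x]; [barrier_no_max] excludes every other
    position. *)
Lemma comparison_strict W x (s M C a : R) : delta_convex delta Om W ->
  0 < s -> (forall y, sqn (y - x) <= s -> Om y /\ W y <= M) ->
  0 < C -> 0 < a -> 2 * a < holder_exp -> M <= W x + C * s `^ a ->
  forall y, sqn (y - x) <= s -> W y <= W x + C * sqn (y - x) `^ a.
Proof.
move=> HW s0 HM C0 a0 ag Cs.
pose F y := W y - C * sqn (y - x) `^ a.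
pose K := [set y | sqn (y - x) <= s].
have cF : {within K, continuous F}.
  apply: continuous_in_subspaceT => y; rewrite inE => yK.
  have cW : {for y, continuous W} by have [] := HW.1 y (HM y yK).1.
  have cp : {for y, continuous (fun y => sqn (y - x) `^ a)}.
    by apply: continuous_powR_nneg => //; [move=> z; exact: sqn_ge0|exact: continuous_sqnB].
  have cp' : {for y, continuous (fun y => C * sqn (y - x) `^ a)}.
    by apply: continuousM cp; exact: cst_continuous.
  exact: continuousB cW cp'.
have K0 : K !=set0.
  by exists x; rewrite /K /= subrr /sqn big1 ?ltW// => i _; rewrite mxE expr0n.
have [c cK cmax] := EVT_max_rV K0 (@compact_sqn_ball x s) cF.
rewrite inE in cK.
suff Fc : F c <= W x.
  by move=> y yK; rewrite -lerBlDr; apply: le_trans Fc; apply: cmax; rewrite inE.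
have [Oc cM] := HM c cK.
have := sqn_ge0 (c - x); rewrite le_eqVlt => /orP[/eqP cx|cx].
  have /eqP := sqn_eq0 (esym cx); rewrite subr_eq0 => /eqP e.
  by rewrite /F -cx powR0 ?gt_eqF// mulr0 subr0 e.
move: cK; rewrite /K /= le_eqVlt => /orP[/eqP cs|cs].
  by rewrite /F cs lerBlDr; exact: le_trans Cs.
exfalso.
have [d d0 Hd] : exists2 d : R, 0 < d & forall y, `|y - c| < d -> sqn (y - x) <= s.
  apply: near_ball; have sc : 0 < s - sqn (c - x) by rewrite subr_gt0.
  have /cvgrPdist_lt/(_ _ sc) := @continuous_sqnB x c; apply: filterS => y.
  rewrite ltr_norml => /andP[+ _]; lra.
apply: (barrier_no_max HW Oc d0 cx C0 a0 ag) => y yc.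
have -> : c - x + (y - c) = y - x by rewrite addrC addrA subrK.
by apply: cmax; rewrite inE; exact: Hd.
Qed.

(* The strict comparison only covers exponents below [holder_exp]; the constant [M - W x] is
   perturbed to be positive and both perturbations are then removed. *)
Lemma comparison W x (s M : R) y : delta_convex delta Om W -> 0 < holder_exp ->
  0 < s -> (forall y, sqn (y - x) <= s -> Om y /\ W y <= M) -> sqn (y - x) <= s ->
  W y - W x <= (M - W x) * (sqn (y - x) / s) `^ (holder_exp / 2).
Proof.
move=> HW g0 s0 HM ys.
have xx : sqn (x - x) <= s by rewrite subrr /sqn big1 ?ltW// => i _; rewrite mxE expr0n.
have MW : 0 <= M - W x by rewrite subr_ge0; exact: (HM x xx).2.
have := sqn_ge0 (y - x); rewrite le_eqVlt => /orP[/eqP yx|yx].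
  have /eqP := sqn_eq0 (esym yx); rewrite subr_eq0 => /eqP ->.
  by rewrite subrr mulr_ge0// powR_ge0.
set t := sqn (y - x) / s; have t0 : 0 < t by rewrite divr_gt0.
have t1 : t <= 1 by rewrite ler_pdivrMr// mul1r.
have key (e a : R) : 0 < e -> 0 < a -> 2 * a < holder_exp -> W y - W x <= (M - W x + e) * t `^ a.
  move=> e0 a0 ag; have sa : 0 < s `^ a by exact: powR_gt0.
  have C0 : 0 < (M - W x + e) / s `^ a by rewrite divr_gt0// ltr_wpDl.
  have Cs : M <= W x + (M - W x + e) / s `^ a * s `^ a.
    by rewrite divfK ?gt_eqF//; lra.
  have := comparison_strict HW s0 HM C0 a0 ag Cs ys.
  rewrite -lerBlDl => h; apply: le_trans h _.
  by rewrite /t powRM ?sqn_ge0 ?invr_ge0 ?(ltW s0)// invr_powR ?(ltW s0)// mulrA mulrAC.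
rewrite leNgt; apply/negP => hlt.
set b := holder_exp / 2 in hlt *.
have b0 : 0 < b by rewrite divr_gt0.
(* [k] is the assumed excess. Raising [M - W x] by [e] and lowering the exponent from [b] to [a]
   cost at most a quarter of [k] each, a contradiction. *)
pose k := W y - W x - (M - W x) * t `^ b.
have k0 : 0 < k by rewrite subr_gt0.
pose e := k / 4; have e0 : 0 < e by rewrite divr_gt0.
pose e2 := k / 4 / (M - W x + e).
have Me : 0 < M - W x + e by rewrite ltr_wpDl.
have e20 : 0 < e2 by rewrite !divr_gt0.
have cb : {for b, continuous (fun a : R => t `^ a)}.
  have -> : (fun a : R => t `^ a) = expR \o (fun a => a * ln t).
    by apply/funext => a; rewrite /powR (gt_eqF t0).
  apply: continuous_comp; last exact: continuous_expR.
  by apply: continuousM; [exact: id|exact: cst_continuous].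
have /cvgrPdist_le/(_ _ e20) /nbhs_ballP [d /= d0 Hd] := cb.
pose a := b - Num.min d b / 2.
have mdb : 0 < Num.min d b by rewrite lt_min d0.
have ma : Num.min d b <= d /\ Num.min d b <= b by rewrite !ge_min !lexx orbT.
have a0 : 0 < a by rewrite /a; move: ma => [_]; lra.
have ag : 2 * a < holder_exp.
  have -> : holder_exp = 2 * b by rewrite /b; field.
  by rewrite ltr_pM2l// /a gtrBl; lra.
have := Hd a; rewrite -ball_normE /= distrC (_ : a - b = - (Num.min d b / 2)); last by rewrite /a; ring.
rewrite normrN gtr0_norm; last by lra.
move=> /(_ _) h; have {h} := h _; rewrite ler_norml => h.
have hd : Num.min d b / 2 < d by move: ma => [+ _]; lra.
have /andP[h1 _] := h hd.
have h2 : t `^ a <= t `^ b + e2 by lra.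
have h3 := key e a e0 a0 ag.
have h4 : (M - W x + e) * t `^ a <= (M - W x + e) * (t `^ b + e2) by rewrite ler_pM2l.
have h5 : (M - W x + e) * e2 = k / 4 by rewrite /e2 mulrC divfK ?gt_eqF.
have tb1 : t `^ b <= 1.
  have := @ge0_ler_powR R b (ltW b0) t 1; rewrite powR1 !nnegrE ler01 (ltW t0).
  by apply.
have h6 : e * t `^ b <= k / 4 by rewrite -[leRHS]mulr1 ler_pM2l.
have kE : k = W y - W x - (M - W x) * t `^ b by [].
move: (le_trans h3 h4); rewrite mulrDr h5 (mulrDl (M - W x)).
by move: kE k0 h6; lra.
Qed.

Definition abs_int W : \bar R := int_over Om (fun x => (`|W x|)%:E).

Lemma abs_int_lower W c (r m : R) : 0 <= r -> 0 <= m ->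
  (forall y, `|y - c| <= r -> Om y /\ m <= `|W y|) ->
  ((m * (2 * r) ^+ n)%:E <= abs_int W)%E.
Proof.
move=> r0 m0 H; apply: (leb_int_lower (y := c)) => // y.
  by case: ifP => // _; rewrite lee_fin.
by move=> /H [Oy my]; rewrite asboolT// lee_fin.
Qed.

(** The power [n] in the weight matches volume: a function of size [A] on a ball of radius
    proportional to [d] has integral comparable with [d ^+ n * A], the maximum of the weighted
    function. *)
Lemma sup_bound (r : R) : 0 < r -> 0 < holder_exp ->
  exists2 C : R, 0 < C & forall W x0 (I : R), delta_convex delta Om W ->
    (forall y, `|y - x0| <= 2 * r -> Om y) -> (abs_int W <= I%:E)%E -> `|W x0| <= C * I.
Proof.
move=> r0 g0.
(* [N] is the loss when the distance to the boundary is halved: [|W| <= N * A] within [d / 2] of the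
   maximum point. *)
pose N : R := 2 ^+ n.
have N1 : 1 <= N by rewrite exprn_ege1// ler1n.
have Np : 0 < N by exact: lt_le_trans N1.
(* Differences of [W] there are at most [2 * N * A], so a factor [eps] in the comparison leaves an
   oscillation of [A / 2]; [tau] is the ratio of squared radii producing this factor. *)
pose eps : R := (4 * N)^-1.
have eps0 : 0 < eps by rewrite invr_gt0 mulr_gt0.
have eps1 : eps <= 1 by rewrite invf_le1 ?mulr_gt0//; lra.
have h0 : 0 < holder_exp / 2 by rewrite divr_gt0.
pose tau := eps `^ (holder_exp / 2)^-1.
have tau0 : 0 < tau by exact: powR_gt0.
have tauE : tau `^ (holder_exp / 2) = eps.
  by rewrite /tau -powRrM mulVf ?gt_eqF// powRr1// ltW.
have tau1 : tau <= 1.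
  have := @ge0_ler_powR R (holder_exp / 2)^-1 _ eps 1; rewrite powR1 !nnegrE ler01 (ltW eps0).
  by apply => //; rewrite invr_ge0 ltW.
have nR : 1 <= n%:R :> R by rewrite ler1n.
have nR0 : 0 < n%:R :> R by rewrite ltr0n.
(* The cube of radius [rho * d] fits into the Euclidean ball of squared radius [tau * (d / 4) ^+ 2],
   because [n * rho ^+ 2 <= tau / 16]. *)
pose rho := tau / (4 * n%:R).
have rho0 : 0 < rho by rewrite divr_gt0// mulr_gt0.
have rho4 : rho <= 1 / 4.
  by rewrite /rho ler_pdivrMr ?mulr_gt0//; lra.
have nrho : n%:R * rho ^+ 2 <= tau / 16.
  have -> : n%:R * rho ^+ 2 = tau / 16 * (tau / n%:R) by rewrite /rho; field; rewrite gt_eqF.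
  apply: ler_piMr; first by rewrite divr_ge0// ltW.
  by rewrite ler_pdivrMr// mul1r; exact: le_trans nR.
exists (2 / ((2 * rho) ^+ n * (2 * r) ^+ n)).
  by rewrite divr_gt0// mulr_gt0// exprn_gt0// mulr_gt0.
move=> W x0 I HW HO HI.
have I0 : 0 <= I.
  rewrite -lee_fin; apply: le_trans HI; apply: leb_int_ge0 => y.
  by case: ifP => // _; rewrite lee_fin.
pose F y := (2 * r - `|y - x0|) ^+ n * `|W y|.
pose K := [set y | `|y - x0| <= 2 * r].
have cN y : {for y, continuous (fun y => `|y - x0|)}.
  apply: (@continuous_comp _ _ _ (fun y : 'rV[R]_n => y - x0) (fun z => `|z|)).
    by apply: continuousB; [exact: id|exact: cst_continuous].
  exact: norm_continuous.
have Kc : compact K.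
  apply: bounded_closed_compact.
    exists (`|x0| + 2 * r); split; first exact: num_real.
    move=> M /ltW LM y /= ys; apply: le_trans LM.
    have -> : y = x0 + (y - x0) by rewrite addrC subrK.
    by apply: le_trans (ler_normD _ _) _; rewrite lerD2l.
  apply: (@preimage_closed _ _ (fun y => `|y - x0|) [set t | t <= 2 * r]); last exact: closed_le.
  by move=> y _; exact: cN.
have cF : {within K, continuous F}.
  apply: continuous_in_subspaceT => y; rewrite inE => yK.
  have cW : {for y, continuous W} by have [] := HW.1 y (HO y yK).
  have cW' : {for y, continuous (fun y => `|W y|)}.
    by apply: continuous_comp cW _; exact: norm_continuous.
  have c1 : {for y, continuous (fun y => 2 * r - `|y - x0|)}.
    by apply: continuousB (cN y); exact: cst_continuous.
  have c2 : {for y, continuous (fun y => (2 * r - `|y - x0|) ^+ n)}.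
    by apply: (@continuous_comp _ _ _ (fun y => 2 * r - `|y - x0|) (fun t => t ^+ n) y c1); exact: exprn_continuous.
  exact: (continuousM c2 cW').
have K0 : K !=set0 by exists x0; rewrite /K /= subrr normr0 mulr_ge0// ltW.
have [c cK cmax] := EVT_max_rV K0 Kc cF.
rewrite inE in cK; have {}cmax y : `|y - x0| <= 2 * r -> F y <= F c.
  by move=> yK; apply: cmax; rewrite inE.
have F0 : (2 * r) ^+ n * `|W x0| <= F c.
  have := cmax x0; rewrite /F subrr normr0 subr0; apply.
  by rewrite mulr_ge0// ltW.
suff HFc : F c <= 2 / (2 * rho) ^+ n * I.
  have := le_trans F0 HFc; rewrite -ler_pdivlMl; last by rewrite exprn_gt0// mulr_gt0.
  move=> h; apply: le_trans h _; rewrite le_eqVlt; apply/orP; left; apply/eqP.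
  by rewrite invfM; set X := (_ ^- n); set Y := (_ ^- n); ring.
pose d := 2 * r - `|c - x0|.
have d0' : 0 <= d by rewrite subr_ge0.
pose A := `|W c|.
have FE : F c = d ^+ n * A by [].
have RHS0 : 0 <= 2 / (2 * rho) ^+ n * I.
  by rewrite mulr_ge0// divr_ge0// exprn_ge0// mulr_ge0// ltW.
have := normr_ge0 (W c); rewrite -/A le_eqVlt => /orP[/eqP A0|A0].
  by rewrite FE -A0 mulr0.
move: d0'; rewrite le_eqVlt => /orP[/eqP d0|d0].
  by rewrite FE -d0 expr0n (gtn_eqF n0) mul0r.
have near z : `|z - c| <= d / 2 -> Om z /\ `|W z| <= N * A.
  move=> zc.
  have zx : `|z - x0| <= 2 * r - d / 2.
    have -> : z - x0 = (z - c) + (c - x0) by rewrite addrA subrK.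
    apply: le_trans (ler_normD _ _) _; rewrite /d in zc *; lra.
  have zK : `|z - x0| <= 2 * r by apply: le_trans zx _; lra.
  split; first exact: HO.
  have := cmax z zK; rewrite FE /F => h.
  have dz : d / 2 <= 2 * r - `|z - x0| by lra.
  have dn : 0 < (d / 2) ^+ n by rewrite exprn_gt0// divr_gt0.
  rewrite -(ler_pM2l dn); apply: (@le_trans _ _ (d ^+ n * A)).
    apply: le_trans h; apply: ler_wpM2r => //.
    by rewrite lerXn2r ?nnegrE// ?(le_trans _ dz)// divr_ge0// ltW.
  by rewrite /N mulrA -exprMn divfK.
pose s := (d / 4) ^+ 2.
have s0 : 0 < s by rewrite exprn_gt0// divr_gt0.
have ball4 z x : sqn (z - x) <= s -> `|z - x| <= d / 4.
  move=> h; have := le_trans (norm_sqn _) h.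
  by rewrite ler_pXn2r// nnegrE// divr_ge0// ltW.
have theta x y : sqn (y - x) <= tau * s -> (sqn (y - x) / s) `^ (holder_exp / 2) <= eps.
  move=> h; rewrite -tauE; apply: ge0_ler_powR; rewrite ?nnegrE ?(ltW h0) ?(ltW tau0)//.
    by rewrite divr_ge0 ?sqn_ge0// ltW.
  by rewrite ler_pdivrMr.
have NA : A <= N * A by rewrite ler_peMl// ltW.
have NAe : (2 * N * A) * eps = A / 2 by rewrite /eps; field; rewrite gt_eqF.
have low x : sqn (x - c) <= tau * s -> A / 2 <= `|W x|.
  move=> xc.
  have xcs : sqn (x - c) <= s by apply: le_trans xc _; rewrite ler_piMl// ltW.
  have xd : `|x - c| <= d / 4 by exact: ball4.
  have sqC : sqn (c - x) = sqn (x - c).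
    by rewrite /sqn; apply: eq_bigr => i _; rewrite !mxE; ring.
  have Wx : `|W x| <= N * A by apply: (near x _).2; lra.
  (* The comparison only bounds the increase of [W] away from the centre. For [W c >= 0] it is
     centred at [x] and read at [c]; for [W c < 0] it is centred at [c] and read at [x]. *)
  have [Wc|Wc] := leP 0 (W c).
    have HM z : sqn (z - x) <= s -> Om z /\ W z <= N * A.
      move=> /ball4 zx; have [|Oz Wz] := near z.
        have -> : z - c = (z - x) + (x - c) by rewrite addrA subrK.
        by apply: le_trans (ler_normD _ _) _; lra.
      by split=> //; exact: le_trans (ler_norm _) Wz.
    have cxs : sqn (c - x) <= s by rewrite sqC.
    have := comparison HW g0 s0 HM cxs.
    have AE : A = W c by rewrite /A ger0_norm.
    move=> h; have : W c - W x <= (2 * N * A) * eps.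
      apply: le_trans h _; apply: ler_pM.
      - by move: Wx; rewrite ler_norml => /andP[_]; lra.
      - exact: powR_ge0.
      - by move: Wx; rewrite ler_norml => /andP[+ _]; lra.
      - by apply: theta; rewrite sqC.
    by have := ler_norm (W x); rewrite NAe -AE; lra.
  have HM z : sqn (z - c) <= s -> Om z /\ W z <= N * A.
    move=> /ball4 zx; have [|Oz Wz] := near z; first by lra.
    by split=> //; exact: le_trans (ler_norm _) Wz.
  have := comparison HW g0 s0 HM xcs.
  have AE : A = - W c by rewrite /A ltr0_norm.
  move=> h; have : W x - W c <= (2 * N * A) * eps.
    apply: le_trans h _; apply: ler_pM; [by lra|exact: powR_ge0|by lra|exact: theta].
  by have := ler_norm (- W x); rewrite normrN NAe; lra.
have rd0 : 0 <= rho * d by rewrite ltW// mulr_gt0.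
have A20 : 0 <= A / 2 by rewrite ltW// divr_gt0.
have h : ((A / 2 * (2 * (rho * d)) ^+ n)%:E <= abs_int W)%E.
  apply: (abs_int_lower rd0 A20 (c := c)) => y yc.
  have yd : `|y - c| <= d / 2.
    by apply: le_trans yc _; rewrite [leRHS]mulrC ler_pM2r//; lra.
  split; first exact: (near y yd).1.
  apply: low; apply: le_trans (sqn_norm _) _.
  apply: (@le_trans _ _ (n%:R * (rho * d) ^+ 2)).
    by rewrite ler_pM2l// ler_pXn2r// nnegrE// mulr_ge0// ltW.
  rewrite exprMn mulrA (_ : tau * s = tau / 16 * d ^+ 2); last by rewrite /s; field.
  by rewrite ler_pM2r// exprn_gt0.
have := le_trans h HI; rewrite lee_fin => h2.
rewrite FE mulrAC ler_pdivlMr; last by rewrite exprn_gt0// mulr_gt0.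
move: h2; rewrite (_ : 2 * (rho * d) = 2 * rho * d); last by ring.
by rewrite exprMn; set X := (2 * rho) ^+ n; set Y := d ^+ n; lra.
Qed.

End delta_convex_functions.

(** The margin [4 * r] leaves room for balls of radius [2 * r] about points within [r] of [K]. *)
Lemma compact_subset_open_margin (R : realType) n (K Om : set 'rV[R]_n) :
  compact K -> open Om -> K `<=` Om ->
  exists2 r : R, 0 < r & forall x y, K x -> `|y - x| <= 4 * r -> Om y.
Proof.
move=> /compact_near_coveringP cK oO KO.
have := cK R 0^'+ (fun r x => forall y, `|y - x| <= 4 * r -> Om y) _.
case.
- move=> x /KO Ox.
  have [d d0 Hd] : exists2 d : R, 0 < d & forall y, `|y - x| < d -> Om y.
    by apply: near_ball; apply: open_nbhs_nbhs; split.
  have d20 : 0 < d / 2 by rewrite divr_gt0.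
  have d80 : 0 < d / 8 by rewrite divr_gt0.
  exists (ball x (d / 2), [set t | 0 < t < d / 8]) => /=.
    split; first exact: nbhsx_ballx.
    near=> t; apply/andP; split; first by near: t; exact: nbhs_right_gt.
    near: t; exact: nbhs_right_lt.
  move=> [x' t] [/=]; rewrite -ball_normE /= distrC => xx' /andP[t0 td] y yx'.
  apply: Hd; have -> : y - x = (y - x') + (x' - x) by rewrite addrA subrK.
  by apply: le_lt_trans (ler_normD _ _) _; lra.
- move=> d /= d0 Hd; have d20 : 0 < d / 2 by rewrite divr_gt0.
  exists (d / 2) => // x y Kx; apply: (Hd (d / 2)) => //=.
  by rewrite sub0r normrN gtr0_norm//; lra.
Unshelve. all: by end_near. Qed.

Lemma enorm_powR (R : realType) n (v : 'rV[R]_n) (g : R) : enorm v `^ g = sqn v `^ (g / 2).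
Proof.
by rewrite /enorm -/(sqn v) -powR12_sqrt ?sqn_ge0// -powRrM mulrC.
Qed.

Lemma holder_exp_gt0 (R : realType) n (delta : R) : (3 <= n)%N -> 0 <= delta ->
  delta < (n%:R - 2)^-1 -> 0 < holder_exp n delta.
Proof.
move=> n3 d0 dn; apply: divr_gt0; last by rewrite ltr_pwDl.
have nR : 3 <= n%:R :> R by rewrite (ler_nat R 3 n).
have n2 : 0 < n%:R - 2 :> R by lra.
move: dn; rewrite -[ltRHS]div1r ltr_pdivlMr//; lra.
Qed.

Section holder_estimate.
Variables (R : realType) (n : nat) (delta : R) (Om Om' : set 'rV[R]_n).
Hypotheses (n3 : (3 <= n)%N) (delta0 : 0 <= delta) (deltan : delta < (n%:R - 2)^-1).
Hypotheses (oOm : open Om) (cOm : compactly_contained Om' Om).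

Lemma abs_int_ge0 (W : 'rV[R]_n -> R) : (0 <= abs_int Om W)%E.
Proof. by apply: leb_int_ge0 => y; case: ifP => // _; rewrite lee_fin. Qed.

(** The bound covers the [r]-neighbourhood of [Om'], since the comparison balls about points of
    [Om'] and the support of the later cutoff extend that far. *)
Lemma local_sup_bound : exists r C : R, [/\ 0 < r, 0 < C,
  forall x z, Om' x -> `|z - x| <= r -> Om z &
  forall W (I : R), delta_convex delta Om W -> (abs_int Om W <= I%:E)%E ->
  forall x z, Om' x -> `|z - x| <= r -> `|W z| <= C * I].
Proof.
have n0 : (0 < n)%N by exact: leq_trans n3.
have g0 := holder_exp_gt0 n3 delta0 deltan.
have [cK KO] := cOm.
have [r r0 Hr] := compact_subset_open_margin cK oOm KO.
have [C C0 HC] := sup_bound n0 delta0 oOm r0 g0.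
exists r, C; split=> // [x z /subset_closure Kx zx|W I HW HI x z /subset_closure Kx zx].
  by apply: Hr Kx _; apply: le_trans zx _; move: r0; lra.
apply: HC HW _ HI => y yz; apply: Hr Kx _.
have -> : y - x = (y - z) + (z - x) by rewrite addrA subrK.
by apply: le_trans (ler_normD _ _) _; lra.
Qed.

Lemma holder_estimate : exists C1 : R, 0 < C1 /\
  forall W : 'rV[R]_n -> R, delta_convex delta Om W ->
    (holder_norm (holder_exp n delta) Om' W <= C1%:E * abs_int Om W)%E.
Proof.
have n0 : (0 < n)%N by exact: leq_trans n3.
have g0 := holder_exp_gt0 n3 delta0 deltan.
have [r [C [r0 C0 HO HC]]] := local_sup_bound.
set g := holder_exp n delta in g0 *.
have s0 : 0 < r ^+ 2 by rewrite exprn_gt0.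
have g20 : 0 < g / 2 by rewrite divr_gt0.
pose P := (r ^+ 2) `^ (g / 2); have P0 : 0 < P by exact: powR_gt0.
have Q0 : 0 < C * (1 + 2 / P) by rewrite mulr_gt0// addr_gt0// divr_gt0.
exists (C * (1 + 2 / P)); split => //.
move=> W HW; have := abs_int_ge0 W; case EI : (abs_int Om W) => [I||]// I0; last by rewrite gt0_muley ?leey ?lte_fin.
rewrite lee_fin in I0.
have HI : (abs_int Om W <= I%:E)%E by rewrite EI.
have HS := HC W I HW HI.
set S := C * I in HS.
have S0 : 0 <= S by rewrite mulr_ge0// ltW.
have cmp x y : Om' x -> Om' y -> sqn (y - x) <= r ^+ 2 ->
    W y - W x <= 2 * S * (sqn (y - x) / r ^+ 2) `^ (g / 2).
  move=> Ox Oy yx.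
  have HM z : sqn (z - x) <= r ^+ 2 -> Om z /\ W z <= S.
    move=> zx; have zr : `|z - x| <= r.
      by have := le_trans (norm_sqn _) zx; rewrite ler_pXn2r// nnegrE// ltW.
    split; first exact: HO Ox zr.
    by apply: le_trans (HS x z Ox zr); exact: ler_norm.
  have h := comparison n0 delta0 oOm HW g0 s0 HM yx.
  apply: le_trans h _; apply: ler_wpM2r; first exact: powR_ge0.
  have xr : `|x - x| <= r by rewrite subrr normr0 ltW.
  have := HS x x Ox xr.
  by rewrite ler_norml => /andP[h1 _]; lra.
(* Beyond Euclidean distance [r] the ratio exceeds 1, and the supremum bound already gives
   [2 * S]. *)
have hold x y : Om' x -> Om' y -> `|W x - W y| <= 2 * S * (sqn (x - y) / r ^+ 2) `^ (g / 2).
  move=> Ox Oy.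
  have sC : sqn (y - x) = sqn (x - y).
    by rewrite /sqn; apply: eq_bigr => i _; rewrite !mxE; ring.
  have [yx|yx] := leP (sqn (x - y)) (r ^+ 2).
    have h1 := cmp y x Oy Ox yx; rewrite -sC in yx; have h2 := cmp x y Ox Oy yx.
    by rewrite ler_norml h1 andbT lerNl opprB -sC.
  have rr (z : 'rV[R]_n) : `|z - z| <= r by rewrite subrr normr0 ltW.
  have h1 := HS x x Ox (rr x); have h2 := HS y y Oy (rr y).
  apply: le_trans (ler_normB _ _) _; apply: (@le_trans _ _ (2 * S)); first lra.
  apply: ler_peMr; first by rewrite mulr_ge0.
  have h : 1 <= sqn (x - y) / r ^+ 2 by rewrite ler_pdivlMr// mul1r ltW.
  have := @ge0_ler_powR R (g / 2) (ltW g20) 1 (sqn (x - y) / r ^+ 2).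
  by rewrite powR1 !nnegrE ler01 (le_trans ler01 h) => /(_ isT isT h).
rewrite mulrDr mulr1 EFinD muleDl//.
apply: leeD.
  apply: ge_ereal_sup => _ [x Ox <-]; rewrite -EFinM lee_fin.
  by apply: (HS x x Ox); rewrite subrr normr0 ltW.
apply: ge_ereal_sup => _ [[x y] /= [Ox [Oy xy]] <-]; rewrite -EFinM lee_fin enorm_powR.
have sp : 0 < sqn (x - y).
  rewrite lt_def sqn_ge0 andbT; apply/eqP => /sqn_eq0 /eqP; rewrite subr_eq0 => /eqP.
  exact: xy.
rewrite ler_pdivrMr ?powR_gt0//; apply: le_trans (hold x y Ox Oy) _.
rewrite powRM ?sqn_ge0 ?invr_ge0 ?(ltW s0)// invr_powR ?(ltW s0)// -/P /S.
rewrite le_eqVlt; apply/orP; left; apply/eqP; ring.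
Qed.

End holder_estimate.

(** * Energy estimates for the gradient *)

Section continuous_at.
Variables (R : realType) (T : topologicalType).
Implicit Types (f g : T -> R) (x : T).

Lemma continuous_atM f g x : {for x, continuous f} -> {for x, continuous g} ->
  {for x, continuous (fun y => f y * g y)}.
Proof. by move=> cf cg; exact: (continuousM cf cg). Qed.

Lemma continuous_atD f g x : {for x, continuous f} -> {for x, continuous g} ->
  {for x, continuous (fun y => f y + g y)}.
Proof. by move=> cf cg; exact: (continuousD cf cg). Qed.

Lemma continuous_atC (k : R) x : {for x, continuous (fun _ : T => k)}.
Proof. exact: cst_continuous. Qed.

Lemma continuous_at_powR f x (e : R) : {for x, continuous f} -> 0 < f x ->
  {for x, continuous (fun y => f y `^ e)}.
Proof.
move=> cf fx; apply: (@continuous_comp _ _ _ f (fun t => t `^ e) x cf).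
exact: is_derive_continuous (is_derive1_powR e fx).
Qed.

End continuous_at.

Lemma is_derive_comp_rv (R : realType) n (f : 'rV[R]_n -> R) (phi : R -> R) (x v : 'rV[R]_n) (d e : R) :
  is_derive x v f d -> is_derive (f x) 1 phi e -> is_derive x v (fun y => phi (f y)) (e * d).
Proof.
move=> df dphi; apply: line_is_derive.
have df' : is_derive (0 : R) (1 : R) (fun t : R => f (x + t *: v)) d.
  by apply: is_derive_line; rewrite scale0r addr0.
have dphi' : is_derive (f (x + (0 : R) *: v)) 1 phi e by rewrite scale0r addr0.
exact: (is_derive1_comp dphi' df').
Qed.

Lemma is_derive_mul (R : realType) n (f g : 'rV[R]_n -> R) (x v : 'rV[R]_n) (df dg : R) :
  is_derive x v f df -> is_derive x v g dg ->
  is_derive x v (fun y => f y * g y) (df * g x + f x * dg).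
Proof.
move=> hf hg; have h := is_deriveM hf hg.
rewrite (_ : df * g x + f x * dg = f x *: dg + g x *: df); first exact: h.
by rewrite !scaleRE addrC [df * _]mulrC.
Qed.

Lemma is_derive_add (R : realType) n (f g : 'rV[R]_n -> R) (x v : 'rV[R]_n) (df dg : R) :
  is_derive x v f df -> is_derive x v g dg -> is_derive x v (fun y => f y + g y) (df + dg).
Proof. by move=> hf hg; exact: is_deriveD. Qed.

Lemma is_derive_sumf (R : realType) n m (f : 'I_m -> 'rV[R]_n -> R) (x v : 'rV[R]_n) (df : 'I_m -> R) :
  (forall i, is_derive x v (f i) (df i)) ->
  is_derive x v (fun y => \sum_i f i y) (\sum_i df i).
Proof.
move=> H; have -> : (fun y => \sum_i f i y) = \sum_i f i.
  by apply/funext => y; rewrite fct_sumE.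
exact: is_derive_sum.
Qed.

Lemma near_near (R : realType) n (x : 'rV[R]_n) (P : 'rV[R]_n -> Prop) :
  (\forall y \near x, P y) -> \forall y \near x, \forall z \near y, P z.
Proof. exact: nbhs_interior. Qed.

Lemma is_derive_near_cst (R : realType) n (f : 'rV[R]_n -> R) (x v : 'rV[R]_n) (c : R) :
  (\forall y \near x, f y = c) -> is_derive x v f 0.
Proof.
move=> H; apply: (@near_eq_is_derive _ _ _ (fun=> c) f).
by apply: filterS H => y ->.
Qed.

Arguments continuous_atC {R T} k {x}.

(** * Products of a cutoff with functions regular on [Om] *)

Section cutoff.
Variables (R : realType) (n : nat) (L : R) (Om : set 'rV[R]_n) (eta : 'rV[R]_n -> R).
Hypotheses (L0 : 0 < L) (c1eta : cbox1 L eta).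
Hypothesis eta_supp : forall x, Om x \/ \forall y \near x, eta y = 0.
Implicit Types (z G : 'rV[R]_n -> R) (x : 'rV[R]_n).

(** Off [Om] the function [W] is arbitrary. The alternative in the last clause makes [z] vanish near
    every point outside [Om], so that [z * G] is continuous everywhere once [G] is continuous on
    [Om]. *)
Definition cutoff z := [/\ continuous z, (forall x, L <= `|x| -> z x = 0) &
  forall x, Om x \/ \forall y \near x, z y = 0].

Lemma cutoff_eta : cutoff eta.
Proof. by have [[c e] _] := c1eta; split. Qed.

Lemma cutoff_deta i : cutoff (pderiv i eta).
Proof.
have [_ /(_ i) [_ [c e]]] := c1eta; split=> // x.
have [Ox|hx] := eta_supp x; [by left|right].
apply: filterS (near_near hx) => y hy.
by have [_ e0] := is_derive_near_cst (evec R i) hy; exact: e0.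
Qed.

Lemma cutoff_mul z z' : cutoff z -> continuous z' -> cutoff (fun x => z x * z' x).
Proof.
move=> [cz ez sz] cz'; split=> [x|x xL|x]; first exact: (continuousM (cz x) (cz' x)).
  by rewrite ez// mul0r.
by have [Ox|hx] := sz x; [left|right; apply: filterS hx => y ->; rewrite mul0r].
Qed.

Lemma continuous_expn z m : continuous z -> continuous (fun x => z x ^+ m).
Proof.
move=> cz x; apply: (@continuous_comp _ _ _ z (fun t => t ^+ m) x (cz x)).
exact: exprn_continuous.
Qed.

Lemma cutoff_expn z m : (0 < m)%N -> cutoff z -> cutoff (fun x => z x ^+ m).
Proof.
case: m => // m _ cz; under eq_fun do rewrite exprS.
by apply: cutoff_mul => //; apply: continuous_expn; case: cz.
Qed.

Lemma near_eq_continuous z G x : (\forall y \near x, z y = G y) -> z x = G x ->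
  {for x, continuous G} -> {for x, continuous z}.
Proof.
move=> H Hx cG; apply: continuous_norm_le => e e0; apply: near_ball.
have /cvgrPdist_le/(_ e e0) := cG; apply: filterS2 H => y -> h.
by rewrite Hx distrC.
Qed.

Lemma cbox_cutoff z G : cutoff z -> (forall x, Om x -> {for x, continuous G}) ->
  cbox L (fun x => z x * G x).
Proof.
move=> [cz ez sz] cG; split=> [x|x xL]; last by rewrite ez// mul0r.
have [Ox|hx] := sz x; first exact: (continuousM (cz x) (cG x Ox)).
apply: (@near_eq_continuous _ (fun=> 0)); last exact: cst_continuous.
  by apply: filterS hx => y ->; rewrite mul0r.
by rewrite (nbhs_singleton hx) mul0r.
Qed.

Lemma is_derive_eta x i : is_derive x (evec R i) eta (pderiv i eta x).
Proof. by apply: is_derive_pderiv; have [_ /(_ i) [h _]] := c1eta; exact: h. Qed.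

Lemma is_derive_eta_expn x i m :
  is_derive x (evec R i) (fun y => eta y ^+ m.+1) (m.+1%:R * eta x ^+ m * pderiv i eta x).
Proof.
have dp : is_derive (eta x) 1 (fun t : R => t ^+ m.+1) (m.+1%:R * eta x ^+ m).
  apply: DeriveDef; first exact: exprn_derivable.
  by rewrite exp_derive [_ *: 1]mulr1.
exact: is_derive_comp_rv (@is_derive_eta x i) dp.
Qed.

(** The product rule for [eta ^+ m.+1 * G], with [dG i] in the role of the partial derivative of
    [G]. It remains valid off [Om], where [eta] and its derivatives vanish. *)
Definition dcut m G (dG : 'I_n -> 'rV[R]_n -> R) i x : R :=
  m.+1%:R * eta x ^+ m * pderiv i eta x * G x + eta x ^+ m.+1 * dG i x.

Lemma is_derive_dcut m G (dG : 'I_n -> 'rV[R]_n -> R) i x :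
  (forall y, Om y -> is_derive y (evec R i) G (dG i y)) ->
  is_derive x (evec R i) (fun y => eta y ^+ m.+1 * G y) (dcut m G dG i x).
Proof.
move=> HG; have [Ox|hx] := eta_supp x.
  exact: is_derive_mul (is_derive_eta_expn x i m) (HG x Ox).
rewrite /dcut (nbhs_singleton hx) exprS mul0r mul0r addr0.
have -> : pderiv i eta x = 0 by have [_ e] := is_derive_near_cst (evec R i) hx; exact: e.
rewrite mulr0 mul0r; apply: is_derive_near_cst (0 : R) _.
by apply: filterS hx => y ->; rewrite exprS !mul0r.
Qed.

Lemma cbox_dcut m G (dG : 'I_n -> 'rV[R]_n -> R) i : (forall x, Om x -> {for x, continuous G}) ->
  (forall x, Om x -> {for x, continuous (dG i)}) -> cbox L (dcut m G dG i).
Proof.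
move=> cG cdG; apply: cboxD; apply: cbox_cutoff => //.
  have -> : (fun x => m.+1%:R * eta x ^+ m * pderiv i eta x) =
            (fun x => pderiv i eta x * (m.+1%:R * eta x ^+ m)).
    by apply/funext => x; rewrite mulrC.
  apply: cutoff_mul; first exact: cutoff_deta.
  have ce : continuous (fun x => eta x ^+ m) by apply: continuous_expn; have [[]] := c1eta.
  move=> x; exact: (continuous_atM (continuous_atC (m.+1%:R : R)) (ce x)).
exact: cutoff_expn cutoff_eta.
Qed.

Lemma cbox1_cutoff m G (dG : 'I_n -> 'rV[R]_n -> R) : (forall x, Om x -> {for x, continuous G}) ->
  (forall i x, Om x -> {for x, continuous (dG i)}) ->
  (forall i x, Om x -> is_derive x (evec R i) G (dG i x)) ->
  cbox1 L (fun x => eta x ^+ m.+1 * G x) /\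
  forall i x, pderiv i (fun x => eta x ^+ m.+1 * G x) x = dcut m G dG i x.
Proof.
move=> cG cdG HG.
have E i x : pderiv i (fun x => eta x ^+ m.+1 * G x) x = dcut m G dG i x.
  by have [_ e] := is_derive_dcut m x (HG i).
split=> //; split; first by apply: cbox_cutoff => //; exact: cutoff_expn cutoff_eta.
move=> i; split.
  by move=> x; have [d _] := is_derive_dcut m x (HG i).
have -> : pderiv i (fun x => eta x ^+ m.+1 * G x) = dcut m G dG i.
  by apply/funext => x; exact: E.
by apply: cbox_dcut => //; exact: cdG.
Qed.

Lemma J_div_cutoff m (G : 'I_n -> 'rV[R]_n -> R) (dG : 'I_n -> 'I_n -> 'rV[R]_n -> R) :
  (forall i x, Om x -> {for x, continuous (G i)}) ->
  (forall i j x, Om x -> {for x, continuous (dG i j)}) ->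
  (forall i j x, Om x -> is_derive x (evec R j) (G i) (dG i j x)) ->
  cbox L (fun x => \sum_i dcut m (G i) (dG i) i x) /\
  J L (fun x => \sum_i dcut m (G i) (dG i) i x) = 0.
Proof.
move=> cG cdG HG.
have cb i : cbox L (dcut m (G i) (dG i) i) by apply: cbox_dcut; [exact: cG|exact: cdG].
split; first exact: cbox_sum.
rewrite J_sum//; apply: big1 => i _.
have [c1 E] := cbox1_cutoff m (cG i) (cdG i) (HG i).
rewrite -(J_pderiv L0 i c1); apply: eq_J => x; exact/esym/E.
Qed.

End cutoff.

(** * Energy inequality and iteration of exponents *)

Section energy.
Variables (R : realType) (k : nat) (delta L : R) (Om : set 'rV[R]_k.+2) (eta : 'rV[R]_k.+2 -> R).
Hypotheses (delta0 : 0 <= delta) (oOm : open Om) (L0 : 0 < L) (c1eta : cbox1 L eta).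
Hypothesis eta_supp : forall x, Om x \/ \forall y \near x, eta y = 0.
Hypothesis eta01 : forall x, 0 <= eta x <= 1.
Notation n := k.+2.
Implicit Types (W : 'rV[R]_n -> R) (x : 'rV[R]_n).

Definition gradsq W x : R := \sum_i pderiv i W x ^+ 2.
Definition lap W x : R := \sum_i pderiv i (pderiv i W) x.
(* The additive term [M ^+ 2] keeps [usq] positive, so that its real powers are smooth, and
   makes every estimate homogeneous under scaling of [W] and [M]. *)
Definition usq (M : R) W x : R := M ^+ 2 + gradsq W x.

(** [M] is a free bound and not the supremum, so that it stays positive when [W] vanishes. *)
Definition admissible (M : R) W :=
  [/\ 0 < M, delta_convex delta Om W & forall x, eta x != 0 -> `|W x| <= M].

Lemma gradsq_ge0 W x : 0 <= gradsq W x.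
Proof. by apply: sumr_ge0 => i _; exact: sqr_ge0. Qed.

Lemma usq_gt0 M W x : 0 < M -> 0 < usq M W x.
Proof. by move=> M0; rewrite /usq ltr_pwDl ?gradsq_ge0// exprn_gt0. Qed.

Lemma supp_Om x : eta x != 0 -> Om x.
Proof. by move=> e; have [//|h] := eta_supp x; rewrite (nbhs_singleton h) eqxx in e. Qed.

Lemma lap_ge0 W x : delta_convex delta Om W -> Om x -> 0 <= lap W x.
Proof.
move=> HW Ox; have [_ + _] := delta_convex_form (ltn0Sn _) delta0 oOm HW Ox.
by rewrite /mxtrace /lap; under eq_bigr do rewrite mxE.
Qed.

Lemma hessian_form W x (v : 'rV[R]_n) : delta_convex delta Om W -> Om x ->
  - delta * lap W x * sqn v <= \sum_i \sum_j v 0 i * v 0 j * pderiv j (pderiv i W) x.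
Proof.
move=> HW Ox; have [_ _ /(_ v)] := delta_convex_form (ltn0Sn _) delta0 oOm HW Ox.
rewrite bformE /mxtrace /lap.
under [X in _ * X * _ <= _ -> _]eq_bigr do rewrite mxE.
by under [X in _ <= X -> _]eq_bigr do under eq_bigr do rewrite mxE.
Qed.

(** Coordinate directions bound the diagonal from below, and subtracting these bounds from the trace
    bounds it from above. The directions [evec R i + c *: evec R j] with [c = 1] and [c = -1] then
    bound the off-diagonal entries. *)
Lemma hessian_bound W x i j : delta_convex delta Om W -> Om x ->
  `|pderiv j (pderiv i W) x| <= (1 + n%:R * delta) * lap W x.
Proof.
move=> HW Ox; have l0 := lap_ge0 HW Ox.
have [Hs _ Hf] := delta_convex_form (ltn0Sn _) delta0 oOm HW Ox.
have trE : \tr (hessian W x) = lap W x by apply: eq_bigr => l _; rewrite mxE.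
set H := hessian W x in Hs Hf trE; rewrite trE in Hf.
have -> : pderiv j (pderiv i W) x = H i j by rewrite mxE.
have nR : 2 <= n%:R :> R by rewrite (ler_nat R 2 n).
have dl0 : 0 <= delta * lap W x by rewrite mulr_ge0.
have dlow a : - (delta * lap W x) <= H a a.
  by have := Hf (evec R a); rewrite bform_evec sqn_evec mulr1 mulNr.
have dupp a : H a a <= lap W x + (n%:R - 1) * (delta * lap W x).
  have h : \sum_(b | b != a) - (delta * lap W x) <= \sum_(b | b != a) H b b by apply: ler_sum => b _.
  have : lap W x = H a a + \sum_(b | b != a) H b b by rewrite -trE /mxtrace (bigD1 a).
  move: h; rewrite sumr_const cardC1 card_ord -[_ *+ n.-1]mulr_natl.
  have -> : n.-1%:R = n%:R - 1 :> R by rewrite -[n in RHS]/(n.-1.+1) -natr1 addrK.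
  by move=> h1 h2; lra.
have [->|ij] := eqVneq i j.
  rewrite ler_norml; have h1 := dlow j; have h2 := dupp j.
  have h3 : 0 <= n%:R * (delta * lap W x) by rewrite mulr_ge0.
  have h4 : delta * lap W x <= n%:R * (delta * lap W x) by apply: ler_peMl => //; lra.
  by rewrite mulrDl mul1r -mulrA; apply/andP; split; lra.
have off (c : R) : c ^+ 2 = 1 -> - (delta * lap W x * 2) <= H i i + H j j + 2 * (c * H i j).
  move=> c2; have := Hf (evec R i + c *: evec R j).
  rewrite bformDZl !bformDZr !bform_evec (bform_sym (evec R j) (evec R i) Hs).
  have -> : bform H (evec R i) (evec R j) = H i j.
    rewrite bformE (bigD1 i)//= [X in _ + X]big1 ?addr0 => [|a ai]; last first.
      by apply: big1 => b _; rewrite !mxE (negbTE ai) andbF !mul0r.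
    rewrite (bigD1 j)//= big1 ?addr0 => [|b bj]; rewrite !mxE !eqxx ?mulr1 ?mul1r//.
    by rewrite (negbTE bj) mul0r.
  rewrite sqn_line !sqn_evec dot_evec [evec R i 0 j]mxE eq_sym (negbTE ij) !andbF mulr0 c2.
  move=> h; move: h; rewrite !mulr0 mul1r addr0 => h.
  have : c * (c * H j j) = H j j by rewrite mulrA -expr2 c2 mul1r.
  by move=> h2; move: h; rewrite (mulrDr c) h2; lra.
have m1 : (-1 : R) ^+ 2 = 1 by rewrite sqrrN expr1n.
have o1 := off 1 (expr1n _ _); have o2 := off (-1) m1.
have u1 := dupp i; have u2 := dupp j.
by rewrite ler_norml mulrDl mul1r -mulrA; apply/andP; split; lra.
Qed.

Section regularity.
Variable W : 'rV[R]_n -> R.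
Hypothesis HW : delta_convex delta Om W.

Lemma dc_continuous x : Om x -> {for x, continuous W}.
Proof. by move=> Ox; have [cW _] := HW.1 x Ox. Qed.

Lemma dc_continuous1 i x : Om x -> {for x, continuous (pderiv i W)}.
Proof. by move=> Ox; have [_ [h _]] := HW.1 x Ox; have [_ c] := h i. Qed.

Lemma dc_continuous2 i j x : Om x -> {for x, continuous (pderiv j (pderiv i W))}.
Proof. by move=> Ox; have [_ [_ h]] := HW.1 x Ox; have [_ c] := h i j. Qed.

Lemma dc_derive i x : Om x -> is_derive x (evec R i) W (pderiv i W x).
Proof.
by move=> Ox; have [_ [h _]] := HW.1 x Ox; have [d _] := h i; exact: is_derive_pderiv.
Qed.

Lemma dc_derive2 i j x : Om x ->
  is_derive x (evec R j) (pderiv i W) (pderiv j (pderiv i W) x).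
Proof.
by move=> Ox; have [_ [_ h]] := HW.1 x Ox; have [d _] := h i j; exact: is_derive_pderiv.
Qed.

Arguments dc_continuous1 i {x}.
Arguments dc_continuous2 i j {x}.
Arguments dc_derive i {x}.
Arguments dc_derive2 i j {x}.

Definition dusq j x : R := \sum_i 2 * pderiv i W x * pderiv j (pderiv i W) x.

Lemma usq_continuous M x : Om x -> {for x, continuous (usq M W)}.
Proof.
move=> Ox; apply: (continuous_atD (continuous_atC (M ^+ 2))).
apply: continuous_at_sum => i.
by have c := dc_continuous1 i Ox; exact: (continuous_atM c c).
Qed.

Lemma dusq_continuous j x : Om x -> {for x, continuous (dusq j)}.
Proof.
move=> Ox; apply: continuous_at_sum => i.
exact: (continuous_atM (continuous_atM (continuous_atC 2) (dc_continuous1 i Ox)) (dc_continuous2 i j Ox)).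
Qed.

Arguments dusq_continuous j {x}.

Lemma usq_derive M j x : Om x -> is_derive x (evec R j) (usq M W) (dusq j x).
Proof.
move=> Ox; rewrite -[dusq j x]add0r.
have h0 : is_derive x (evec R j) (fun _ : 'rV[R]_n => M ^+ 2) 0 by exact: is_derive_cst.
apply: (is_derive_add h0); apply: is_derive_sumf => i.
have d := dc_derive2 i j Ox.
have h := is_derive_mul d d.
rewrite (_ : 2 * _ * _ = pderiv j (pderiv i W) x * pderiv i W x + pderiv i W x * pderiv j (pderiv i W) x).
  exact: h.
by ring.
Qed.

Arguments usq_derive M j {x}.

Lemma powu_derive M (e : R) j x : 0 < M -> Om x ->
  is_derive x (evec R j) (fun y => usq M W y `^ e) (e * usq M W x `^ (e - 1) * dusq j x).
Proof.
move=> M0 Ox; have h := is_derive1_powR e (usq_gt0 W x M0).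
exact: (is_derive_comp_rv (usq_derive M j Ox) h).
Qed.

Lemma powu_continuous M (e : R) x : 0 < M -> Om x -> {for x, continuous (fun y => usq M W y `^ e)}.
Proof.
by move=> M0 Ox; apply: continuous_at_powR; [exact: usq_continuous|exact: usq_gt0].
Qed.

Arguments powu_continuous {M} e {x}.

Lemma dpowu_continuous M (e : R) j x : 0 < M -> Om x ->
  {for x, continuous (fun x => e * usq M W x `^ (e - 1) * dusq j x)}.
Proof.
move=> M0 Ox.
exact: (continuous_atM (continuous_atM (continuous_atC e) (powu_continuous (e - 1) M0 Ox)) (dusq_continuous j Ox)).
Qed.

End regularity.

Arguments dc_continuous1 {W} HW i {x}.
Arguments dc_continuous2 {W} HW i j {x}.
Arguments dc_derive {W} HW i {x}.
Arguments dc_derive2 {W} HW i j {x}.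
Arguments powu_continuous {W} HW {M} e {x}.
Arguments dpowu_continuous {W} HW {M} e j {x}.
Arguments powu_derive {W} HW {M} e j {x}.

(* Tests [0 <= Lap W] against [eta^2 (W + M)]. *)
Lemma energy_start : exists2 C : R, 0 < C & forall M W, admissible M W ->
  J L (fun x => eta x ^+ 2 * usq M W x) <= C * M ^+ 2.
Proof.
pose Z x := eta x ^+ 2 + 16 * \sum_i pderiv i eta x ^+ 2.
have ce := cutoff_eta c1eta eta_supp.
have cZ : cbox L Z.
  apply: cboxD.
    have [c e _] := cutoff_expn (m := 2) isT ce; exact: (conj c e).
  apply: cboxZ; apply: cbox_sum => i.
  have [c e _] := cutoff_expn (m := 2) isT (cutoff_deta c1eta eta_supp i); exact: (conj c e).
have Z0 x : 0 <= Z x.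
  by rewrite addr_ge0 ?sqr_ge0// mulr_ge0// sumr_ge0// => i _; exact: sqr_ge0.
exists (J L Z + 1) => [|M W [M0 HW WM]]; first by rewrite ltr_wpDl// J_ge0.
pose G i x := (W x + M) * pderiv i W x.
pose dG i j x := pderiv j W x * pderiv i W x + (W x + M) * pderiv j (pderiv i W) x.
have cWM x : Om x -> {for x, continuous (fun y => W y + M)}.
  by move=> Ox; exact: (continuous_atD (dc_continuous HW Ox) (continuous_atC M)).
have dWM j x : Om x -> is_derive x (evec R j) (fun y => W y + M) (pderiv j W x).
  move=> Ox; rewrite -[pderiv j W x]addr0; exact: is_derive_add (dc_derive HW j Ox) _.
have cG i x : Om x -> {for x, continuous (G i)}.
  by move=> Ox; exact: (continuous_atM (cWM x Ox) (dc_continuous1 HW i Ox)).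
have cdG i j x : Om x -> {for x, continuous (dG i j)}.
  move=> Ox; apply: (continuous_atD (continuous_atM (dc_continuous1 HW j Ox) (dc_continuous1 HW i Ox))).
  exact: (continuous_atM (cWM x Ox) (dc_continuous2 HW i j Ox)).
have hG i j x : Om x -> is_derive x (evec R j) (G i) (dG i j x).
  by move=> Ox; apply: is_derive_mul; [exact: dWM|exact: dc_derive2].
have [cdiv Jdiv] := J_div_cutoff L0 c1eta eta_supp 1 cG cdG hG.
set div := (fun x => _) in cdiv Jdiv.
(* The shift by [M] makes [W + M] nonnegative where [eta] is nonzero, so the term of [div]
   containing [lap W] is nonnegative and can be discarded. *)
have pw x : eta x ^+ 2 * usq M W x <= M ^+ 2 * Z x + 2 * div x.
  have divE : div x = \sum_i (2 * eta x * pderiv i eta x * ((W x + M) * pderiv i W x) +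
      eta x ^+ 2 * (pderiv i W x * pderiv i W x)) + eta x ^+ 2 * ((W x + M) * lap W x).
    rewrite /div /lap !mulr_sumr -big_split /=; apply: eq_bigr => i _.
    by rewrite /dcut /G /dG expr1; ring.
  have [e0|e0] := eqVneq (eta x) 0.
    rewrite divE e0 expr0n /= !mul0r addr0 big1 ?mulr0 ?addr0 => [|i _].
      by rewrite mulr_ge0 ?sqr_ge0.
    by rewrite !mul0r addr0.
  have Ox := supp_Om e0.
  have /ler_normlP [W1 W2] := WM x e0.
  have l0 := lap_ge0 HW Ox.
  have q : 0 <= eta x ^+ 2 * ((W x + M) * lap W x).
    by rewrite mulr_ge0 ?sqr_ge0// mulr_ge0//; lra.
  rewrite divE /usq /gradsq /Z !mulrDr.
  suff : eta x ^+ 2 * (\sum_i pderiv i W x ^+ 2) <=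
     M ^+ 2 * (16 * \sum_i pderiv i eta x ^+ 2) +
     2 * \sum_i (2 * eta x * pderiv i eta x * ((W x + M) * pderiv i W x) +
      eta x ^+ 2 * (pderiv i W x * pderiv i W x)).
    by move=> h; rewrite [M ^+ 2 * _ ^+ 2]mulrC -addrA lerD2l; move: h q; lra.
  rewrite !mulr_sumr -big_split /=; apply: ler_sum => i _.
  set e := eta x; set a := pderiv i eta x; set w := pderiv i W x; set b := W x + M.
  have b2 : 4 * a ^+ 2 * b ^+ 2 <= 4 * a ^+ 2 * (4 * M ^+ 2).
    apply: ler_wpM2l; first by rewrite mulr_ge0// sqr_ge0.
    have -> : 4 * M ^+ 2 = (2 * M) ^+ 2 by ring.
    have b0 : 0 <= b by rewrite /b; lra.
    have M20 : 0 <= 2 * M by lra.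
    by rewrite ler_pXn2r// /b; lra.
  (* Completing the square: since [0 <= b <= 2 * M], the remainder [4 * a ^+ 2 * b ^+ 2] is at most
     [16 * a ^+ 2 * M ^+ 2], whence the constant in [Z]. *)
  have := sqr_ge0 (e * w + 2 * a * b).
  by move: b2; rewrite !expr2; lra.
have c1 : cbox L (fun x => eta x ^+ 2 * usq M W x).
  apply: (cbox_cutoff (Om := Om)); first exact: cutoff_expn.
  by move=> x Ox; exact: usq_continuous.
have c2 : cbox L (fun x => M ^+ 2 * Z x + 2 * div x) by apply: cboxD; exact: cboxZ.
apply: le_trans (le_J L0 c1 c2 pw) _.
rewrite (JD L0); [|exact: cboxZ|exact: cboxZ].
rewrite !(JZ L0)// Jdiv mulr0 addr0 mulrC ler_wpM2r ?sqr_ge0//.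
by rewrite lerDl.
Qed.

(** The power of [eta] is existential because each step of the iteration raises it; the power of [M]
    is dictated by scaling. *)
Definition grad_bound (s : R) := exists m : nat, exists2 C : R, 0 < C &
  forall M W, admissible M W ->
    J L (fun x => eta x ^+ m.+1 * usq M W x `^ (s / 2)) <= C * M `^ s.

Lemma cbox_powu m M W (e : R) : admissible M W ->
  cbox L (fun x => eta x ^+ m.+1 * usq M W x `^ e).
Proof.
move=> [M0 HW _]; apply: (cbox_cutoff (Om := Om)).
  by apply: cutoff_expn => //; exact: cutoff_eta c1eta eta_supp.
by move=> x Ox; exact: powu_continuous.
Qed.

Lemma grad_bound2 : grad_bound 2.
Proof.
have [C C0 HC] := energy_start; exists 1, C => // M W adm.
have [M0 _ _] := adm; rewrite powR_mulrn ?(ltW M0)//.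
rewrite (_ : (fun x => _) = (fun x => eta x ^+ 2 * usq M W x)); first exact: HC.
by apply/funext => x; rewrite divff// powRr1// ltW// usq_gt0.
Qed.

(** Because [usq M W >= M ^+ 2], the missing factor, [M] to the power [s - s'], is absorbed by
    [usq M W] to the power [(s - s') / 2]. *)
Lemma grad_bound_le s s' : s' <= s -> grad_bound s -> grad_bound s'.
Proof.
move=> ss' [m [C C0 HC]]; exists m, C => // M W adm.
have [M0 _ _] := adm.
have Ms : 0 < M `^ (s - s') by exact: powR_gt0.
rewrite -(ler_pM2r Ms) -mulrA -powRD; last by rewrite (gt_eqF M0) implybT.
rewrite (_ : s' + (s - s') = s); last by ring.
rewrite [leLHS]mulrC -(JZ L0); last exact: cbox_powu.
apply: le_trans (HC M W adm).
apply: (le_J L0); [by apply: cboxZ; exact: cbox_powu|exact: cbox_powu|] => x.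
have /andP[e0 _] := eta01 x.
rewrite mulrCA; apply: ler_wpM2l; first exact: exprn_ge0.
have u0 := usq_gt0 W x M0.
have -> : usq M W x `^ (s / 2) = usq M W x `^ ((s - s') / 2) * usq M W x `^ (s' / 2).
  by rewrite -powRD ?(gt_eqF u0) ?implybT//; congr (_ `^ _); field.
apply: ler_wpM2r; first exact: powR_ge0.
have -> : M `^ (s - s') = (M ^+ 2) `^ ((s - s') / 2).
  by rewrite -powR_mulrn ?(ltW M0)// -powRrM; congr (_ `^ _); field.
apply: ge0_ler_powR; rewrite ?nnegrE ?sqr_ge0 ?(ltW u0)//.
  by rewrite divr_ge0// subr_ge0.
by rewrite /usq lerDl gradsq_ge0.
Qed.

Lemma le_sqrt_usq M W x i : 0 < M -> `|pderiv i W x| <= usq M W x `^ 2^-1.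
Proof.
move=> M0; have u0 := usq_gt0 W x M0.
have h : `|pderiv i W x| ^+ 2 <= (usq M W x `^ 2^-1) ^+ 2.
  rewrite powR12_sqrt ?(ltW u0)// sqr_sqrtr ?(ltW u0)// real_normK ?num_real//.
  rewrite /usq /gradsq (bigD1 i)//= addrCA lerDl addr_ge0 ?sqr_ge0// sumr_ge0// => j _.
  exact: sqr_ge0.
by move: h; rewrite ler_pXn2r// nnegrE// powR_ge0.
Qed.

Lemma dusq_bound M W x j : 0 < M -> delta_convex delta Om W -> Om x ->
  `|dusq W j x| <= 2 * n%:R * (1 + n%:R * delta) * usq M W x `^ 2^-1 * lap W x.
Proof.
move=> M0 HW Ox; rewrite /dusq; apply: le_trans (ler_norm_sum _ _ _) _.
rewrite (_ : 2 * n%:R * _ * _ * _ =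
  \sum_(i < n) 2 * usq M W x `^ 2^-1 * ((1 + n%:R * delta) * lap W x)); last first.
  by rewrite sumr_const card_ord -mulr_natl; ring.
apply: ler_sum => i _; rewrite !normrM gtr0_norm//.
apply: ler_pM.
- by rewrite mulr_ge0.
- exact: normr_ge0.
- by rewrite ler_pM2l//; exact: le_sqrt_usq.
- exact: hessian_bound.
Qed.

Lemma dusq_dot W x : \sum_j dusq W j x * pderiv j W x =
  2 * \sum_i \sum_j pderiv i W x * pderiv j W x * pderiv j (pderiv i W) x.
Proof.
rewrite mulr_sumr; under eq_bigr do rewrite /dusq mulr_suml.
rewrite exchange_big /=; apply: eq_bigr => i _; rewrite mulr_sumr; apply: eq_bigr => j _; ring.
Qed.

(* [Vs] is the vector field [u^((s-1)/2) grad W] and [Gs] is [u^(s/2)]; the prefix [d] marks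
   their partial derivatives. *)
Definition Gs (s M : R) W x := usq M W x `^ (s / 2).
Definition dGs (s M : R) W i x := s / 2 * usq M W x `^ (s / 2 - 1) * dusq W i x.
Definition Vs (s M : R) W i x := usq M W x `^ ((s - 1) / 2) * pderiv i W x.
Definition dVs (s M : R) W i j x :=
  (s - 1) / 2 * usq M W x `^ ((s - 1) / 2 - 1) * dusq W j x * pderiv i W x +
  usq M W x `^ ((s - 1) / 2) * pderiv j (pderiv i W) x.

(** Differentiating the power of [usq] produces the Hessian form at [grad W]; its possible negative
    part is a fraction of the [lap W] term, since [gradsq W <= usq M W]. *)
Lemma div_Vs_lower s M W x : 1 <= s -> 0 < M -> delta_convex delta Om W -> Om x ->
  (1 - (s - 1) * delta) * (usq M W x `^ ((s - 1) / 2) * lap W x) <= \sum_i dVs s M W i i x.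
Proof.
move=> s1 M0 HW Ox; have u0 := usq_gt0 W x M0; have l0 := lap_ge0 HW Ox.
set p := usq M W x `^ ((s - 1) / 2 - 1).
set q := usq M W x `^ ((s - 1) / 2).
have qE : q = p * usq M W x.
  by rewrite -[in RHS](powRr1 (ltW u0)) /p -powRD ?subrK// (gt_eqF u0) implybT.
have p0 : 0 < p by exact: powR_gt0.
have -> : \sum_i dVs s M W i i x = (s - 1) * p *
    (\sum_i \sum_j pderiv i W x * pderiv j W x * pderiv j (pderiv i W) x) + q * lap W x.
  transitivity ((s - 1) / 2 * p * (\sum_j dusq W j x * pderiv j W x) + q * lap W x).
    rewrite /lap !mulr_sumr -big_split /=; apply: eq_bigr => i _.
    by rewrite /dVs -/p -/q -!mulrA.
  rewrite dusq_dot; move: (\sum_i \sum_j _) (lap W x) => F l; by field.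
have := hessian_form (grad W x) HW Ox.
have -> : sqn (grad W x) = gradsq W x by apply: eq_bigr => i _; rewrite mxE.
under [X in _ <= X -> _]eq_bigr do under eq_bigr do rewrite !mxE.
set F := (\sum_i \sum_j _) => h.
have g0 := gradsq_ge0 W x.
have gu : gradsq W x <= usq M W x by rewrite lerDr sqr_ge0.
have h1 : p * (- delta * lap W x * gradsq W x) <= p * F by rewrite ler_pM2l.
have h2 : delta * lap W x * (p * gradsq W x) <= delta * lap W x * q.
  by rewrite qE; apply: ler_wpM2l; [rewrite mulr_ge0|rewrite ler_pM2l].
have h3 : - (delta * lap W x * q) <= p * F by apply: le_trans h1; move: h2; lra.
have h4 : (s - 1) * (- (delta * lap W x * q)) <= (s - 1) * (p * F).
  by apply: ler_wpM2l => //; rewrite subr_ge0.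
by move: h4; lra.
Qed.

(** In the derivative of the cut-off [Gs], the second-order terms are bounded by a multiple of
    [lap W], which the divergence of the cut-off [Vs] controls from above. Keeping that divergence
    whole matters: its integral is zero. *)
Lemma energy_pointwise s m (E : R) : 1 <= s -> (s - 1) * delta < 1 -> 0 <= E ->
  (forall i x, `|pderiv i eta x| <= E) ->
  exists C1 C2 : R, [/\ 0 < C1, 0 <= C2 & forall M W x, admissible M W ->
    \sum_i `|dcut eta m.+1 (Gs s M W) (dGs s M W) i x| <=
    C1 * (eta x ^+ m.+1 * Gs s M W x) +
    C2 * \sum_i dcut eta m.+1 (Vs s M W i) (dVs s M W i) i x].
Proof.
move=> s1 sd E0 HE.
pose kap := 1 - (s - 1) * delta.
have k0 : 0 < kap by rewrite subr_gt0.
have s0 : 0 <= s by exact: le_trans s1.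
(* [B] collects the second-order terms and [A] the terms with the gradient of [eta]; the 1 added
   below makes the constant positive. *)
pose B := n%:R * (s * n%:R * (1 + n%:R * delta)).
have B0 : 0 <= B by rewrite !mulr_ge0// addr_ge0// mulr_ge0.
pose A := n%:R * (m.+2%:R * E).
have A0 : 0 <= A by rewrite !mulr_ge0.
exists (A + B / kap * A + 1), (B / kap); split.
- by rewrite ltr_wpDl// addr_ge0// mulr_ge0// divr_ge0// ltW.
- by rewrite divr_ge0// ltW.
move=> M W x [M0 HW WM].
have [e0|e0] := eqVneq (eta x) 0.
  rewrite !big1 ?e0 => [|i _|i _]; rewrite /dcut ?e0 ?exprS ?mul0r ?mulr0 ?mul0r ?addr0 ?normr0//.
have Ox := supp_Om e0.
have /andP[ep _] := eta01 x.
have l0 := lap_ge0 HW Ox.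
have u0 := usq_gt0 W x M0.
have w_le i := le_sqrt_usq W x i M0.
have du_le i := dusq_bound i M0 HW Ox.
have divV := div_Vs_lower s1 M0 HW Ox.
set r := usq M W x `^ 2^-1 in w_le du_le.
set q := usq M W x `^ ((s - 1) / 2) in divV.
set t := eta x ^+ m.+1.
have r0 : 0 < r by exact: powR_gt0.
have q0 : 0 < q by exact: powR_gt0.
have t0 : 0 <= t by exact: exprn_ge0.
have GE : Gs s M W x = q * r.
  rewrite /Gs /q /r -powRD; last by rewrite (gt_eqF u0) implybT.
  by congr (_ `^ _); field.
have pE : usq M W x `^ (s / 2 - 1) * r = q.
  rewrite /q /r -powRD; last by rewrite (gt_eqF u0) implybT.
  by congr (_ `^ _); field.
have te : eta x ^+ m.+2 = t * eta x by rewrite exprSr.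
set ql := q * lap W x in divV.
have ql0 : 0 <= ql by rewrite mulr_ge0// ltW.
have cross i (b : R) : `|b| <= q * r ->
    `|m.+2%:R * t * pderiv i eta x * b| <= m.+2%:R * E * (t * (q * r)).
  move=> hb; rewrite !normrM (ger0_norm t0) normr_nat.
  rewrite [leRHS](_ : _ = m.+2%:R * t * E * (q * r)); last by ring.
  apply: ler_pM => //; first by rewrite !mulr_ge0.
  by apply: ler_wpM2l; [rewrite mulr_ge0|exact: HE].
have term i : `|dcut eta m.+1 (Gs s M W) (dGs s M W) i x| <=
    m.+2%:R * E * (t * (q * r)) + s * n%:R * (1 + n%:R * delta) * (t * eta x * ql).
  rewrite /dcut te -/t; apply: le_trans (ler_normD _ _) _; apply: lerD.
    by apply: cross; rewrite GE ger0_norm// mulr_ge0// ltW.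
  rewrite normrM (ger0_norm (mulr_ge0 t0 ep)).
  rewrite [leRHS](_ : _ = t * eta x * (s * n%:R * (1 + n%:R * delta) * ql)); last by ring.
  apply: ler_wpM2l; first by rewrite mulr_ge0.
  rewrite /dGs normrM (ger0_norm (mulr_ge0 (_ : 0 <= s / 2) (powR_ge0 _ _))) ?divr_ge0//.
  apply: le_trans (ler_wpM2l (mulr_ge0 (_ : 0 <= s / 2) (powR_ge0 _ _)) (du_le i)) _.
    by rewrite divr_ge0.
  rewrite /ql -pE; move: (usq M W x `^ (s / 2 - 1)) (lap W x) => p l.
  by rewrite le_eqVlt; apply/orP; left; apply/eqP; field.
have L1 : \sum_i `|dcut eta m.+1 (Gs s M W) (dGs s M W) i x| <= A * (t * (q * r)) + B * (t * eta x * ql).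
  apply: le_trans (ler_sum _ (fun i _ => term i)) _.
  by rewrite sumr_const card_ord -[_ *+ n]mulr_natl /A /B mulrDr !mulrA.
have term2 i : t * eta x * dVs s M W i i x - m.+2%:R * E * (t * (q * r)) <=
    dcut eta m.+1 (Vs s M W i) (dVs s M W i) i x.
  rewrite /dcut te -/t.
  have hb : `|Vs s M W i x| <= q * r.
    by rewrite /Vs -/q normrM (gtr0_norm q0) ler_pM2l//; exact: w_le.
  have := cross i _ hb; rewrite ler_norml => /andP[h _].
  by rewrite [leRHS]addrC lerD2l.
have L2 : kap * (t * eta x * ql) <= \sum_i dcut eta m.+1 (Vs s M W i) (dVs s M W i) i x + A * (t * (q * r)).
  rewrite -lerBlDr; apply: le_trans (ler_sum _ (fun i _ => term2 i)).
  rewrite big_split /= -mulr_sumr sumrN sumr_const card_ord -[_ *+ n]mulr_natl.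
  rewrite (_ : n%:R * _ = A * (t * (q * r))); last by rewrite /A; ring.
  rewrite lerD2r mulrCA; apply: ler_wpM2l; first by rewrite mulr_ge0.
  exact: divV.
rewrite GE; move: L1 L2.
set S1 := \sum_i `|_|; set S2 := \sum_i _; set X := t * (q * r); set Y := t * eta x * ql => L1 L2.
have X0 : 0 <= X by apply: mulr_ge0 t0 _; rewrite ltW// mulr_gt0.
have h : B * Y <= B / kap * (S2 + A * X).
  rewrite -mulrA; apply: ler_wpM2l => //.
  by rewrite ler_pdivlMl.
apply: le_trans L1 _; apply: (@le_trans _ _ (A * X + B / kap * (S2 + A * X))); first by rewrite lerD2l.
rewrite [leRHS](_ : _ = A * X + B / kap * (S2 + A * X) + X); last by ring.
by rewrite lerDl.
Qed.

Lemma Gs_continuous s M W x : 0 < M -> delta_convex delta Om W -> Om x ->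
  {for x, continuous (Gs s M W)}.
Proof. by move=> M0 HW Ox; exact: powu_continuous. Qed.

Lemma Vs_regular s M W : 0 < M -> delta_convex delta Om W ->
  [/\ forall i x, Om x -> {for x, continuous (Vs s M W i)},
     forall i j x, Om x -> {for x, continuous (dVs s M W i j)} &
     forall i j x, Om x -> is_derive x (evec R j) (Vs s M W i) (dVs s M W i j x)].
Proof.
move=> M0 HW; split=> [i x Ox|i j x Ox|i j x Ox].
- exact: (continuous_atM (powu_continuous HW _ M0 Ox) (dc_continuous1 HW i Ox)).
- apply: (continuous_atD (continuous_atM (dpowu_continuous HW _ j M0 Ox) (dc_continuous1 HW i Ox))).
  exact: (continuous_atM (powu_continuous HW _ M0 Ox) (dc_continuous2 HW i j Ox)).
- exact: (is_derive_mul (powu_derive HW _ j M0 Ox) (dc_derive2 HW i j Ox)).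
Qed.

(** Integration removes the divergence from [energy_pointwise], leaving the bound on the gradient
    that [sobolev] asks for. The factor [1 + 1 / (k + 1)] is [n / (n - 1)]. *)
Lemma grad_bound_step s : 1 <= s -> (s - 1) * delta < 1 -> grad_bound s ->
  grad_bound (s * (1 + k.+1%:R^-1)).
Proof.
move=> s1 sd [m [C C0 HC]].
set th : R := 1 + k.+1%:R^-1.
have th0 : 0 < th by rewrite addr_gt0// invr_gt0.
have th2 : th <= 2.
  have -> : (2 : R) = 1 + 1 by [].
  by rewrite /th lerD2l invf_le1 ?ltr0n// ler1n.
have [E E0 HE] : exists2 E : R, 0 <= E & forall i x, `|pderiv i eta x| <= E.
  have H i : exists E : R, 0 <= E /\ forall x, `|pderiv i eta x| <= E.
    by have [E E0 HE] := cbox_bounded L0 (c1eta.2 i).2; exists E.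
  have [f Hf] := choice H.
  exists (\sum_i f i) => [|i x]; first by apply: sumr_ge0 => i _; exact: (Hf i).1.
  apply: le_trans ((Hf i).2 x) _; rewrite (bigD1 i)//= lerDl.
  by apply: sumr_ge0 => j _; exact: (Hf j).1.
have [C1 [C2 [C10 C20 Hpw]]] := energy_pointwise m s1 sd E0 HE.
(* As [0 <= eta <= 1] and [th <= 2], the power [2 * m.+2] of [eta] is at most the power [th] of
   [eta ^+ m.+2]; [grad_bound] adds one to its witness. *)
exists (2 * m.+1).+1, ((C1 * C) `^ th) => [|M W adm].
  by apply: powR_gt0; rewrite mulr_gt0.
have [M0 HW WM] := adm.
have [c1G EG] := cbox1_cutoff c1eta eta_supp m.+1 (fun x => @Gs_continuous s M W x M0 HW)
  (fun i x => @dpowu_continuous W HW M (s / 2) i x M0) (fun i x => @powu_derive W HW M (s / 2) i x M0).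
have [cV cdV dV] := Vs_regular s M0 HW.
have [cdiv Jdiv] := J_div_cutoff L0 c1eta eta_supp m.+1 cV cdV dV.
set g := (fun x => eta x ^+ m.+2 * _) in c1G EG.
have cb0 := cbox_powu m (s / 2) adm.
have Jg : J L (gradl1 g) <= C1 * C * M `^ s.
  apply: (@le_trans _ _ (J L (fun x => C1 * (eta x ^+ m.+1 * usq M W x `^ (s / 2)) +
      C2 * \sum_i dcut eta m.+1 (Vs s M W i) (dVs s M W i) i x))).
    apply: (le_J L0); [exact: cbox_gradl1|by apply: cboxD; exact: cboxZ|] => x.
    rewrite /gradl1; under eq_bigr do rewrite EG.
    exact: Hpw.
  rewrite (JD L0); [|exact: cboxZ|exact: cboxZ]; rewrite !(JZ L0)// Jdiv mulr0 addr0.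
  by rewrite -mulrA ler_pM2l//; exact: HC.
have g0 x : 0 <= g x.
  by have /andP[e0 _] := eta01 x; rewrite /g mulr_ge0 ?exprn_ge0// powR_ge0.
have D0 : 0 < C1 * C * M `^ s by rewrite !mulr_gt0// powR_gt0.
have := sobolev L0 c1G g0 D0 Jg; rewrite -/th.
rewrite powRM; [|by rewrite ltW// mulr_gt0|exact: powR_ge0].
rewrite -powRrM; apply: le_trans.
apply: (le_J L0); [exact: cbox_powu|by apply: cbox_powR => //; exact: c1G.1|] => x.
have /andP[e0 e1] := eta01 x.
have em0 : 0 <= eta x ^+ m.+2 by exact: exprn_ge0.
have u0 := usq_gt0 W x M0.
rewrite /g powRM ?powR_ge0// -powRrM.
rewrite (_ : s * th / 2 = s / 2 * th); last by ring.
apply: ler_wpM2r; first exact: powR_ge0.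
rewrite (_ : (2 * m.+1).+2 = m.+2 * 2)%N; last by rewrite [RHS]mulSn [in RHS]mulnC.
rewrite exprM -powR_mulrn//.
move: em0; rewrite le_eqVlt => /orP[/eqP <-|em0].
  by rewrite !powR0 ?gt_eqF// ltr0n.
apply: ger_powR; last exact: th2.
by rewrite em0 exprn_ile1.
Qed.

Lemma bernoulli_ge (t : R) (j : nat) : 0 <= t -> 1 + j%:R * t <= (1 + t) ^+ j.
Proof.
move=> t0; elim: j => [|j IH]; first by rewrite mul0r addr0 expr0.
rewrite exprS; have : (1 + t) * (1 + j%:R * t) <= (1 + t) * (1 + t) ^+ j.
  by apply: ler_wpM2l => //; rewrite addr_ge0.
have j0 : 0 <= j%:R * (t * t) :> R by rewrite !mulr_ge0.
by rewrite -natr1; lra.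
Qed.

Lemma grad_bound_all (p : R) : 0 < p -> delta < 1 ->
  (p / (1 + k.+1%:R^-1) - 1) * delta < 1 -> grad_bound p.
Proof.
move=> p0 d1 pd; set th : R := 1 + k.+1%:R^-1 in pd *.
have i0 : 0 < k.+1%:R^-1 :> R by rewrite invr_gt0.
have th1 : 1 < th by rewrite ltrDl.
have th0 : 0 < th by exact: lt_trans th1.
(* One step from [T] reaches at least [p]. Both [p / th] and the initial exponent 2 satisfy the step
   condition, the latter by [delta < 1]. *)
pose T := Num.max (p / th) 2.
have Td : (T - 1) * delta < 1.
  have h2 : (2 - 1) * delta < 1 by move: d1; lra.
  by rewrite /T; case: (leP (p / th) 2).
have T2 : 2 <= T by rewrite le_max lexx orbT.
(* The cap at [T] keeps every intermediate exponent within the step condition. *)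
have H j : grad_bound (Num.min (2 * th ^+ j) T).
  elim: j => [|j IH].
    by rewrite expr0 mulr1 min_l//; exact: grad_bound2.
  set s := Num.min _ _ in IH.
  have s2 : 2 <= s.
    by rewrite le_min T2 andbT ler_peMr// exprn_ege1// ltW.
  have sT : s <= T by rewrite ge_min lexx orbT.
  have s1 : 1 <= s by apply: le_trans s2; rewrite ler1n.
  have sd : (s - 1) * delta < 1.
    by apply: le_lt_trans Td; apply: ler_wpM2r => //; rewrite lerD2r.
  apply: grad_bound_le (grad_bound_step s1 sd IH); rewrite -/th /s.
  rewrite exprS ge_min; have [h|h] := leP (2 * th ^+ j) T.
    by apply/orP; left; rewrite mulrCA mulrC.
  by apply/orP; right; rewrite ler_peMr// ltW// (lt_le_trans _ T2).
have TT : 0 <= T by exact: le_trans T2.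
have [j Hj] : exists j : nat, T <= 2 * th ^+ j.
  have h := archi_boundP (divr_ge0 TT (ltW i0)); rewrite ltr_pdivrMr// in h.
  have h2 := bernoulli_ge (Num.bound (T / k.+1%:R^-1)) (ltW i0).
  have h3 := exprn_ge0 (Num.bound (T / k.+1%:R^-1)) (ltW th0).
  exists (Num.bound (T / k.+1%:R^-1)); apply: (le_trans (ltW h)).
  apply: le_trans (le_trans h2 _); first by rewrite lerDr.
  by rewrite ler_peMl// ler1n.
have HT : grad_bound T by have := H j; rewrite min_r.
have T1 : 1 <= T by apply: le_trans T2; rewrite ler1n.
apply: grad_bound_le (grad_bound_step T1 Td HT); rewrite -/th.
by rewrite -ler_pdivrMr// le_max lexx.
Qed.

End energy.

(** * Cutoff functions *)

Section cutoff_construction.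
Variable R : realType.

Definition pos_part (t : R) : R := (t + `|t|) / 2.

Lemma pos_partE t : 0 <= t -> pos_part t = t.
Proof. by move=> t0; rewrite /pos_part ger0_norm//; field. Qed.

Lemma pos_part0 t : t <= 0 -> pos_part t = 0.
Proof. by move=> t0; rewrite /pos_part ler0_norm// subrr mul0r. Qed.

Lemma pos_part_ge0 t : 0 <= pos_part t.
Proof. by have [t0|/ltW t0] := leP 0 t; [rewrite pos_partE|rewrite pos_part0]. Qed.

Lemma le_pos_part t s : 0 <= s -> t <= s -> pos_part t <= s.
Proof. by move=> s0 ts; have [t0|/ltW t0] := leP 0 t; [rewrite pos_partE|rewrite pos_part0]. Qed.

Lemma pos_part_continuous : continuous pos_part.
Proof.
move=> t; have cid : {for t, continuous (fun s : R => s)} by exact: id.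
have cn : {for t, continuous (fun s : R => `|s|)} by exact: norm_continuous.
exact: (continuous_atM (continuous_atD cid cn) (continuous_atC 2^-1)).
Qed.

(** The remainder is at most [h ^+ 2] for each combination of signs of [t] and [t + h]. *)
Lemma is_derive_pos_part_sq (t : R) : is_derive t 1 (fun s => pos_part s ^+ 2) (2 * pos_part t).
Proof.
apply: is_derive_eps => e e0; exists e => // h he.
apply: (@le_trans _ _ (`|h| * `|h|)); last by rewrite ler_wpM2r// ltW.
rewrite -normrM (ger0_norm (_ : 0 <= h * h)) -?expr2 ?sqr_ge0//.
rewrite ler_norml; have [t0|/ltW t0] := leP 0 t.
  rewrite (pos_partE t0); have [th0|/ltW th0] := leP 0 (t + h).
    by rewrite pos_partE//; apply/andP; split; nra.
  by rewrite (pos_part0 th0); apply/andP; split; nra.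
rewrite (pos_part0 t0); have [th0|/ltW th0] := leP 0 (t + h).
  by rewrite pos_partE//; apply/andP; split; nra.
by rewrite (pos_part0 th0); apply/andP; split; nra.
Qed.

Variable n : nat.
Implicit Types a x : 'rV[R]_n.

Lemma is_derive_sqnB a x i :
  is_derive x (evec R i) (fun y => sqn (y - a)) (2 * (x - a) 0 i).
Proof.
apply: line_is_derive.
have -> : (fun t : R => sqn (x + t *: evec R i - a)) =
    (fun t => sqn (x - a) + t * (2 * (x - a) 0 i) + t ^+ 2).
  apply/funext => t; rewrite (_ : x + t *: evec R i - a = (x - a) + t *: evec R i).
    by rewrite sqn_line dot_evec sqn_evec mulr1.
  by rewrite addrAC.
by apply: is_derive_eq; rewrite !scaleRE; ring.
Qed.

(* A [C^1] bump is enough: the cutoff is differentiated only once. *)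
Definition bump (rho : R) a x := pos_part (rho - sqn (x - a)) ^+ 2.

Definition dbump (rho : R) a i x := 2 * pos_part (rho - sqn (x - a)) * - (2 * (x - a) 0 i).

Lemma is_derive_bump rho a x i : is_derive x (evec R i) (bump rho a) (dbump rho a i x).
Proof.
have h : is_derive x (evec R i) (fun y => rho - sqn (y - a)) (- (2 * (x - a) 0 i)).
  have h := is_derive_sqnB a x i; rewrite -[X in is_derive _ _ _ X]add0r.
  exact: is_deriveB.
exact: is_derive_comp_rv h (is_derive_pos_part_sq _).
Qed.

Lemma pos_sqn_continuous rho a x : {for x, continuous (fun y : 'rV[R]_n => pos_part (rho - sqn (y - a)))}.
Proof.
have c1 : {for x, continuous (fun y : 'rV[R]_n => rho - sqn (y - a))}.
  exact: (@continuousB _ _ _ (fun=> rho) (fun y : 'rV[R]_n => sqn (y - a)) x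
    (continuous_atC rho) (@continuous_sqnB R n a x)).
apply: (@continuous_comp _ _ _ (fun y : 'rV[R]_n => rho - sqn (y - a)) pos_part x c1).
exact: pos_part_continuous.
Qed.

Lemma dbump_continuous rho a i x : {for x, continuous (dbump rho a i)}.
Proof.
have cc : {for x, continuous (fun y : 'rV[R]_n => (y - a) 0 i)}.
  under [X in {for _, continuous X}]eq_fun do rewrite !mxE.
  apply: (@continuous_atD _ _ (fun y : 'rV[R]_n => y 0 i) (fun=> - a 0 i)).
    exact: coord_continuous.
  exact: continuous_atC.
apply: (continuous_atM (continuous_atM (continuous_atC 2) (@pos_sqn_continuous rho a x))).
have -> : (fun y => - (2 * (y - a) 0 i)) = (fun y => - 2 * (y - a) 0 i).
  by apply/funext => y; rewrite mulNr.
exact: (continuous_atM (continuous_atC (- 2)) cc).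
Qed.

Lemma bump_continuous rho a x : {for x, continuous (bump rho a)}.
Proof.
exact: (continuous_atM (@pos_sqn_continuous rho a x) (@pos_sqn_continuous rho a x)).
Qed.

Lemma bump_supp rho a x : rho <= sqn (x - a) -> bump rho a x = 0 /\ forall i, dbump rho a i x = 0.
Proof.
move=> h; have p0 : pos_part (rho - sqn (x - a)) = 0 by rewrite pos_part0// subr_le0.
by rewrite /bump /dbump p0 expr0n /= mulr0; split => // i; rewrite mul0r.
Qed.

(** A normalised sum of bumps centred at finitely many points of [Om']. A positive lower bound [c]
    on [Om'] replaces the value 1; its powers go into the final constant. *)
Lemma cutoff_exists (Om' Om : set 'rV[R]_n) (r : R) : 0 < r -> compact (closure Om') ->
  (forall x z, Om' x -> `|z - x| <= r -> Om z) ->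
  exists L c : R, exists eta : 'rV[R]_n -> R,
    [/\ 0 < L, 0 < c, cbox1 L eta, (forall x, Om x \/ \forall y \near x, eta y = 0) &
      [/\ (forall x, 0 <= eta x <= 1), (forall x, Om' x -> c <= eta x) &
        (forall x, eta x != 0 -> exists2 a, Om' a & `|x - a| <= r)]].
Proof.
move=> r0 cK HO.
(* With bumps of radius [r / 2], a point farther than [r] from all centres has a neighbourhood where
   they all vanish. *)
pose r1 := r / 2; have r10 : 0 < r1 by rewrite divr_gt0.
pose rho := r1 ^+ 2; have rho0 : 0 < rho by rewrite exprn_gt0.
have rho20 : 0 < rho / 2 by rewrite divr_gt0.
have far a x : r1 < `|x - a| -> rho <= sqn (x - a).
  move=> h; apply: le_trans (norm_sqn _).
  by rewrite ler_pXn2r ?nnegrE ?(ltW r10) ?(ltW h) ?(ltW (lt_trans r10 h)).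
have near_lt a y : sqn (y - a) < rho / 2 -> \forall z \near y, sqn (z - a) < rho / 2.
  exact: (cvgr_lt _ (@continuous_sqnB R n a y)).
have : cover_compact (closure Om') by rewrite -compact_cover.
(* The cover uses half the squared radius, where a bump is at least [(rho / 2) ^+ 2]. *)
move=> /(_ 'rV[R]_n Om' (fun a => [set y | sqn (y - a) < rho / 2])) [].
- by move=> a _; rewrite openE => y; exact: near_lt.
- move=> y cy; have [|a [Oa ay]] := cy _ (near_lt y y _).
    by rewrite subrr /sqn big1// => i _; rewrite mxE expr0n.
  exists a => //=.
  by rewrite (_ : sqn (y - a) = sqn (a - y))// /sqn; apply: eq_bigr => i _; rewrite !mxE; ring.
move=> D DO Dcov.
pose s : seq 'rV[R]_n := finmap.enum_fset D; pose m := size s.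
pose pt (j : 'I_m) := s`_j.
have ptO j : Om' (pt j).
  by have := DO (pt j); rewrite inE; apply; exact: mem_nth.
(* Each of the [m] bumps is at most [rho ^+ 2]; the 1 keeps [N] positive for an empty cover. *)
pose N := 1 + m%:R * rho ^+ 2.
have N0 : 0 < N by rewrite ltr_pwDl// mulr_ge0// sqr_ge0.
pose eta x := N^-1 * \sum_(j < m) bump rho (pt j) x.
pose deta i x := N^-1 * \sum_(j < m) dbump rho (pt j) i x.
have b0 a x : 0 <= bump rho a x by exact: sqr_ge0.
have eta_far x : (forall j, rho <= sqn (x - pt j)) -> eta x = 0 /\ forall i, deta i x = 0.
  move=> h; rewrite /eta /deta big1 ?mulr0 => [|j _]; last exact: (bump_supp (h j)).1.
  by split=> // i; rewrite big1 ?mulr0// => j _; exact: (bump_supp (h j)).2.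
have d_eta x i : is_derive x (evec R i) eta (deta i x).
  have h := is_derive_sumf (fun j => is_derive_bump rho (pt j) x i).
  exact: is_deriveZ.
have pdE i : pderiv i eta = deta i.
  by apply/funext => x; have [_ e] := d_eta x i; exact: e.
have [M [Mr HM]] := compact_bounded cK.
pose M1 := `|M| + 1.
have HM1 x : Om' x -> `|x| <= M1.
  move=> Ox; apply: (HM M1); last exact: subset_closure.
  by rewrite /M1; apply: le_lt_trans (ler_norm M) _; rewrite ltrDl.
pose L := M1 + r.
have M10 : 0 < M1 by rewrite ltr_wpDl.
have Lfar x : L <= `|x| -> forall j, rho <= sqn (x - pt j).
  move=> Lx j; apply: far.
  have h := HM1 _ (ptO j).
  have : `|x| <= `|x - pt j| + `|pt j| by rewrite -{1}(subrK (pt j) x) ler_normD.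
  by move: Lx; rewrite /L /r1; lra.
exists L, ((rho / 2) ^+ 2 / N), eta; split.
- by rewrite addr_gt0.
- by rewrite divr_gt0// exprn_gt0.
- split; first split.
  + move=> x; apply: (continuous_atM (continuous_atC N^-1)).
    by apply: continuous_at_sum => j; exact: bump_continuous.
  + by move=> x /Lfar /eta_far [].
  + move=> i; split; first by move=> x; have [d _] := d_eta x i.
    rewrite pdE; split.
      move=> x; apply: (continuous_atM (continuous_atC N^-1)).
      by apply: continuous_at_sum => j; exact: dbump_continuous.
    by move=> x /Lfar /eta_far [_].
- move=> x; have [[j hj]|h] := pselect (exists j, `|x - pt j| <= r).
    by left; exact: HO (ptO j) hj.
  right; have : \forall y \near x, `|y - x| < r1.
    apply/nbhs_ballP; exists r1 => // y; rewrite -ball_normE /= distrC.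
    exact.
  apply: filterS => y yx; apply: (eta_far y _).1 => j; apply: far.
  rewrite ltNge; apply/negP => h2; apply: h; exists j.
  have -> : x - pt j = (y - pt j) - (y - x) by rewrite opprB [RHS]addrC addrA subrK.
  apply: le_trans (ler_normB _ _) _; rewrite /r1 in h2 yx; lra.
split.
- move=> x; rewrite /eta mulr_ge0 ?invr_ge0 ?(ltW N0) ?sumr_ge0//=.
  rewrite ler_pdivrMl// mulr1 /N; apply: (@le_trans _ _ (m%:R * rho ^+ 2)); last by rewrite lerDr.
  rewrite (_ : m%:R * _ = \sum_(j < m) rho ^+ 2); last by rewrite sumr_const card_ord mulr_natl.
  apply: ler_sum => j _; rewrite ler_pXn2r ?nnegrE ?pos_part_ge0 ?(ltW rho0)//.
  by apply: le_pos_part; [exact: ltW|rewrite gerBl sqn_ge0].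
- move=> x Ox; have [a aD /= xa] := Dcov x (subset_closure Ox).
  have ai : (index a s < m)%N by rewrite index_mem.
  have ja : pt (Ordinal ai) = a by rewrite /pt /= nth_index.
  rewrite mulrC /eta ler_wpM2l ?invr_ge0 ?(ltW N0)// (bigD1 (Ordinal ai))//= ja.
  apply: (@le_trans _ _ (bump rho a x)); last by rewrite lerDl sumr_ge0.
  have h : rho / 2 <= rho - sqn (x - a) by move: xa; lra.
  rewrite /bump pos_partE; last exact: le_trans (ltW rho20) h.
  by rewrite ler_pXn2r// nnegrE ?(ltW rho20)// (le_trans (ltW rho20)).
- move=> x; apply: contra_neqP => h; apply: (eta_far x _).1 => j; apply: far.
  rewrite ltNge; apply/negP => h2; apply: h; exists (pt j) => //.
  by apply: le_trans h2 _; rewrite /r1; move: r0; lra.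
Qed.

End cutoff_construction.

(** * The gradient estimate below the critical exponent *)

(** The quotient is the exponent before the last Sobolev step; the step condition for it, solved for
    [p], is [p < p_crit]. *)
Lemma p_crit_exponent (R : realType) (k : nat) (delta p : R) : 0 <= delta -> 0 < p ->
  delta = 0 \/ p < p_crit k.+2 delta -> (p / (1 + k.+1%:R^-1) - 1) * delta < 1.
Proof.
move=> d0 p0; have k0 : 0 < k.+1%:R :> R by rewrite ltr0n.
have -> : p / (1 + k.+1%:R^-1) = p * k.+1%:R / k.+2%:R.
  rewrite (_ : 1 + _ = k.+2%:R / k.+1%:R); first by rewrite invf_div mulrA.
  by rewrite -[k.+2%:R]natr1 mulrDl divff ?gt_eqF// mul1r.
case=> [->|]; first by rewrite mulr0.
(* The second alternative does not exclude [delta = 0], where division by zero gives [p_crit] the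
   value 0. *)
have [->|dn0] := eqVneq delta 0; first by rewrite mulr0.
have dp : 0 < delta by rewrite lt_neqAle eq_sym dn0.
have k20 : 0 < k.+2%:R :> R by rewrite ltr0n.
rewrite /p_crit (_ : k.+2%:R - 1 = k.+1%:R); last by rewrite -natr1 addrK.
rewrite ltr_pdivlMr ?mulr_gt0// => h.
rewrite mulrBl mul1r ltrBlDr mulrAC ltr_pdivrMr//.
by rewrite -mulrA [ltRHS]mulrC.
Qed.

Section gradient_estimate.
Variables (R : realType) (k : nat) (delta : R) (Om Om' : set 'rV[R]_k.+2).
Notation n := k.+2.
Hypotheses (n3 : (3 <= n)%N) (delta0 : 0 <= delta) (deltan : delta < (n%:R - 2)^-1).
Hypotheses (oOm : open Om) (cOm : compactly_contained Om' Om).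

Lemma gradient_estimate (p : R) : 0 < p -> delta = 0 \/ p < p_crit n delta ->
  exists C2 : R, 0 < C2 /\ forall W, delta_convex delta Om W ->
    (poweR (int_over Om' (fun x => (enorm (grad W x) `^ p)%:E)) p^-1
       <= C2%:E * abs_int Om W)%E.
Proof.
move=> p0 pc.
have nR : 3 <= n%:R :> R by rewrite (ler_nat R 3 n).
have n2 : 0 < n%:R - 2 :> R by move: nR; lra.
have d1 : delta < 1.
  by apply: lt_le_trans deltan _; rewrite invf_le1//; move: nR; lra.
have [r [C [r0 C0 HO HC]]] := local_sup_bound n3 delta0 deltan oOm cOm.
have [L [c [eta [L0 c0 c1eta eta_supp [eta01 etac etaO]]]]] := cutoff_exists r0 cOm.1 HO.
have [m [K K0 HK]] := grad_bound_all delta0 oOm L0 c1eta eta_supp eta01 p0 d1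
  (p_crit_exponent delta0 p0 pc).
pose B := (c ^+ m.+1)^-1 * K.
have B0 : 0 < B by rewrite mulr_gt0// invr_gt0 exprn_gt0.
have key W M : admissible delta Om eta M W ->
    (poweR (int_over Om' (fun x => (enorm (grad W x) `^ p)%:E)) p^-1 <= (B `^ p^-1 * M)%:E)%E.
  move=> adm; have [M0 HW _] := adm.
  have cb := cbox_powu c1eta eta_supp m (p / 2) adm.
  have le1 : (int_over Om' (fun x => (enorm (grad W x) `^ p)%:E) <= (B * M `^ p)%:E)%E.
    (* This majorant is continuous and vanishes outside a cube, so its integral equals [J]. *)
    apply: (@le_trans _ _ (leb_int (fun x =>
        ((c ^+ m.+1)^-1 * (eta x ^+ m.+1 * usq M W x `^ (p / 2)))%:E))).
      apply: le_leb_int => x; first by case: ifP => // _; rewrite lee_fin powR_ge0.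
      have e0 : 0 <= eta x by have /andP[] := eta01 x.
      case: ifPn => [/asboolP Ox|_]; last first.
        by rewrite lee_fin !mulr_ge0 ?invr_ge0 ?exprn_ge0 ?powR_ge0// ltW.
      rewrite lee_fin enorm_powR mulrA.
      have s0 : 0 <= sqn (grad W x) by exact: sqn_ge0.
      have su : sqn (grad W x) <= usq M W x.
        rewrite /usq (_ : sqn _ = gradsq W x) ?lerDr ?sqr_ge0//.
        by apply: eq_bigr => i _; rewrite mxE.
      apply: (@le_trans _ _ (usq M W x `^ (p / 2))).
        have p20 : 0 <= p / 2 by rewrite divr_ge0// ltW.
        by apply: (ge0_ler_powR p20); rewrite ?nnegrE//; exact: le_trans s0 su.
      apply: ler_peMl; first exact: powR_ge0.
      rewrite mulrC ler_pdivlMr ?exprn_gt0// mul1r.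
      by rewrite ler_pXn2r ?nnegrE ?(ltW c0)//; exact: etac.
    rewrite (leb_int_J L0 (cboxZ _ cb)) (JZ L0 _ cb) lee_fin /B -mulrA.
    by rewrite ler_wpM2l ?invr_ge0 ?exprn_ge0 ?(ltW c0)//; exact: HK.
  have i0 : (0 <= int_over Om' (fun x => (enorm (grad W x) `^ p)%:E))%E.
    by apply: leb_int_ge0 => x; case: ifP => // _; rewrite lee_fin powR_ge0.
  apply: le_trans (gt0_ler_poweR _ _ _ le1) _.
  - by rewrite invr_ge0 ltW.
  - by rewrite in_itv /= i0 leey.
  - by rewrite in_itv /= leey andbT lee_fin mulr_ge0 ?powR_ge0// ltW.
  rewrite poweR_EFin powRM ?powR_ge0 ?(ltW B0)//.
  by rewrite -powRrM divff ?gt_eqF// powRr1// ltW.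
have Bp0 : 0 < B `^ p^-1 by rewrite powR_gt0.
exists (B `^ p^-1 * C); split; first by rewrite mulr_gt0.
move=> W HW.
have := abs_int_ge0 Om W.
case Ei : (abs_int Om W) => [I| |] // I0; last by rewrite gt0_muley ?leey// lte_fin mulr_gt0.
rewrite -EFinM; apply/lee_addgt0Pr => e e0.
(* The added term makes [M] positive even for [I = 0] and contributes exactly [e] to the final
   bound. *)
have M0 : 0 < C * I + e / B `^ p^-1.
  by rewrite ltr_wpDl ?mulr_ge0 ?divr_gt0// ltW.
apply: le_trans (key W (C * I + e / B `^ p^-1) _) _; last first.
  by rewrite -EFinD lee_fin mulrDr mulrA [_ * (e / _)]mulrC divfK// gt_eqF.
split=> // x /etaO [a Oa xa].
have Wx : `|W x| <= C * I by apply: HC Oa xa => //; rewrite Ei.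
by apply: le_trans Wx _; rewrite lerDl ltW// divr_gt0.
Qed.

End gradient_estimate.

Theorem theorem1p1 (R : realType) (n : nat) (delta : R)
    (Om Om' : set 'rV[R]_n) :
  (3 <= n)%N ->
  0 <= delta -> delta < (n%:R - 2)^-1 ->
  open Om ->
  domain Om' -> compactly_contained Om' Om ->
  (exists C1 : R, 0 < C1 /\
     forall W : 'rV[R]_n -> R, delta_convex delta Om W ->
       (holder_norm ((1 + (2 - n%:R) * delta) / (1 + delta)) Om' W
          <= C1%:E * int_over Om (fun x => (`|W x|)%:E))%E) /\
  (forall p : R, 0 < p -> (delta = 0 \/ p < p_crit n delta) ->
     exists C2 : R, 0 < C2 /\
       forall W : 'rV[R]_n -> R, delta_convex delta Om W ->
         (poweR (int_over Om' (fun x => (enorm (grad W x) `^ p)%:E)) p^-1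
            <= C2%:E * int_over Om (fun x => (`|W x|)%:E))%E).
Proof.
move=> n3 delta0 deltan oOm _ cOm; split; first exact: holder_estimate.
case: n Om Om' n3 deltan oOm cOm => [|[|k]]// Om Om' n3 deltan oOm cOm p p0 pc.
exact: gradient_estimate.
Qed.
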